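(* Let $S\subset\mathbb{R}^2$ be a square of side-length $\pi$. There exists $h_9^*>0$ such that the ninth Robin eigenvalue $\lambda_{9,h}(S)$ is Courant-sharp for $0\le h\le h_9^*$ and not Courant-sharp for $h>h_9^*$.
   Context: For a bounded, connected, open set $\Omega\subset\mathbb{R}^2$ with Lipschitz boundary and $h\in[0,+\infty)$, the Robin eigenvalues $\lambda_{k,h}(\Omega)$, $k\ge 1$, listed in non-decreasing order with multiplicity, are the numbers for which there is a non-zero $u_k\in H^1(\Omega)$ with $-\Delta u_k=\lambda_{k,h}(\Omega)u_k$ in $\Omega$ and $\frac{\partial}{\partial\nu}u_k+h\,u_k=0$ on $\partial\Omega$, where $\nu$ is the outward-pointing unit normal. The nodal domains of an eigenfunction $u$ are the connected components of $\Omega\setminus\overline{u^{-1}(0)}$. The eigenvalue $\lambda_{k,h}(\Omega)$ is called Courant-sharp if it has a corresponding (real-valued) eigenfunction with exactly $k$ nodal domains. *)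

(* Defs.v *)
From HB Require Import structures.
From mathcomp Require Import all_boot all_order all_algebra.
From mathcomp Require Import all_classical all_reals all_analysis.
Import Order.TTheory GRing.Theory Num.Theory numFieldNormedType.Exports.
Set Implicit Arguments.
Unset Strict Implicit.
Unset Printing Implicit Defensive.
Local Open Scope classical_set_scope.
Local Open Scope ring_scope.

Notation area := (lebesgue_measure \x lebesgue_measure)%E.

Definition L2 (R : realType) (A : set (R * R)) (f : R * R -> R) : Prop :=
  measurable_fun A f /\ (\int[area]_(x in A) ((f x) ^+ 2)%:E < +oo)%E.

(* Coordinate directions are indexed by [bool]. *)
Definition axis (R : realType) (i : bool) : R * R :=
  if i then (0, 1) else (1, 0).

Definition partial (R : realType) (i : bool) (f : R * R -> R) : R * R -> R :=
  fun x => 'D_(axis R i) f x.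

Definition partials (R : realType) (s : seq bool) (f : R * R -> R) :
  R * R -> R := foldr (@partial R) f s.

(* C^oo(R^2): partial derivatives of all orders exist and are continuous. *)
Definition smooth (R : realType) (f : R * R -> R) : Prop :=
  forall s : seq bool, continuous (partials s f) /\
    forall (i : bool) (x : R * R), derivable (partials s f) x (axis R i).

Definition test_function (R : realType) (Omega : set (R * R))
    (phi : R * R -> R) : Prop :=
  [/\ smooth phi, compact (closure [set x | phi x != 0]) &
      closure [set x | phi x != 0] `<=` Omega].

Definition weak_partial (R : realType) (Omega : set (R * R)) (i : bool)
    (u g : R * R -> R) : Prop :=
  forall phi, test_function Omega phi ->
    \int[area]_(x in Omega) (u x * partial i phi x) =
    - \int[area]_(x in Omega) (g x * phi x).

(* u belongs to H^1(Omega) and its weak gradient is (G false, G true). *)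
Definition H1 (R : realType) (Omega : set (R * R)) (u : R * R -> R)
    (G : bool -> R * R -> R) : Prop :=
  L2 Omega u /\ forall i, L2 Omega (G i) /\ weak_partial Omega i u (G i).

Definition quarter_turn (R : realType) (v : R * R) : R * R := (- v.2, v.1).

(* An arbitrary square, not necessarily parallel to the axes; it is given by
   its side-length, a corner, and the unit direction of the side that starts
   at that corner in the counterclockwise orientation of the boundary. *)
Record square (R : realType) := Square {
  corner : R * R;
  direction : R * R;
  side_length : R;
  direction_unit : direction.1 ^+ 2 + direction.2 ^+ 2 = 1;
  side_length_gt0 : 0 < side_length }.

Definition square_set (R : realType) (S : square R) : set (R * R) :=
  [set corner S + s *: direction S + t *: quarter_turn (direction S) |
    s in `]0, side_length S[ & t in `]0, side_length S[].

Coercion square_set : square >-> set.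

(* Arc-length parametrisation, on [0, side_length S], of the i-th side. *)
Definition side (R : realType) (S : square R) (i : 'I_4) (t : R) : R * R :=
  corner S + \sum_(j < i) side_length S *: iter j (@quarter_turn R) (direction S)
    + t *: iter i (@quarter_turn R) (direction S).

Definition boundary_L2 (R : realType) (S : square R) (g : R * R -> R) : Prop :=
  forall i : 'I_4,
    measurable_fun `[0, side_length S] (fun t => g (side S i t)) /\
    (\int[lebesgue_measure]_(t in `[0%R, side_length S])
       ((g (side S i t)) ^+ 2)%:E < +oo)%E.

Definition boundary_integral (R : realType) (S : square R)
    (f : R * R -> R) : R :=
  \sum_(i < 4)
    \int[lebesgue_measure]_(t in `[0, side_length S]) f (side S i t).

(* g is the trace on the boundary of S of the function u of H^1(S) whose weak
   gradient is G: the trace operator is the continuous extension to H^1(S) of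
   the restriction to the boundary of functions smooth up to the boundary. *)
Definition is_trace (R : realType) (S : square R) (u : R * R -> R)
    (G : bool -> R * R -> R) (g : R * R -> R) : Prop :=
  boundary_L2 S g /\
  exists phi : nat -> R * R -> R,
    [/\ forall n, smooth (phi n),
        (\int[area]_(x in S) ((phi n x - u x) ^+ 2)%:E)%E
          @[n --> \oo] --> 0%E,
        forall i, (\int[area]_(x in S) ((partial i (phi n) x - G i x) ^+ 2)%:E)%E
          @[n --> \oo] --> 0%E &
        forall i : 'I_4,
          (\int[lebesgue_measure]_(t in `[0%R, side_length S])
             ((phi n (side S i t) - g (side S i t)) ^+ 2)%:E)%E
          @[n --> \oo] --> 0%E].

(* u in H^1(S) solves - Delta u = lam u in S, du/dnu + h u = 0 on the boundary.
   For u in H^1 this means the Green identity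
     int_S grad u . grad v + h int_{bd S} u v = lam int_S u v
   for all v in H^1(S). *)
Definition robin_solution (R : realType) (S : square R) (h lam : R)
    (u : R * R -> R) : Prop :=
  exists (G : bool -> R * R -> R) (g : R * R -> R),
    [/\ H1 S u G, is_trace S u G g &
        forall (v : R * R -> R) (H : bool -> R * R -> R) (k : R * R -> R),
          H1 S v H -> is_trace S v H k ->
          \int[area]_(x in S) (G false x * H false x + G true x * H true x)
            + h * boundary_integral S (fun x => g x * k x)
          = lam * \int[area]_(x in S) (u x * v x)].

Definition robin_eigenfunction (R : realType) (S : square R) (h lam : R)
    (u : R * R -> R) : Prop :=
  robin_solution S h lam u /\ ~ (u = (fun=> 0) %[ae area in square_set S]).

(* The space of solutions for lam, modulo equality almost everywhere, has a
   basis with d elements. *)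
Definition eigenspace_dim (R : realType) (S : square R) (h lam : R) (d : nat) :
    Prop :=
  exists w : 'I_d -> R * R -> R,
    (forall i, robin_solution S h lam (w i)) /\
    forall u, robin_solution S h lam u ->
      exists! a : 'rV[R]_d,
        u = (fun x => \sum_(i < d) a 0 i * w i x) %[ae area in square_set S].

(* l lists the Robin eigenvalues in non-decreasing order, every real number
   occurring as often as the dimension of its eigenspace (hence not at all if
   it is not an eigenvalue). *)
Definition robin_spectrum (R : realType) (S : square R) (h : R)
    (l : nat -> R) : Prop :=
  nondecreasing_seq l /\
  forall lam : R, exists s : seq nat,
    [/\ uniq s, forall n, n \in s <-> l n = lam &
        eigenspace_dim S h lam (size s)].

(* lam = lambda_{k,h}(S); eigenvalues are numbered from 1. *)
Definition robin_eigenvalue (R : realType) (S : square R) (h : R) (k : nat)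
    (lam : R) : Prop :=
  (0 < k)%N /\ exists2 l, robin_spectrum S h l & l k.-1 = lam.

Definition nodal_domains (R : realType) (Omega : set (R * R))
    (u : R * R -> R) : set (set (R * R)) :=
  let N := Omega `\` closure (Omega `&` [set x | u x = 0]) in
  [set connected_component N x | x in N].

(* The nodal domains are those of the continuous representative of u. *)
Definition courant_sharp (R : realType) (S : square R) (h : R) (k : nat) :
    Prop :=
  exists2 lam, robin_eigenvalue S h k lam &
    exists u : R * R -> R,
      [/\ robin_eigenfunction S h lam u,
          forall x, square_set S x -> {for x, continuous u} &
          (nodal_domains S u #= `I_k)%card].

(* Main.v *)
(** Let [mode n] be the [n]-th Robin eigenfunction of the interval from [0] to
    [pi], with frequency [al n], where [n <= al n < n + 1]. The products of two
    modes form a complete family of eigenfunctions of the square: a C^1 function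
    [f] orthogonal to the first [N + 1] modes satisfies [N^2 |f|^2 <= E(f)],
    because by Picone's identity such a bound holds for the functions vanishing
    at the [N + 1] nodes of [cos ((N + 1) x)], and the first [N + 1] modes can
    be used to interpolate at these nodes. Hence the Robin spectrum consists of
    the numbers [(al i)^2 + (al j)^2].

    The pair (2, 2) is ninth as long as [2 (al 2)^2 <= (al 0)^2 + (al 3)^2], and
    then its eigenfunction cuts the square into a 3 x 3 grid. The squares [mu]
    of the frequencies satisfy [d mu / d h = F(h, mu)] with [F] strictly concave
    in [mu], so [2 (al 2)^2 - (al 0)^2 - (al 3)^2] increases with [h] whenever
    it is nonnegative, and therefore changes sign only once. After the crossing,
    every product in the ninth eigenspace has [i + j] odd; so the elements of
    this eigenspace are antisymmetric under the reflection through the center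
    of the square, which permutes their nodal domains without fixed point: the
    number of nodal domains is not odd. *)

Require Import Defs.
From mathcomp Require Import all_boot all_order all_algebra.
From mathcomp Require Import all_classical all_reals all_analysis.
From mathcomp Require Import measurable_realfun.
From mathcomp Require Import ring lra zify.
Import Order.TTheory GRing.Theory Num.Theory numFieldNormedType.Exports.
Set Implicit Arguments.
Unset Strict Implicit.
Unset Printing Implicit Defensive.
Local Open Scope ring_scope.
Local Open Scope classical_set_scope.

(** * Calculus on an interval *)

(** Eigenfunctions are weak solutions in [H1], and a spectrum is any list with the right
    multiplicities. So all eigenspaces must be known, which makes completeness the main analytic
    task. It is obtained quantitatively: the remainder of an expansion has at most the energy of the
    function, and the lower bound [N^2] then forces its norm to [0]. Cosines serve for comparison
    because their nodes are explicit and their slope vanishes at [0] and [pi], while [h >= 0] only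
    adds to the energy. In two variables, Bernstein polynomials reduce [C^1] functions to sums of
    products. Orthogonality to smooth functions is enough, since a trace comes with smooth functions
    converging to the solution.

    The function [F] comes from [h = a tan ((a - n) pi / 2)] with [mu = a^2]: in the derivative,
    [tan] can be replaced by [h / a], which removes [n]. All branches thus obey one equation, and
    the derivative of the gap is a concavity expression in a single function.

    After the crossing the ninth eigenvalue is not identified; it is only confined between values
    that leave no room for a pair with even sum. *)

Section ContinuityRules.
Context {R : realType} {T : topologicalType}.
Implicit Types f g : T -> R.

Lemma contD f g : continuous f -> continuous g -> continuous (fun x => f x + g x).
Proof. by move=> cf cg x; apply: cvgD; [exact: cf|exact: cg]. Qed.

Lemma contM f g : continuous f -> continuous g -> continuous (fun x => f x * g x).
Proof. by move=> cf cg x; apply: cvgM; [exact: cf|exact: cg]. Qed.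

Lemma contN f : continuous f -> continuous (fun x => - f x).
Proof. by move=> cf x; apply: cvgN; exact: cf. Qed.

Lemma contX f n : continuous f -> continuous (fun x => f x ^+ n).
Proof.
move=> cf; elim: n => [|n ih].
  by under eq_fun do rewrite expr0; move=> x; exact: cvg_cst.
by under eq_fun do rewrite exprS; exact: contM.
Qed.

Lemma contC (c : R) : continuous (fun _ : T => c).
Proof. by move=> x; exact: cvg_cst. Qed.

Lemma cont_eq f g : continuous f -> f =1 g -> continuous g.
Proof. by move=> cf /funext <-. Qed.

Lemma cont_sum (J : Type) (r : seq J) (P : pred J) (F : J -> T -> R) :
  (forall j, P j -> continuous (F j)) ->
  continuous (fun x => \sum_(j <- r | P j) F j x).
Proof.
move=> cF; elim: r => [|j r ih].
  by apply: (@cont_eq (fun=> 0)) => [|x]; [exact: contC|rewrite big_nil].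
case Pj: (P j); last by apply: (cont_eq ih) => x; rewrite big_cons Pj.
by apply: (cont_eq (contD (cF _ Pj) ih)) => x; rewrite big_cons Pj.
Qed.

Lemma cont_comp (U : topologicalType) (g : U -> R) (f : T -> U) :
  continuous f -> continuous g -> continuous (fun x => g (f x)).
Proof. by move=> cf cg x; apply: (@continuous_comp _ _ _ f g); [exact: cf|exact: cg]. Qed.
Lemma cont_id : continuous (fun x : T => x). Proof. by move=> x. Qed.

End ContinuityRules.

Ltac continuity := repeat lazymatch goal with
  | |- continuous (fun x => @?f x + @?g x) => apply: (@contD _ _ f g)
  | |- continuous (fun x => @?f x * @?g x) => apply: (@contM _ _ f g)
  | |- continuous (fun x => - @?f x) => apply: (@contN _ _ f)
  | |- continuous (fun x => @?f x ^+ ?n) => apply: (@contX _ _ f n)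
  | |- continuous (fun x => cos (@?f x)) =>
      apply: (@cont_comp _ _ _ (@cos _) f); last exact: continuous_cos
  | |- continuous (fun x => sin (@?f x)) =>
      apply: (@cont_comp _ _ _ (@sin _) f); last exact: continuous_sin
  | |- continuous (fun x => \sum_(j <- _ | _) _) => apply: cont_sum => ? ?
  | |- continuous (fun x => x) => exact: cont_id
  | |- continuous (fun _ => ?c) => exact: contC
  | |- continuous _ => solve [eassumption | match goal with H : forall _, continuous _ |- _ => exact: H end]
  end.

Section OneDim.
Context {R : realType}.
Implicit Types (f g : R -> R) (a b : R).
Local Notation leb := (@lebesgue_measure R).

(** The derivative is part of the data, and both functions live on the whole line, so that no
    one-sided derivatives occur at the ends of an interval. *)
Definition C1 f f' := (forall x : R, is_derive x 1 f (f' x)) /\ continuous f'.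

Lemma C1_cont f f' : C1 f f' -> continuous f.
Proof.
move=> [df _] x; apply: differentiable_continuous.
by apply/derivable1_diffP; have [] := df x.
Qed.

Lemma cont_integrable a b f : continuous f ->
  leb.-integrable `[a, b] (EFin \o f).
Proof.
move=> cf; apply: (@continuous_compact_integrable _ f); first exact: segment_compact.
exact: continuous_subspaceT.
Qed.

Definition itg a b f : R := \int[leb]_(x in `[a, b]) f x.

Lemma itgD a b f g : continuous f -> continuous g ->
  itg a b (fun x => f x + g x) = itg a b f + itg a b g.
Proof. by move=> cf cg; rewrite /itg RintegralD//; exact: cont_integrable. Qed.

Lemma itgZ a b c f : continuous f -> itg a b (fun x => c * f x) = c * itg a b f.
Proof. by move=> cf; rewrite /itg RintegralZl//; exact: cont_integrable. Qed.

Lemma itgN a b f : continuous f -> itg a b (fun x => - f x) = - itg a b f.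
Proof.
move=> cf; rewrite -[RHS]mulN1r -itgZ//; congr itg.
by apply/funext => x; rewrite mulN1r.
Qed.

Lemma itgB a b f g : continuous f -> continuous g ->
  itg a b (fun x => f x - g x) = itg a b f - itg a b g.
Proof. by move=> cf cg; rewrite itgD ?itgN//; exact: contN. Qed.

Lemma itg_sum a b (J : Type) (r : seq J) (P : pred J) (F : J -> R -> R) :
  (forall j, P j -> continuous (F j)) ->
  itg a b (fun x => \sum_(j <- r | P j) F j x) = \sum_(j <- r | P j) itg a b (F j).
Proof.
move=> cF; elim: r => [|j r ih].
  rewrite big_nil /itg; under eq_Rintegral do rewrite big_nil.
  by rewrite Rintegral_cst//= mul0r.
rewrite big_cons; case: ifP => Pj.
  rewrite -ih -itgD//; [|exact: cF|exact: cont_sum].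
  by apply: eq_Rintegral => x _; rewrite big_cons Pj.
by rewrite -ih; apply: eq_Rintegral => x _; rewrite big_cons Pj.
Qed.

Lemma itg_ge0 a b f : (forall x, a <= x <= b -> 0 <= f x) -> 0 <= itg a b f.
Proof. by move=> f0; apply: Rintegral_ge0 => x /=; rewrite in_itv/=; exact: f0. Qed.

Lemma eq_itg a b f g : (forall x, a <= x <= b -> f x = g x) -> itg a b f = itg a b g.
Proof.
by move=> fg; apply: eq_Rintegral => x; rewrite inE/= in_itv/=; exact: fg.
Qed.

Lemma FTC a b f f' : a < b -> C1 f f' -> itg a b f' = f b - f a.
Proof.
move=> ab Cf; have [df cf'] := Cf; have cf := C1_cont Cf.
rewrite /itg /Rintegral (@continuous_FTC2 _ f' f)//.
- exact: continuous_subspaceT.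
- split => [x _||]; first by have [] := df x.
  + by apply: cvg_at_right_filter; exact: cf.
  + by apply: cvg_at_left_filter; exact: cf.
- by move=> x _; rewrite derive1E; have [] := df x.
Qed.

Lemma C1_eq f f' g g' : C1 f f' -> f =1 g -> f' =1 g' -> C1 g g'.
Proof. by move=> H /funext <- /funext <-. Qed.

Lemma C1D f f' g g' : C1 f f' -> C1 g g' ->
  C1 (fun x => f x + g x) (fun x => f' x + g' x).
Proof.
by move=> [df cf] [dg cg]; split => [x|]; [exact: is_deriveD|continuity].
Qed.

Lemma C1M f f' g g' : C1 f f' -> C1 g g' ->
  C1 (fun x => f x * g x) (fun x => f' x * g x + f x * g' x).
Proof.
move=> Cf Cg; have cf := C1_cont Cf; have cg := C1_cont Cg.
case: Cf Cg => [df cf'] [dg cg']; split => [x|]; last by continuity.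
apply: (is_derive_eq (is_deriveM (df x) (dg x))).
by rewrite /GRing.scale/=; ring.
Qed.

Lemma C1Z c f f' : C1 f f' -> C1 (fun x => c * f x) (fun x => c * f' x).
Proof.
move=> [df cf]; split => [x|]; last by continuity.
by have := is_deriveZ c (df x).
Qed.

Lemma C1C c : C1 (fun=> c) (fun=> 0).
Proof. by split => [x|]; [exact: is_derive_cst|continuity]. Qed.

Lemma C1id : C1 (fun x => x) (fun=> 1).
Proof. by split => [x|]; [exact: is_derive_id|continuity]. Qed.

Lemma C1X f f' n : C1 f f' ->
  C1 (fun x => f x ^+ n) (fun x => n%:R * f x ^+ n.-1 * f' x).
Proof.
move=> Cf; have cf := C1_cont Cf.
elim: n => [|n ih].
  by apply: C1_eq (C1C 1) _ _ => x; rewrite ?expr0// !mul0r.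
apply: C1_eq (C1M Cf ih) _ _ => x; first by rewrite exprS.
case: n {ih} => [|n]; first by rewrite /= !expr0; ring.
rewrite /= -[n.+2%:R]natr1 (exprS (f x) n); ring.
Qed.

Lemma C1_sum (J : Type) (r : seq J) (P : pred J) (F F' : J -> R -> R) :
  (forall j, P j -> C1 (F j) (F' j)) ->
  C1 (fun x => \sum_(j <- r | P j) F j x) (fun x => \sum_(j <- r | P j) F' j x).
Proof.
move=> CF; elim: r => [|j r ih].
  by apply: C1_eq (C1C 0) _ _ => x; rewrite big_nil.
case Pj: (P j); last by apply: C1_eq ih _ _ => x; rewrite big_cons Pj.
by apply: C1_eq (C1D (CF _ Pj) ih) _ _ => x; rewrite big_cons Pj.
Qed.

Lemma C1_cos c d : C1 (fun x => cos (c * x - d)) (fun x => - c * sin (c * x - d)).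
Proof.
split=> [x|]; last by continuity.
have dg : is_derive x 1 (fun x => c * x - d) c.
  have H : is_derive x 1 (fun x => c * x - d) (c * 1 - 0) :=
    is_deriveB (is_deriveZ c (is_derive_id x 1)) (is_derive_cst d x 1).
  by apply: (is_derive_eq H); rewrite subr0 mulr1.
have H : is_derive x 1 (fun x => cos (c * x - d)) _ :=
  @is_derive1_comp _ (@cos R) (fun x => c * x - d) _ _ _
    (is_derive_cos (c * x - d)) dg.
by apply: (is_derive_eq H); rewrite mulrC mulrN mulNr.
Qed.

Lemma C1_sin c d : C1 (fun x => sin (c * x - d)) (fun x => c * cos (c * x - d)).
Proof.
split=> [x|]; last by continuity.
have dg : is_derive x 1 (fun x => c * x - d) c.
  have H : is_derive x 1 (fun x => c * x - d) (c * 1 - 0) :=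
    is_deriveB (is_deriveZ c (is_derive_id x 1)) (is_derive_cst d x 1).
  by apply: (is_derive_eq H); rewrite subr0 mulr1.
have H : is_derive x 1 (fun x => sin (c * x - d)) _ :=
  @is_derive1_comp _ (@sin R) (fun x => c * x - d) _ _ _
    (is_derive_sin (c * x - d)) dg.
by apply: (is_derive_eq H); rewrite mulrC.
Qed.

End OneDim.

Section Antiderivative.
Context {R : realType}.
Implicit Types (g : R -> R) (a b : R).
Local Notation leb := (@lebesgue_measure R).

Lemma itg_derive a g (x : R) : continuous g -> a < x ->
  is_derive x 1 (fun y => itg a y g) (g x).
Proof.
move=> cg ax.
have ig : leb.-integrable [set` Interval (BLeft a) (BRight (x + 1))] (EFin \o g).
  exact: cont_integrable.
have [d e] := @continuous_FTC1 _ g (BLeft a) x (x + 1) ltac:(by rewrite ltrDl) ig ltac:(by rewrite lte_fin) (cg x).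
by apply: (DeriveDef d); rewrite -e derive1E.
Qed.

Lemma itg_cat a b c g : continuous g -> a <= b -> b <= c ->
  itg a c g = itg a b g + itg b c g.
Proof.
move=> cg ab bc; apply/eqP; rewrite addrC -subr_eq; apply/eqP.
rewrite /itg (@Rintegral_itvB _ g (BLeft a) (BRight c) b) ?bnd_simp//.
  rewrite Rintegral_itv_obnd_cbnd//.
  by apply: integrableS (cont_integrable b c cg) => //; exact: subset_itv_oc_cc.
exact: cont_integrable.
Qed.

End Antiderivative.

(** * Picone's inequality for functions with prescribed zeros *)

Section Picone.
Context {R : realType}.
Variables (v v' : R -> R) (Cv : C1 v v') (om : R).
Let g x := v' x ^+ 2 - om ^+ 2 * v x ^+ 2.
Let cg : continuous g.
Proof. by have := C1_cont Cv; case: Cv => _ cv' cv; rewrite /g; continuity. Qed.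

(* The comparison function is [cos (om (x - m))]: with [T = om tan (om (x - m))],
   [v'^2 - om^2 v^2 = (v' + T v)^2 - (T v^2)']. *)
Lemma picone_cell a b m : a < b -> 0 <= om ->
  (forall x, a <= x <= b -> - (pi / 2) < om * (x - m) < pi / 2) ->
  (m = a \/ v a = 0) -> (m = b \/ v b = 0) ->
  0 <= itg a b g.
Proof.
move=> ab om0 bnd ma mb.
pose T x := om * tan (om * x - om * m).
(* The integral starts at [a - 1], so that [F] has a two-sided derivative at [a] too. *)
pose F x := itg (a - 1) x g + T x * v x ^+ 2.
have dF x : a <= x <= b -> is_derive x 1 F ((v' x + T x * v x) ^+ 2).
  move=> xab.
  have cosn0 : cos (om * x - om * m) != 0.
    by rewrite gt_eqF// cos_gt0_pihalf// -mulrBr; exact: bnd.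
  have dg : is_derive x 1 (fun x => om * x - om * m) om.
    have H : is_derive x 1 (fun x => om * x - om * m) (om * 1 - 0) :=
      is_deriveB (is_deriveZ om (is_derive_id x 1)) (is_derive_cst (om * m) x 1).
    by apply: (is_derive_eq H); rewrite subr0 mulr1.
  have dT : is_derive x 1 T (om * ((cos (om * x - om * m)) ^- 2 * om)).
    have H : is_derive x 1 (fun x => tan (om * x - om * m)) _ :=
      @is_derive1_comp _ (@tan R) (fun x => om * x - om * m) _ _ _
      (is_derive_tan cosn0) dg.
    exact: (is_deriveZ om H).
  have dv2 := (C1X 2 Cv).1 x.
  have dI : is_derive x 1 (fun y => itg (a - 1) y g) (g x).
    by apply: itg_derive => //; case/andP: xab => ax _; lra.
  apply: (is_derive_eq (is_deriveD dI (is_deriveM dT dv2))).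
  rewrite /GRing.scale/= /g /T.
  have -> : (cos (om * x - om * m)) ^- 2 = 1 + tan (om * x - om * m) ^+ 2.
    have s2 := cos2Dsin2 (om * x - om * m).
    rewrite /tan expr_div_n (_ : sin _ ^+ 2 = 1 - cos (om * x - om * m) ^+ 2).
      by field.
    by rewrite -s2; ring.
  by ring.
have FaFb : F a <= F b.
  have sub x : x \in `]a, b[%R -> a <= x <= b.
    by rewrite in_itv/= => /andP[? ?]; rewrite !ltW.
  apply: (@ger0_derive1_ndecr _ F a b) => //; last exact: ltW.
  - by move=> x /sub xab; have [] := dF x xab.
  - move=> x /sub xab; rewrite derive1E; have [_ ->] := dF x xab.
    exact: sqr_ge0.
  - apply: derivable_within_continuous => x; rewrite in_itv/= => xab.
    by have [] := dF x xab.
(* At each end either the tangent vanishes, because [m] lies there, or [v] does. *)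
have Ta : T a * v a ^+ 2 = 0.
  case: ma => [ma|->]; last by rewrite expr0n mulr0.
  by rewrite /T ma subrr tan0 mulr0 mul0r.
have Tb : T b * v b ^+ 2 = 0.
  case: mb => [mb|->]; last by rewrite expr0n mulr0.
  by rewrite /T mb subrr tan0 mulr0 mul0r.
move: FaFb; rewrite /F Ta Tb !addr0 (@itg_cat _ (a - 1) a b)//; first lra.
  by rewrite gerBl.
exact: ltW.
Qed.

(** The prescribed zeros are those of [cos (N x)], the odd multiples of [pi / (2 N)]. Cutting at all
    multiples gives cells with such a zero at the odd end; the comparison cosine is centred at the
    even end, and [om < N] keeps it positive on the cell. Both [0] and [pi] are even multiples, so
    no condition on [v] arises there. *)
Lemma picone N : (0 < N)%N -> 0 <= om < N%:R ->
  (forall k, (k < N)%N -> v (k.*2.+1%:R * (pi / N.*2%:R)) = 0) ->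
  om ^+ 2 * itg 0 pi (fun x => v x ^+ 2) <= itg 0 pi (fun x => v' x ^+ 2).
Proof.
move=> N0 /andP[om0 omN] vz.
have cv := C1_cont Cv; have [_ cv'] := Cv.
rewrite -itgZ; last by continuity.
rewrite -subr_ge0 -itgB; [|by continuity..].
set d := pi / N.*2%:R : R.
have d0 : 0 < d by rewrite divr_gt0 ?pi_gt0// ltr0n double_gt0.
have omd : om * d < pi / 2.
  have -> : pi / 2 = N%:R * d :> R.
    by rewrite /d -muln2 natrM; field; rewrite pnatr_eq0 -lt0n.
  by rewrite ltr_pM2r.
suff H j : (j <= N.*2)%N -> 0 <= itg 0 (j%:R * d) g.
  have -> : pi = N.*2%:R * d by rewrite /d mulrC divfK// pnatr_eq0 double_eq0 -lt0n.
  exact: H.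
elim: j => [_|j ih jN].
  by rewrite mul0r /itg set_itv1 Rintegral_set1.
rewrite (@itg_cat _ 0 (j%:R * d))//; last 2 first.
- by rewrite mulr_ge0 ?ler0n ?ltW.
- by rewrite ler_pM2r// ler_nat.
rewrite addr_ge0 ?ih ?(ltnW jN)//.
have jd : j.+1%:R * d = j%:R * d + d by rewrite -natr1 mulrDl mul1r.
have bnd m : m = j%:R * d \/ m = j.+1%:R * d -> 
  forall x, j%:R * d <= x <= j.+1%:R * d -> - (pi / 2) < om * (x - m) < pi / 2.
  move=> Hm x /andP[x1 x2].
  have : `|om * (x - m)| <= om * d.
    rewrite normrM (ger0_norm om0) ler_wpM2l// ler_norml.
    by case: Hm => ->; apply/andP; split; lra.
  by rewrite ler_norml => /andP[? ?]; apply/andP; split; lra.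
case oj : (odd j).
  have vj : v (j%:R * d) = 0.
    rewrite -[j in j%:R]odd_double_half oj add1n vz//.
    by have := odd_double_half j; rewrite oj; lia.
  by apply: (@picone_cell _ _ (j.+1%:R * d)) => //; [lra|exact: bnd (or_intror _)|right|left].
have vj : v (j.+1%:R * d) = 0.
  rewrite -[j in j.+1%:R]odd_double_half oj add0n vz//.
  by have := odd_double_half j; rewrite oj; lia.
by apply: (@picone_cell _ _ (j%:R * d)) => //; [lra|exact: bnd (or_introl _)|left|right].
Qed.

End Picone.

(** * The Robin problem on an interval *)

Section RobinInterval.
Context {R : realType}.

(** With this phase, [cos (a x - phase a n)] is [cos (a (x - pi / 2) + n pi / 2)], which is even or
    odd about the midpoint of [[0, pi]] according to the parity of [n]. The boundary condition at
    [0] therefore implies the one at [pi]. *)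
Definition phase (a : R) (n : nat) : R := (a - n%:R) * (pi / 2).

(* [a] is the square root of the [n]-th eigenvalue (counted from [0]) of the
   interval [[0, pi]]; the eigenfunction is [cos (a x - phase a n)]. *)
Definition root_eq (h : R) n (a : R) :=
  n%:R <= a < n.+1%:R /\ a * sin (phase a n) = h * cos (phase a n).

Lemma root_eq_exists h n : 0 <= h -> exists a, root_eq h n a.
Proof.
move=> h0.
pose f a := a * sin (pi / 2 * a - pi / 2 * n%:R) - h * cos (pi / 2 * a - pi / 2 * n%:R).
have cf : continuous f by rewrite /f; continuity.
have fn : f n%:R = - h by rewrite /f subrr sin0 cos0; ring.
have fn1 : f n.+1%:R = n.+1%:R.
  rewrite /f -mulrBr -natr1 addrAC subrr add0r mulr1 sin_pihalf cos_pihalf; ring.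
have le_n : n%:R <= n.+1%:R :> R by rewrite ler_nat.
have [|c cin fc] := @IVT _ f n%:R n.+1%:R 0 le_n (continuous_subspaceT cf) _.
  rewrite fn fn1 ge_min le_max; apply/andP; split; first by rewrite oppr_le0 h0.
  by rewrite ler0n orbT.
exists c; move: cin; rewrite in_itv/= => /andP[nc cn1].
have E : phase c n = pi / 2 * c - pi / 2 * n%:R by rewrite /phase; ring.
split; last by apply/eqP; rewrite -subr_eq0 E -/(f c) fc.
rewrite nc/= lt_neqAle cn1 andbT; apply/eqP => cE; move: fc; rewrite cE fn1 => /eqP.
by rewrite pnatr_eq0.
Qed.

Lemma phase_bound a n : n%:R <= a < n.+1%:R -> 0 <= phase a n < pi / 2.
Proof.
have p : 0 < pi / 2 :> R by rewrite divr_gt0 ?pi_gt0.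
rewrite -natr1 /phase => /andP[na an]; apply/andP; split.
  by rewrite mulr_ge0 ?subr_ge0// ltW.
by rewrite -[ltRHS]mul1r ltr_pM2r//; lra.
Qed.

End RobinInterval.

Lemma cosDnpi (R : realType) (x : R) n : cos (x + n%:R * pi) = (-1) ^+ n * cos x.
Proof.
elim: n x => [|n ih] x; first by rewrite mul0r addr0 mul1r.
by rewrite -natr1 mulrDl mul1r addrA cosDpi ih exprS; ring.
Qed.

Lemma sinDnpi (R : realType) (x : R) n : sin (x + n%:R * pi) = (-1) ^+ n * sin x.
Proof.
elim: n x => [|n ih] x; first by rewrite mul0r addr0 mul1r.
by rewrite -natr1 mulrDl mul1r addrA sinDpi ih exprS; ring.
Qed.

Section Eigenfunctions.
Context {R : realType}.
Variables (h : R) (h0 : 0 <= h) (al : nat -> R) (Hal : forall n, root_eq h n (al n)).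

Definition tau n : R := phase (al n) n.
Definition mode n (x : R) : R := cos (al n * x - tau n).
Definition mode' n (x : R) : R := - al n * sin (al n * x - tau n).

Lemma al_ge n : n%:R <= al n. Proof. by case: (Hal n) => /andP[]. Qed.
Lemma al_lt n : al n < n.+1%:R. Proof. by case: (Hal n) => /andP[]. Qed.
Lemma al_ge0 n : 0 <= al n. Proof. exact: le_trans (ler0n _ _) (al_ge n). Qed.
Lemma al_incr m n : (m < n)%N -> al m < al n.
Proof.
move=> mn; apply: (lt_le_trans (al_lt m)); apply: le_trans (al_ge n).
by rewrite ler_nat.
Qed.
Lemma al_inj : injective al.
Proof.
move=> m n e; case: (ltngtP m n) => // /al_incr; by rewrite e ltxx.
Qed.

Lemma C1_mode n : C1 (mode n) (mode' n).
Proof. exact: C1_cos. Qed.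
Lemma C1_mode' n : C1 (mode' n) (fun x => - al n ^+ 2 * mode n x).
Proof.
by apply: C1_eq (C1Z (- al n) (C1_sin (al n) (tau n))) _ _ => x //; rewrite /mode; ring.
Qed.
Lemma mode_cont n : continuous (mode n). Proof. exact: C1_cont (C1_mode n). Qed.
Lemma mode'_cont n : continuous (mode' n). Proof. exact: C1_cont (C1_mode' n). Qed.

Lemma tau_bound n : 0 <= tau n < pi / 2.
Proof. by apply: phase_bound; case: (Hal n). Qed.

(** The symmetry about the midpoint in terms of phases. It carries the boundary condition to [pi],
    locates the zeros of the second mode and gives the parity of the modes under reflection. *)
Lemma al_pi n : al n * pi - tau n = tau n + n%:R * pi.
Proof. by rewrite /tau /phase; field. Qed.

Lemma mode'_0 n : mode' n 0 = h * mode n 0.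
Proof.
rewrite /mode' /mode mulr0 sub0r sinN cosN mulrN mulNr opprK.
by case: (Hal n).
Qed.

Lemma mode'_pi n : mode' n pi = - h * mode n pi.
Proof.
rewrite /mode' /mode al_pi sinDnpi cosDnpi.
by rewrite !mulNr mulrCA [h * _]mulrCA; case: (Hal n) => _ ->.
Qed.

(** The bilinear form of the Robin problem; [v'] and [w'] stand for the derivatives of [v] and
    [w]. *)
Definition energy (v w v' w' : R -> R) : R :=
  itg 0 pi (fun x => v' x * w' x) + h * (v 0 * w 0 + v pi * w pi).

Lemma energy_mode v v' n : C1 v v' ->
  energy v (mode n) v' (mode' n) = al n ^+ 2 * itg 0 pi (fun x => v x * mode n x).
Proof.
move=> Cv; have cv := C1_cont Cv; have [_ cv'] := Cv.
have cu := @mode_cont n; have cu' := @mode'_cont n.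
have := FTC (pi_gt0 R) (C1M Cv (C1_mode' n)).
rewrite itgD; [|by continuity..].
rewrite (@eq_itg _ _ _ (fun x => v x * (- al n ^+ 2 * mode n x))
  (fun x => - al n ^+ 2 * (v x * mode n x))); last by move=> x _; ring.
rewrite itgZ; last by continuity.
rewrite mode'_pi mode'_0 /energy => E.
by move: E; rewrite mulNr; lra.
Qed.

Lemma mode_orth m n : m <> n -> itg 0 pi (fun x => mode m x * mode n x) = 0.
Proof.
move=> mn.
have e1 := energy_mode n (C1_mode m); have e2 := energy_mode m (C1_mode n).
have e : energy (mode m) (mode n) (mode' m) (mode' n) = energy (mode n) (mode m) (mode' n) (mode' m).
  by rewrite /energy; congr (_ + _); [apply: eq_itg => x _; rewrite mulrC|ring].
have i : itg 0 pi (fun x => mode m x * mode n x) = itg 0 pi (fun x => mode n x * mode m x).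
  by apply: eq_itg => x _; rewrite mulrC.
move: e; rewrite e1 e2 -i => /eqP; rewrite -subr_eq0 -mulrBl mulf_eq0 => /orP[|/eqP//].
rewrite subr_eq0 => /eqP /pexpIrn => /(_ isT).
by rewrite !nnegrE => /(_ (al_ge0 n) (al_ge0 m)) /al_inj e; case: mn.
Qed.

(** Since [cos^2 + sin^2 = 1], the number [al n ^ 2 * pi] is [al n ^ 2] times the squared norm of
    the mode plus that of its derivative. The latter is at most the energy, which equals the former;
    so the squared norm is at least [pi / 2]. If [al n = 0], the mode is constant. *)
Lemma mode_norm_gt0 n : 0 < itg 0 pi (fun x => mode n x ^+ 2).
Proof.
have p := pi_gt0 R; have cu := @mode_cont n; have cu' := @mode'_cont n.
have [a0|a0] := eqVneq (al n) 0.
  have n0 : n = 0%N.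
    by have := al_ge n; rewrite a0 lern0 => /eqP.
  rewrite (@eq_itg _ _ _ _ (fun=> 1)); last first.
    by move=> x _; rewrite /mode /tau /phase a0 n0 mul0r !subr0 mul0r subr0 cos0 expr1n.
  by rewrite (FTC p C1id) subr0.
have := energy_mode n (C1_mode n); rewrite /energy => E.
have : al n ^+ 2 * pi = al n ^+ 2 * itg 0 pi (fun x => mode n x ^+ 2)
   + itg 0 pi (fun x => mode' n x * mode' n x).
  rewrite -itgZ -?itgD; [|by continuity..].
  rewrite (@eq_itg _ _ _ _ (fun=> al n ^+ 2 * 1)).
    by rewrite itgZ ?(FTC p C1id) ?subr0//; continuity.
  by move=> x _; rewrite /mode /mode' mulr1 -[RHS]mulr1 -(cos2Dsin2 (al n * x - tau n)); ring.
move=> E2.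
have E3 : al n ^+ 2 * pi <= 2 * (al n ^+ 2 * itg 0 pi (fun x => mode n x ^+ 2)).
  rewrite E2 [leRHS]mulr_natl mulr2n lerD2l -[X in _ <= _ * X]/(itg 0 pi (fun x => mode n x * mode n x)) -E.
  rewrite lerDl mulr_ge0//.
  by rewrite addr_ge0// -expr2 sqr_ge0.
have a2 : 0 < al n ^+ 2 by rewrite exprn_gt0// lt_neqAle eq_sym a0 al_ge0.
have := lt_le_trans (mulr_gt0 a2 p) E3.
by rewrite mulrCA pmulr_rgt0// pmulr_rgt0.
Qed.

(** * Functions orthogonal to the first modes *)

Section Projection.
Variables (N : nat) (v v' : R -> R) (Cv : C1 v v').
Hypothesis v_orth : forall n, (n < N)%N -> itg 0 pi (fun x => v x * mode n x) = 0.
Variable (a : 'I_N -> R).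
Let s x := \sum_(n < N) a n * mode n x.
Let s' x := \sum_(n < N) a n * mode' n x.
Let Cs : C1 s s'.
Proof. by apply: C1_sum => n _; apply: C1Z; exact: C1_mode. Qed.

Let I_s (f : R -> R) : continuous f -> itg 0 pi (fun x => f x * s x) = \sum_(n < N) a n * itg 0 pi (fun x => f x * mode n x).
Proof.
move=> cf; have cu := @mode_cont.
transitivity (\sum_(n < N) itg 0 pi (fun x => a n * (f x * mode n x))); last first.
  by apply: eq_bigr => n _; rewrite itgZ//; continuity.
rewrite -itg_sum; last by move=> n _; continuity.
by apply: eq_itg => x _; rewrite mulr_sumr; apply: eq_bigr => n _; ring.
Qed.

Let energy_s f f' : C1 f f' -> energy f s f' s' = \sum_(n < N) a n * (al n ^+ 2 * itg 0 pi (fun x => f x * mode n x)).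
Proof.
move=> Cf; have cu := @mode_cont; have cu' := @mode'_cont; have [_ cf'] := Cf.
transitivity (\sum_(n < N) (itg 0 pi (fun x => a n * (f' x * mode' n x)) + a n * (h * (f 0 * mode n 0 + f pi * mode n pi)))); last first.
  by apply: eq_bigr => n _; rewrite -(energy_mode _ Cf) /energy [RHS]mulrDr itgZ//; continuity.
rewrite big_split/= -itg_sum; last by move=> n _; continuity.
congr (_ + _).
  by apply: eq_itg => x _; rewrite mulr_sumr; apply: eq_bigr => n _; ring.
rewrite /s !mulr_sumr -big_split/= mulr_sumr; apply: eq_bigr => n _; ring.
Qed.

Let s_u n : itg 0 pi (fun x => s x * mode n x) = \sum_(m < N) a m * itg 0 pi (fun x => mode n x * mode m x).
Proof.
rewrite (@eq_itg _ _ _ _ (fun x => mode n x * s x)); last by move=> x _; rewrite mulrC.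
by rewrite I_s//; exact: mode_cont.
Qed.

Let s_u' (n : 'I_N) : itg 0 pi (fun x => s x * mode n x) = a n * itg 0 pi (fun x => mode n x ^+ 2).
Proof.
rewrite s_u (bigD1 n)//= big1 ?addr0// => m mn.
by rewrite mode_orth ?mulr0// => e; move/eqP: mn; apply; apply/val_inj.
Qed.

(** Pythagoras with arbitrary coefficients [a]. By [energy_mode] the same orthogonality holds for
    the energy, which gives the companion identity. The coefficients will be chosen to make [v - s]
    vanish at the nodes. *)
Lemma projection_norm : itg 0 pi (fun x => (v x - s x) ^+ 2)
  = itg 0 pi (fun x => v x ^+ 2) + \sum_(n < N) a n ^+ 2 * itg 0 pi (fun x => mode n x ^+ 2).
Proof.
have cs := C1_cont Cs; have cv := C1_cont Cv.
rewrite (@eq_itg _ _ _ _ (fun x => v x ^+ 2 + (s x * s x - 2 * (v x * s x)))); last by move=> x _; ring.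
rewrite itgD ?itgB ?itgZ; [|by continuity..].
rewrite !I_s// [X in _ - 2 * X]big1 ?mulr0 ?subr0; last first.
  by move=> n _; rewrite v_orth ?mulr0.
by congr (_ + _); apply: eq_bigr => n _; rewrite s_u'; ring.
Qed.

Lemma projection_energy : energy (fun x => v x - s x) (fun x => v x - s x) (fun x => v' x - s' x) (fun x => v' x - s' x)
  = energy v v v' v' + \sum_(n < N) a n ^+ 2 * (al n ^+ 2 * itg 0 pi (fun x => mode n x ^+ 2)).
Proof.
have [_ cs'] := Cs; have [_ cv'] := Cv.
transitivity (energy v v v' v' + (energy s s s' s' - 2 * energy v s v' s')).
  rewrite /energy (@eq_itg _ _ _ _ (fun x => v' x * v' x + (s' x * s' x - 2 * (v' x * s' x)))); last by move=> x _; ring.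
  rewrite itgD ?itgB ?itgZ; [|by continuity..].
  by ring.
rewrite !energy_s// [X in _ - 2 * X]big1 ?mulr0 ?subr0; last first.
  by move=> n _; rewrite v_orth ?mulr0.
by congr (_ + _); apply: eq_bigr => n _; rewrite s_u'; ring.
Qed.

End Projection.

(** This is [picone] for [v - s], expanded by the two Pythagoras identities. The sum over the
    coefficients is kept in the bound: for [v = 0] it shows that interpolation at the nodes is
    uniquely solvable. *)
Lemma rayleigh_nodes N (v v' : R -> R) (a : 'I_N.+1 -> R) om : C1 v v' ->
  (forall n, (n < N.+1)%N -> itg 0 pi (fun x => v x * mode n x) = 0) ->
  (forall k, (k < N.+1)%N -> let z := k.*2.+1%:R * (pi / N.+1.*2%:R) in
     v z = \sum_(n < N.+1) a n * mode n z) ->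
  0 <= om < N.+1%:R ->
  om ^+ 2 * itg 0 pi (fun x => v x ^+ 2)
  + \sum_(n < N.+1) a n ^+ 2 * ((om ^+ 2 - al n ^+ 2) * itg 0 pi (fun x => mode n x ^+ 2))
  <= energy v v v' v'.
Proof.
move=> Cv vo vz omN.
pose s x := \sum_(n < N.+1) a n * mode n x.
pose s' x := \sum_(n < N.+1) a n * mode' n x.
have Cs : C1 s s' by apply: C1_sum => n _; apply: C1Z; exact: C1_mode.
have Cw : C1 (fun x => v x - s x) (fun x => v' x - s' x).
  by apply: C1_eq (C1D Cv (C1Z (-1) Cs)) _ _ => x; rewrite mulN1r.
have vs0 k : (k < N.+1)%N -> v (k.*2.+1%:R * (pi / N.+1.*2%:R)) - s (k.*2.+1%:R * (pi / N.+1.*2%:R)) = 0.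
  by move=> kN; apply/eqP; rewrite subr_eq0; apply/eqP; exact: (vz k kN).
have := @picone _ _ _ Cw om N.+1 isT omN vs0.
rewrite (projection_norm Cv vo) => P.
have : itg 0 pi (fun x => (v' x - s' x) ^+ 2) <= energy (fun x => v x - s x) (fun x => v x - s x) (fun x => v' x - s' x) (fun x => v' x - s' x).
  by rewrite /energy lerDl mulr_ge0// addr_ge0// -expr2 sqr_ge0.
rewrite (projection_energy Cv vo) => Q.
have -> : \sum_(n < N.+1) a n ^+ 2 * ((om ^+ 2 - al n ^+ 2) * itg 0 pi (fun x => mode n x ^+ 2))
  = om ^+ 2 * (\sum_(n < N.+1) a n ^+ 2 * itg 0 pi (fun x => mode n x ^+ 2))
    - \sum_(n < N.+1) a n ^+ 2 * (al n ^+ 2 * itg 0 pi (fun x => mode n x ^+ 2)).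
  by rewrite mulr_sumr -sumrB; apply: eq_bigr => n _; ring.
by have := le_trans P Q; rewrite mulrDr; lra.
Qed.

Lemma rayleigh N (v v' : R -> R) : C1 v v' ->
  (forall n, (n < N.+1)%N -> itg 0 pi (fun x => v x * mode n x) = 0) ->
  N%:R ^+ 2 * itg 0 pi (fun x => v x ^+ 2) <= energy v v v' v'.
Proof.
move=> Cv vo.
(* Being above [al N] makes all weights [om ^ 2 - al n ^ 2] positive; being below [N + 1] is what
   [picone] requires with [N + 1] nodes. *)
pose om := (al N + N.+1%:R) / 2.
have aN := al_lt N; have Na := al_ge N.
have omN : 0 <= om < N.+1%:R.
  by have := ler0n R N; rewrite /om -natr1 in aN *; move=> ?; apply/andP; split; lra.
have omN' : N%:R <= om by rewrite /om -natr1 in aN *; lra.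
have pos (n : 'I_N.+1) : 0 < (om ^+ 2 - al n ^+ 2) * itg 0 pi (fun x => mode n x ^+ 2).
  rewrite mulr_gt0 ?mode_norm_gt0// subr_gt0.
  have om0 : 0 <= om by case/andP: omN.
  rewrite ltr_pXn2r ?nnegrE ?al_ge0//.
  apply: (@le_lt_trans _ _ (al N)); last by rewrite /om; lra.
  by have := ltn_ord n; rewrite ltnS leq_eqVlt => /orP[/eqP->//|/al_incr/ltW].
pose z (k : nat) : R := k.*2.+1%:R * (pi / N.+1.*2%:R).
pose M := \matrix_(n < N.+1, k < N.+1) mode n (z k).
(* A combination of modes that vanishes at all nodes yields, by [rayleigh_nodes] with [v = 0], a sum
   of nonnegative terms that is at most [0]. The weights are positive, so all its coefficients
   vanish. *)
have Mu : M \in unitmx.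
  rewrite unitmxE unitfE; apply/negP => /det0P[a a0 aM].
  have := @rayleigh_nodes N _ _ (fun n => a 0 n) om (C1C 0) _ _ omN.
  rewrite /energy !mul0r addr0 mulr0 addr0.
  have i0 (g : R -> R) : itg 0 pi (fun x => 0 * g x) = 0.
    rewrite (@eq_itg _ _ _ _ (fun=> 0)) => [|x _]; last by rewrite mul0r.
    by rewrite (FTC (pi_gt0 R) (C1C 0)) subrr.
  have i2 : itg 0 pi (fun=> 0 ^+ 2 : R) = 0.
    by rewrite -[RHS](i0 (fun=> 0)); apply: eq_itg => x _; rewrite expr2.
  have i00 : itg 0 pi (fun=> 0 : R) = 0 by rewrite (FTC (pi_gt0 R) (C1C 0)) subrr.
  rewrite i2 i00 ?mulr0 ?add0r.
  move=> /(_ _ _)H.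
  have : \sum_(n < N.+1) a 0 n ^+ 2 * ((om ^+ 2 - al n ^+ 2) * itg 0 pi (fun x => mode n x ^+ 2)) <= 0.
    apply: H => [n nN|k kN]; first exact: i0.
    have /rowP/(_ (Ordinal kN)) := aM; rewrite !mxE => {1}<-.
    by apply: eq_bigr => n _; rewrite mxE.
  rewrite le_eqVlt ltNge sumr_ge0 ?orbF; last first.
    by move=> n _; rewrite mulr_ge0 ?sqr_ge0// ltW.
  rewrite psumr_eq0 => [/allP s0|n _]; last by rewrite mulr_ge0 ?sqr_ge0// ltW.
  case/negP: a0; apply/eqP/rowP => n; rewrite mxE.
  have := s0 n (mem_index_enum _); rewrite mulf_eq0 (gt_eqF (pos n)) orbF sqrf_eq0.
  by move=> /eqP.
have [a aM] : exists a, a *m M = \row_k v (z k).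
  by exists ((\row_k v (z k)) *m invmx M); rewrite mulmxKV.
have := @rayleigh_nodes N _ _ (fun n => a 0 n) om Cv vo _ omN.
move=> /(_ _)H.
have : om ^+ 2 * itg 0 pi (fun x => v x ^+ 2) <= energy v v v' v'.
  apply: le_trans (H _); first by rewrite lerDl sumr_ge0// => n _; rewrite mulr_ge0 ?sqr_ge0// ltW.
  move=> k kN zk; have := aM.
  by move=> /rowP/(_ (Ordinal kN)); rewrite !mxE => <-; apply: eq_bigr => n _; rewrite mxE.
apply: le_trans; rewrite ler_wpM2r//.
  by apply: itg_ge0 => x _; exact: sqr_ge0.
have om0 : 0 <= om by case/andP: omN.
by rewrite lerXn2r ?nnegrE ?ler0n.
Qed.

Lemma interval_complete (f f' : R -> R) e : C1 f f' -> 0 < e ->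
  exists N (c : 'I_N -> R), itg 0 pi (fun x => (f x - \sum_(n < N) c n * mode n x) ^+ 2) <= e.
Proof.
move=> Cf e0; have [_ cf'] := Cf.
(* As [N] exceeds the energy of [f] divided by [e], the remainder [v] satisfies
   [N^2 |v|^2 <= energy < N e <= N^2 e]. *)
pose N := (Num.truncn (energy f f f' f' / e)).+1.
exists N.+1; pose c (n : 'I_N.+1) := itg 0 pi (fun x => f x * mode n x) / itg 0 pi (fun x => mode n x ^+ 2).
exists c.
pose s x := \sum_(n < N.+1) c n * mode n x.
pose s' x := \sum_(n < N.+1) c n * mode' n x.
have Cs : C1 s s' by apply: C1_sum => n _; apply: C1Z; exact: C1_mode.
pose v x := f x - s x; pose v' x := f' x - s' x.
have Cv : C1 v v'.
  by apply: C1_eq (C1D Cf (C1Z (-1) Cs)) _ _ => x; rewrite mulN1r.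
have cf := C1_cont Cf; have cs := C1_cont Cs; have cu := @mode_cont.
have vo n : (n < N.+1)%N -> itg 0 pi (fun x => v x * mode n x) = 0.
  move=> nN; rewrite (@eq_itg _ _ _ _ (fun x => f x * mode n x - \sum_(m < N.+1) c m * (mode m x * mode n x))); last first.
    by move=> x _; rewrite /v /s mulrBl mulr_suml; congr (_ - _); apply: eq_bigr => m _; ring.
  rewrite itgB; [|by continuity|by continuity].
  rewrite itg_sum; last by move=> m _; continuity.
  rewrite (bigD1 (Ordinal nN))//= big1 ?addr0 => [|m mn].
    rewrite itgZ; last by continuity.
    by rewrite -[X in _ - _ * X]/(itg 0 pi (fun x => mode n x ^+ 2)) /c/= divfK ?subrr// gt_eqF// mode_norm_gt0.
  rewrite itgZ; last by continuity.
  by rewrite mode_orth ?mulr0// => E; case/eqP: mn; apply/val_inj.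
have Ef : energy v v v' v' <= energy f f f' f'.
  (* [f] is [v] minus the combination with coefficients [- c], so Pythagoras compares the two
     energies. *)
  have := projection_energy Cv vo (fun n => - c n).
  have -> : energy f f f' f' = energy (fun x => v x - \sum_(n < N.+1) - c n * mode n x)
    (fun x => v x - \sum_(n < N.+1) - c n * mode n x) (fun x => v' x - \sum_(n < N.+1) - c n * mode' n x)
    (fun x => v' x - \sum_(n < N.+1) - c n * mode' n x).
    have e1 : (fun x => v x - \sum_(n < N.+1) - c n * mode n x) = f.
      apply/funext => x; have -> : \sum_(n < N.+1) - c n * mode n x = - s x.
        by rewrite /s -sumrN; apply: eq_bigr => n _; rewrite mulNr.
      by rewrite /v opprK subrK.
    have e2 : (fun x => v' x - \sum_(n < N.+1) - c n * mode' n x) = f'.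
      apply/funext => x; have -> : \sum_(n < N.+1) - c n * mode' n x = - s' x.
        by rewrite /s' -sumrN; apply: eq_bigr => n _; rewrite mulNr.
      by rewrite /v' opprK subrK.
    by rewrite e1 e2.
  move=> ->; rewrite lerDl sumr_ge0// => n _.
  by rewrite mulr_ge0 ?sqr_ge0// mulr_ge0 ?sqr_ge0// ltW// mode_norm_gt0.
have := le_trans (rayleigh Cv vo) Ef.
have iv : 0 <= itg 0 pi (fun x => v x ^+ 2) by apply: itg_ge0 => x _; exact: sqr_ge0.
have N1 : energy f f f' f' / e < N%:R.
  rewrite /N; have [e_ge|e_lt] := leP 0 (energy f f f' f' / e).
    by have /andP[] := Num.Theory.truncn_itv e_ge.
  exact: lt_le_trans e_lt (ler0n _ _).
have N2 : (1:R) <= N%:R by rewrite ler1n.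
move: N1; rewrite ltr_pdivrMr// => N1 H; have {}H := le_lt_trans H N1.
rewrite leNgt; apply/negP => Ie.
suff : N%:R * e < N%:R ^+ 2 * itg 0 pi (fun x => v x ^+ 2).
  by move=> /(lt_trans H); rewrite ltxx.
have N0 : 0 < N%:R :> R by exact: lt_le_trans N2.
rewrite expr2 -mulrA ltr_pM2l//; apply: (lt_le_trans Ie).
by rewrite -[leLHS]mul1r ler_wpM2r.
Qed.

End Eigenfunctions.

(** * The area measure of the plane *)

Section PlaneMeasurability.
Context {R : realType}.

Lemma ball_itv (x e y : R) : x - e < y -> y < x + e -> ball x e y.
Proof. by move=> ? ?; rewrite -ball_normE /ball_/= ltr_distlC; apply/andP. Qed.

(** Measurability refers to the product sigma-algebra; an open set is the countable union of the
    rectangles with rational ends that it contains. *)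
Lemma plane_open_measurable (A : set (R * R)) : open A -> measurable A.
Proof.
move=> oA.
pose rect (q : (rat * rat) * (rat * rat)) : set (R * R) :=
  `]ratr q.1.1, ratr q.1.2[ `*` `]ratr q.2.1, ratr q.2.2[.
have -> : A = \bigcup_(q in [set: (rat * rat) * (rat * rat)])
    (if `[< rect q `<=` A >] then rect q else set0).
  apply/seteqP; split => [[x y] Axy|z [q _]]; last by case: asboolP => // qA /qA.
  have /nbhs_ballP[e /= e0 eA] : nbhs (x, y) A by exact: open_nbhs_nbhs.
  have [a] := @rat_in_itvoo R (x - e) x ltac:(lra).
  have [b] := @rat_in_itvoo R x (x + e) ltac:(lra).
  have [c] := @rat_in_itvoo R (y - e) y ltac:(lra).
  have [d] := @rat_in_itvoo R y (y + e) ltac:(lra).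
  rewrite !in_itv/= => /andP[d1 d2] /andP[c1 c2] /andP[b1 b2] /andP[a1 a2].
  exists ((a, b), (c, d)) => //; rewrite asboolT.
    by split; rewrite /= in_itv/=; apply/andP; split.
  move=> [s t] [] /=; rewrite !in_itv/= => /andP[s1 s2] /andP[t1 t2].
  by apply: eA; split; apply: ball_itv => /=; lra.
apply: countable_bigcupT_measurable => [|q]; first exact: countableP.
by case: asboolP => // _; apply: measurableX; exact: measurable_itv.
Qed.

Lemma plane_cont_measurable (f : R * R -> R) : continuous f -> measurable_fun setT f.
Proof.
move=> /continuousP cf; apply: (measurability _ (RGenOpens.measurableE R)).
move=> _ [_ [a [b ->] <-]]; rewrite setTI; apply: plane_open_measurable.
exact/cf/interval_open.
Qed.

End PlaneMeasurability.

Section AreaInvariance.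
Context {R : realType}.
Local Notation leb := (@lebesgue_measure R).

Lemma leb_shift (c : R) (A : set R) : measurable A ->
  leb ((fun y : measurableTypeR R => (y + c : measurableTypeR R)) @^-1` A) = leb A.
Proof.
move=> mA; rewrite -/(pushforward leb (fun y : measurableTypeR R => (y + c : measurableTypeR R)) A).
have mf : measurable_fun [set: measurableTypeR R] (fun y : measurableTypeR R => (y + c : measurableTypeR R)).
  apply: continuous_measurable_fun => x; apply: cvgD; [exact: cvg_id|exact: cvg_cst].
apply/esym/lebesgue_measure_unique => //= _ [[a b]] _ <-.
have -> : pushforward leb (fun y : measurableTypeR R => (y + c : measurableTypeR R)) `]a, b]
  = leb `]a - c, b - c].
  rewrite /pushforward; congr (leb _); apply/seteqP; split => x /=; rewrite !in_itv/= => /andP[? ?];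
  by apply/andP; split; lra.
rewrite !lebesgue_measure_itv/= !lte_fin ltrD2r.
by case: ifP => // _; rewrite -!EFinB; congr EFin; ring.
Qed.

Definition area_preserving (T : R * R -> R * R) : Prop :=
  measurable_fun setT T /\
  forall A : set (R * R), measurable A -> area (T @^-1` A) = area A.

Lemma area_preserving_comp S T : area_preserving S -> area_preserving T ->
  area_preserving (S \o T).
Proof.
move=> [mS aS] [mT aT]; split; first exact: measurableT_comp.
move=> A mA; rewrite comp_preimage aT ?aS//.
by rewrite -[X in measurable X]setTI; exact: mS.
Qed.

(** The area is computed by vertical sections, and a vertical shear only translates each of them. *)
Lemma area_preserving_vshear (g : R -> R) : continuous g ->
  area_preserving (fun p => (p.1, p.2 + g p.1)).
Proof.
move=> cg.
have mT : measurable_fun setT (fun p : R * R => (p.1, p.2 + g p.1)).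
  apply: measurable_fun_pair; first exact: measurable_fst.
  apply: measurable_funD; first exact: measurable_snd.
  apply: measurableT_comp; last exact: measurable_fst.
  exact: continuous_measurable_fun.
split; [exact: mT|move=> A mA].
have mTA : measurable ((fun p : R * R => (p.1, p.2 + g p.1)) @^-1` A).
  by rewrite -[X in measurable X]setTI; exact: mT.
rewrite /product_measure1; apply: eq_integral => x _ /=.
rewrite -[RHS](leb_shift (g x)); last exact: measurable_xsection.
by congr (leb _); rewrite !xsectionE.
Qed.

(** This allows slicing horizontally, as the other family of shears requires. *)
Lemma area_product2 (A : set (R * R)) : measurable A ->
  area A = (leb \x^ leb)%E A.
Proof.
move=> mA; apply: product_measure_unique => // B C mB mC.
exact: product_measure2E.
Qed.

Lemma area_preserving_hshear (g : R -> R) : continuous g ->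
  area_preserving (fun p => (p.1 + g p.2, p.2)).
Proof.
move=> cg.
have mT : measurable_fun setT (fun p : R * R => (p.1 + g p.2, p.2)).
  apply: measurable_fun_pair; last exact: measurable_snd.
  apply: measurable_funD; first exact: measurable_fst.
  apply: measurableT_comp; last exact: measurable_snd.
  exact: continuous_measurable_fun.
split; [exact: mT|move=> A mA].
have mTA : measurable ((fun p : R * R => (p.1 + g p.2, p.2)) @^-1` A).
  by rewrite -[X in measurable X]setTI; exact: mT.
rewrite !area_product2// /product_measure2; apply: eq_integral => x _ /=.
rewrite -[RHS](leb_shift (g x)); last exact: measurable_ysection.
by congr (leb _); rewrite !ysectionE.
Qed.

Definition rot (a b : R) (p : R * R) : R * R := (a * p.1 - b * p.2, b * p.1 + a * p.2).

(* A rotation by an angle that is not a multiple of [pi] is a product of three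
   shears; the half turn is the product of two quarter turns. *)
Lemma area_preserving_rot a b : a ^+ 2 + b ^+ 2 = 1 -> area_preserving (rot a b).
Proof.
have gen a' b' : a' ^+ 2 + b' ^+ 2 = 1 -> b' != 0 -> area_preserving (rot a' b').
  (* For the rotation by an angle [t], [c] is [- tan (t / 2)]; the shears by [c], [b'] and [c]
     compose to it. *)
  move=> ab b0; pose c := (a' - 1) / b'.
  have cl (k : R) : continuous (fun x : R => k * x) by continuity.
  have := area_preserving_comp (area_preserving_hshear (cl c))
    (area_preserving_comp (area_preserving_vshear (cl b')) (area_preserving_hshear (cl c))).
  congr area_preserving; apply/funext => -[x y]; rewrite /rot/= /c; congr pair; last by field.
  have -> : x + (a' - 1) / b' * y + (a' - 1) / b' * (y + b' * (x + (a' - 1) / b' * y))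
     = a' * x + (a' ^+ 2 - 1) / b' * y by field.
  by rewrite (_ : a' ^+ 2 - 1 = - b' ^+ 2); [field|rewrite -ab; ring].
move=> ab; have [b0|b0] := eqVneq b 0; last exact: gen.
have a0 : - a != 0.
  by rewrite oppr_eq0; apply/eqP => a0; move: ab; rewrite a0 b0 expr0n addr0 => /eqP; rewrite eq_sym oner_eq0.
have := area_preserving_comp (@gen b (- a) _ a0) (@gen 0 1 _ (oner_neq0 _)).
rewrite sqrrN addrC => /(_ ab); rewrite expr0n expr1n add0r => /(_ erefl).
congr area_preserving; apply/funext => -[x y]; rewrite /rot/=; congr pair; ring.
Qed.

End AreaInvariance.

(** * Square integrable functions *)

(** [young] will be used with the weight [e / (2 * (n + 1))], where [n] is a squared norm; adding
    [1] covers the case [n = 0]. *)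
Lemma half_share (R : realFieldType) (e n : R) : 0 < e -> 0 <= n ->
  e / (2 * (n + 1)) * n <= e / 2.
Proof.
move=> e0 n0; have n1 : 0 < n + 1 by lra.
have -> : e / (2 * (n + 1)) * n = e / 2 * (n / (n + 1)) by field; rewrite gt_eqF.
by rewrite ler_piMr ?divr_ge0 ?ltW// ltr_pdivrMr//; lra.
Qed.

Section SquareIntegrable.
Context d (T : measurableType d) {R : realType}.
Variables (mu : {measure set T -> \bar R}) (D : set T) (mD : measurable D).
Implicit Types f g w z : T -> R.

(** [L2] over an arbitrary measure space, so that the square, the box and the sides are treated
    alike. *)
Definition sqi f := measurable_fun D f /\
  (\int[mu]_(x in D) ((f x) ^+ 2)%:E < +oo)%E.

Lemma sqi_sq f : sqi f -> mu.-integrable D (EFin \o (fun x => f x ^+ 2)).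
Proof.
move=> [mf lf]; apply/integrableP; split.
  by apply/measurable_EFinP; exact: measurable_funX.
apply: le_lt_trans lf; rewrite le_eqVlt; apply/orP; left; apply/eqP.
by apply: eq_integral => x _; rewrite /= ger0_norm// sqr_ge0.
Qed.

Lemma sqi_mul f g : sqi f -> sqi g -> mu.-integrable D (EFin \o (fun x => f x * g x)).
Proof.
move=> Hf Hg; have [mf _] := Hf; have [mg _] := Hg.
apply: (le_integrable mD _ _ (integrableD mD (sqi_sq Hf) (sqi_sq Hg))).
  by apply/measurable_EFinP; exact: measurable_funM.
move=> x _ /=; rewrite lee_fin [X in _ <= X]ger0_norm ?addr_ge0 ?sqr_ge0// normrM.
rewrite -(real_normK (num_real (f x))) -(real_normK (num_real (g x))).
have := sqr_ge0 (`|f x| - `|g x|); have := mulr_ge0 (normr_ge0 (f x)) (normr_ge0 (g x)).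
nra.
Qed.

Lemma sqi_of f : measurable_fun D f -> mu.-integrable D (EFin \o (fun x => f x ^+ 2)) -> sqi f.
Proof.
move=> mf /integrableP[_ lf]; split => //; apply: le_lt_trans lf.
rewrite le_eqVlt; apply/orP; left; apply/eqP.
by apply: eq_integral => x _; rewrite /= ger0_norm// sqr_ge0.
Qed.

Lemma sqiD f g : sqi f -> sqi g -> sqi (fun x => f x + g x).
Proof.
move=> Hf Hg; have [mf _] := Hf; have [mg _] := Hg.
apply: sqi_of; first exact: measurable_funD.
have H1 := integrableD mD (sqi_sq Hf) (sqi_sq Hg).
have H2 := integrableD mD H1 (integrableD mD (sqi_mul Hf Hg) (sqi_mul Hf Hg)).
apply: eq_integrable H2 => // x _; rewrite /= -!EFinD; congr EFin; ring.
Qed.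

Lemma sqiZ c f : sqi f -> sqi (fun x => c * f x).
Proof.
move=> Hf; have [mf _] := Hf.
apply: sqi_of; first exact: measurable_funM.
have := integrableZl mD (c ^+ 2) (sqi_sq Hf).
by apply: eq_integrable => // x _; rewrite /= -EFinM exprMn.
Qed.

Lemma sqiB f g : sqi f -> sqi g -> sqi (fun x => f x - g x).
Proof.
move=> Hf Hg; have := sqiD Hf (sqiZ (-1) Hg); congr sqi.
by apply/funext => x; rewrite mulN1r.
Qed.

Lemma sqi0 : sqi (fun=> 0).
Proof.
split; first exact: measurable_cst.
by rewrite (eq_integral (cst 0%E)) ?integral0// => x _; rewrite expr0n.
Qed.

Lemma sqi_sum (J : Type) (r : seq J) (P : pred J) (F : J -> T -> R) :
  (forall j, P j -> sqi (F j)) -> sqi (fun x => \sum_(j <- r | P j) F j x).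
Proof.
move=> HF; elim: r => [|j r ih].
  by rewrite (_ : (fun x => _) = fun=> 0); [exact: sqi0|apply/funext => x; rewrite big_nil].
have [Pj|Pj] := boolP (P j).
  rewrite (_ : (fun x => _) = fun x => F j x + \sum_(j <- r | P j) F j x).
    by apply: sqiD => //; exact: HF.
  by apply/funext => x; rewrite big_cons Pj.
by rewrite (_ : (fun x => _) = fun x => \sum_(j <- r | P j) F j x)//; apply/funext => x; rewrite big_cons (negbTE Pj).
Qed.

Lemma Rint_mulD z f g : sqi z -> sqi f -> sqi g ->
  \int[mu]_(x in D) (z x * (f x + g x)) =
  \int[mu]_(x in D) (z x * f x) + \int[mu]_(x in D) (z x * g x).
Proof.
move=> Hz Hf Hg; rewrite -RintegralD//; [|exact: sqi_mul..].
by apply: eq_Rintegral => x _; rewrite mulrDr.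
Qed.

Lemma Rint_mulZ z c f : sqi z -> sqi f ->
  \int[mu]_(x in D) (z x * (c * f x)) = c * \int[mu]_(x in D) (z x * f x).
Proof.
move=> Hz Hf; rewrite -RintegralZl//; last exact: sqi_mul.
by apply: eq_Rintegral => x _; rewrite mulrCA.
Qed.

Lemma Rint_mulB z f g : sqi z -> sqi f -> sqi g ->
  \int[mu]_(x in D) (z x * (f x - g x)) =
  \int[mu]_(x in D) (z x * f x) - \int[mu]_(x in D) (z x * g x).
Proof.
move=> Hz Hf Hg; rewrite -RintegralB//; [|exact: sqi_mul..].
by apply: eq_Rintegral => x _; rewrite mulrBr.
Qed.

Lemma Rint_mul_sum z (J : Type) (r : seq J) (P : pred J) (F : J -> T -> R) (c : J -> R) :
  sqi z -> (forall j, P j -> sqi (F j)) ->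
  \int[mu]_(x in D) (z x * \sum_(j <- r | P j) c j * F j x) =
  \sum_(j <- r | P j) c j * \int[mu]_(x in D) (z x * F j x).
Proof.
move=> Hz HF; elim: r => [|j r ih].
  rewrite big_nil; under eq_Rintegral do rewrite big_nil mulr0.
  by rewrite Rintegral_cst// mul0r.
rewrite big_cons; case: ifP => Pj.
  rewrite -ih -Rint_mulZ -?Rint_mulD//.
  - by apply: eq_Rintegral => x _; rewrite big_cons Pj.
  - by apply: sqiZ; exact: HF.
  - by apply: sqi_sum => k Pk; apply: sqiZ; exact: HF.
  - exact: HF.
by rewrite -ih; apply: eq_Rintegral => x _; rewrite big_cons Pj.
Qed.

Definition nrm2 f := \int[mu]_(x in D) (f x ^+ 2).

Lemma nrm2_ge0 f : 0 <= nrm2 f.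
Proof. by apply: Rintegral_ge0 => x _; exact: sqr_ge0. Qed.

Lemma nrm2E f : sqi f -> (\int[mu]_(x in D) ((f x) ^+ 2)%:E)%E = (nrm2 f)%:E.
Proof.
move=> Hf; rewrite /nrm2 /Rintegral fineK//.
by have := integrable_fin_num mD (sqi_sq Hf).
Qed.

(** Takes the place of Cauchy-Schwarz: it follows pointwise from [(eta a - b)^2 >= 0], and the free
    weight [eta] is adapted to the wanted error. *)
Lemma young w g eta : sqi w -> sqi g -> 0 < eta ->
  `|\int[mu]_(x in D) (w x * g x)| <= eta * nrm2 w + eta^-1 * nrm2 g.
Proof.
move=> Hw Hg e0; have sw := sqi_sq Hw; have sg := sqi_sq Hg; have swg := sqi_mul Hw Hg.
apply: (le_trans (le_normr_Rintegral mD swg)).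
have s1 : mu.-integrable D (EFin \o (fun x => eta * w x ^+ 2)).
  by have := integrableZl mD eta sw; apply: eq_integrable.
have s2 : mu.-integrable D (EFin \o (fun x => eta^-1 * g x ^+ 2)).
  by have := integrableZl mD eta^-1 sg; apply: eq_integrable.
have E1 : eta * nrm2 w = \int[mu]_(x in D) (eta * w x ^+ 2) by rewrite RintegralZl.
have E2 : eta^-1 * nrm2 g = \int[mu]_(x in D) (eta^-1 * g x ^+ 2) by rewrite RintegralZl.
rewrite E1 E2 -RintegralD//; apply: le_Rintegral => //.
- have := integrable_abse swg; by apply: eq_integrable => // x _.
- by have := integrableD mD s1 s2; apply: eq_integrable.
move=> x _; rewrite normrM -(real_normK (num_real (w x))) -(real_normK (num_real (g x))).
set a := `|w x|; set b := `|g x|.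
have a0 : 0 <= a by exact: normr_ge0.
have b0 : 0 <= b by exact: normr_ge0.
have i0 : 0 < eta^-1 by rewrite invr_gt0.
have -> : eta * a ^+ 2 + eta^-1 * b ^+ 2 = eta^-1 * ((eta * a) ^+ 2 + b ^+ 2).
  by field; rewrite gt_eqF.
rewrite -ler_pdivrMl ?invrK//.
have := sqr_ge0 (eta * a - b); have := mulr_ge0 (mulr_ge0 (ltW e0) a0) b0; nra.
Qed.

Lemma orth_closed z f : sqi z -> sqi f ->
  (forall e, 0 < e -> exists g, [/\ sqi g, \int[mu]_(x in D) (z x * g x) = 0 &
     nrm2 (fun x => f x - g x) <= e]) ->
  \int[mu]_(x in D) (z x * f x) = 0.
Proof.
move=> Hz Hf H; apply/eqP; rewrite -normr_le0; apply/ler_addgt0Pl => e e0.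
rewrite addr0.
pose eta := e / (2 * (nrm2 z + 1)).
have nz := nrm2_ge0 z.
have eta0 : 0 < eta by rewrite divr_gt0// mulr_gt0//; lra.
have [g [Hg zg fg]] := H (eta * (e / 2)) ltac:(by rewrite mulr_gt0// divr_gt0).
have -> : \int[mu]_(x in D) (z x * f x) = \int[mu]_(x in D) (z x * (f x - g x)).
  by rewrite Rint_mulB// zg subr0.
apply: (le_trans (young Hz (sqiB Hf Hg) eta0)).
have -> : e = e / 2 + e / 2 by field.
apply: lerD.
  exact: half_share.
by rewrite ler_pdivrMl.
Qed.

Lemma l2_lim w f (phi : nat -> T -> R) : sqi w -> sqi f -> (forall n, sqi (phi n)) ->
  (\int[mu]_(x in D) ((phi n x - f x) ^+ 2)%:E)%E @[n --> \oo] --> 0%E ->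
  \int[mu]_(x in D) (w x * phi n x) @[n --> \oo] --> \int[mu]_(x in D) (w x * f x).
Proof.
move=> Hw Hf Hphi Hlim.
have Hlim' : nrm2 (fun x => phi n x - f x) @[n --> \oo] --> (0:R).
  exact: (fine_cvg Hlim).
apply/cvgrPdist_le => e e0.
pose eta := e / (2 * (nrm2 w + 1)).
have nw := nrm2_ge0 w.
have eta0 : 0 < eta by rewrite divr_gt0// mulr_gt0//; lra.
have ee0 : 0 < eta * (e / 2) by rewrite mulr_gt0// divr_gt0.
move/cvgrPdist_le : Hlim' => /(_ _ ee0); apply: filterS => n.
rewrite sub0r normrN (ger0_norm (nrm2_ge0 _)) => Hn.
rewrite distrC -Rint_mulB//.
apply: (le_trans (young Hw (sqiB (Hphi n) Hf) eta0)).
have -> : e = e / 2 + e / 2 by field.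
apply: lerD.
  exact: half_share.
by rewrite ler_pdivrMl.
Qed.

Lemma nrm2_eq0_ae f : sqi f -> nrm2 f = 0 -> f = (fun=> 0) %[ae mu in D].
Proof.
move=> Hf f0; have [mf _] := Hf.
have : (\int[mu]_(x in D) `|(f x ^+ 2)%:E|)%E = 0%E.
  rewrite -[RHS]/(0%:E) -f0 -(nrm2E Hf); apply: eq_integral => x _.
  by rewrite gee0_abs// lee_fin sqr_ge0.
move/ae_eq_integral_abs => /(_ mD).
have mf2 : measurable_fun D (EFin \o (fun x => f x ^+ 2)).
  by apply/measurable_EFinP; exact: measurable_funX.
move=> /(_ mf2); apply: filterS => x /= H Dx.
by have := H Dx => -[/eqP]; rewrite sqrf_eq0 => /eqP.
Qed.

End SquareIntegrable.

(** * Smooth functions along the sides of the square *)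

Section ChainRule.
Context {R : realType}.

Lemma mvt_abs (f f' : R -> R) (x y : R) : (forall t, is_derive t (1:R) f (f' t)) ->
  exists t, `|t - x| <= `|y - x| /\ f y - f x = f' t * (y - x).
Proof.
move=> df.
have wf (a b : R) : {within `[a, b], continuous f}.
  by apply: derivable_within_continuous => t _; have [] := df t.
have [xy|yx] := leP x y.
  have [t] := MVT_segment xy (fun t _ => df t) (wf x y).
  rewrite in_itv/= => /andP[xt ty] ->; exists t; split => //.
  by rewrite !ger0_norm ?subr_ge0// lerD2r.
have [t] := MVT_segment (ltW yx) (fun t _ => df t) (wf y x).
rewrite in_itv/= => /andP[yt tx] E; exists t; split.
  by rewrite !ler0_norm ?subr_le0 ?(ltW yx)//; lra.
by rewrite -[LHS]opprB E; ring.
Qed.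

Lemma is_derive_cvg (f : R -> R) (x l : R) :
  (h^-1 * (f (h + x) - f x)) @[h --> (0:R)^'] --> l -> is_derive x (1:R) f l.
Proof.
move=> H.
have E : (fun h : R => h^-1 *: ((f \o shift x) (h *: (1:R)) - f x)) =
         (fun h => h^-1 * (f (h + x) - f x)).
  by apply/funext => h /=; rewrite /GRing.scale/= mulr1.
apply: DeriveDef.
  by rewrite /derivable E; apply/cvg_ex; exists l.
by rewrite /derive E; apply/cvg_lim.
Qed.

Lemma is_derive_fst (phi : R * R -> R) (x y : R) : derivable phi (x, y) (axis R false) ->
  is_derive x (1:R) (fun t => phi (t, y)) (partial false phi (x, y)).
Proof.
move=> d.
have E : (fun h : R => h^-1 *: ((phi \o shift (x, y)) (h *: axis R false) - phi (x, y)))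
  = (fun h : R => h^-1 *: (((fun t => phi (t, y)) \o shift x) (h *: (1:R)) - phi (x, y))).
  apply/funext => h /=; congr (_ *: (phi _ - _)).
  by rewrite /axis; congr pair; rewrite /= /GRing.scale/= mulr0 add0r.
apply: DeriveDef; first by move: d; rewrite /derivable E.
by rewrite /partial /derive E.
Qed.

Lemma is_derive_snd (phi : R * R -> R) (x y : R) : derivable phi (x, y) (axis R true) ->
  is_derive y (1:R) (fun t => phi (x, t)) (partial true phi (x, y)).
Proof.
move=> d.
have E : (fun h : R => h^-1 *: ((phi \o shift (x, y)) (h *: axis R true) - phi (x, y)))
  = (fun h : R => h^-1 *: (((fun t => phi (x, t)) \o shift y) (h *: (1:R)) - phi (x, y))).
  apply/funext => h /=; congr (_ *: (phi _ - _)).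
  by rewrite /axis; congr pair; rewrite /= /GRing.scale/= mulr0 add0r.
apply: DeriveDef; first by move: d; rewrite /derivable E.
by rewrite /partial /derive E.
Qed.

Lemma cont_box (f : R * R -> R) (a b e : R) : continuous f -> 0 < e ->
  exists2 d, 0 < d & forall x y, `|x - a| < d -> `|y - b| < d -> `|f (x, y) - f (a, b)| < e.
Proof.
move=> cf e0; have /cvgrPdist_lt/(_ _ e0) := cf (a, b).
move=> /nbhs_ballP[d /= d0 H]; exists d => // x y xa yb.
rewrite distrC; apply: H; split => /=; rewrite -ball_normE /ball_/= distrC//.
Qed.

(** Only derivatives along the axes are given. The increment is split into a horizontal and a
    vertical leg, the mean value theorem is applied to each, and continuity of the partial
    derivatives gives the limit. *)
Lemma is_derive_line (phi : R * R -> R) (p v : R * R) (s : R) :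
  (forall i x, derivable phi x (axis R i)) ->
  continuous (partial false phi) -> continuous (partial true phi) ->
  is_derive s (1:R) (fun s => phi (p.1 + s * v.1, p.2 + s * v.2))
    (v.1 * partial false phi (p.1 + s * v.1, p.2 + s * v.2)
     + v.2 * partial true phi (p.1 + s * v.1, p.2 + s * v.2)).
Proof.
move=> dphi c0 c1; apply: is_derive_cvg.
set a := p.1 + s * v.1; set b := p.2 + s * v.2.
apply/cvgrPdist_lt => e e0.
pose k := `|v.1| + `|v.2| + 1.
have k0 : 0 < k by rewrite /k; have := normr_ge0 v.1; have := normr_ge0 v.2; lra.
have ek : 0 < e / k by rewrite divr_gt0.
have [d0 d00 H0] := cont_box a b c0 ek.
have [d1 d10 H1] := cont_box a b c1 ek.
near=> h.
have hn0 : h != 0 by near: h; exact: nbhs_dnbhs_neq.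
have hd : `|h| < Num.min d0 d1 / k.
  near: h; apply: dnbhs0_lt; rewrite divr_gt0// lt_min d00 d10//.
have hk : `|h| * k < d0 /\ `|h| * k < d1.
  by move: hd; rewrite ltr_pdivlMr// lt_min => /andP[].
have hv1 : `|h * v.1| <= `|h| * k.
  rewrite normrM ler_wpM2l// /k; have := normr_ge0 v.2; lra.
have hv2 : `|h * v.2| <= `|h| * k.
  rewrite normrM ler_wpM2l// /k; have := normr_ge0 v.1; lra.
have [t [ta E0]] := @mvt_abs (fun x => phi (x, b + h * v.2))
  (fun x => partial false phi (x, b + h * v.2)) a (a + h * v.1) (fun t => is_derive_fst (dphi false _)).
have [r [rb E1]] := @mvt_abs (fun y => phi (a, y))
  (fun y => partial true phi (a, y)) b (b + h * v.2) (fun t => is_derive_snd (dphi true _)).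
have -> : p.1 + (h + s) * v.1 = a + h * v.1 by rewrite /a; ring.
have -> : p.2 + (h + s) * v.2 = b + h * v.2 by rewrite /b; ring.
have -> : phi (a + h * v.1, b + h * v.2) - phi (a, b) =
  (phi (a + h * v.1, b + h * v.2) - phi (a, b + h * v.2)) + (phi (a, b + h * v.2) - phi (a, b)) by ring.
rewrite E0 E1.
set X := partial false phi (t, _); set Y := partial true phi (a, r).
set X0 := partial false phi (a, b); set Y0 := partial true phi (a, b).
have -> : v.1 * X0 + v.2 * Y0 - h^-1 * (X * (a + h * v.1 - a) + Y * (b + h * v.2 - b))
  = v.1 * (X0 - X) + v.2 * (Y0 - Y) by field.
have aE u : a + u - a = u by ring.
have bE u : b + u - b = u by ring.
rewrite aE in ta; rewrite bE in rb.
have XX : `|X0 - X| < e / k.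
  rewrite distrC; apply: H0; first by apply: (le_lt_trans ta); apply: (le_lt_trans hv1); case: hk.
  by rewrite bE; apply: (le_lt_trans hv2); case: hk.
have YY : `|Y0 - Y| < e / k.
  rewrite distrC; apply: H1; first by rewrite subrr normr0.
  by apply: (le_lt_trans rb); apply: (le_lt_trans hv2); case: hk.
apply: (le_lt_trans (ler_normD _ _)); rewrite !normrM.
have : `|v.1| * `|X0 - X| + `|v.2| * `|Y0 - Y| <= (`|v.1| + `|v.2|) * (e / k).
  by rewrite mulrDl; apply: lerD; rewrite ler_wpM2l// ltW.
move=> /le_lt_trans; apply.
have -> : e = k * (e / k) by field; rewrite gt_eqF.
have -> : k * (e / k) / k = e / k by field; rewrite gt_eqF.
rewrite ltr_pM2r// /k; lra.
Unshelve. all: by end_near. Qed.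

End ChainRule.

(** * Integration over the square *)

Section OpenBox.
Context {R : realType}.
Variables (L : R) (L0 : 0 < L).
Local Notation leb := (@lebesgue_measure R).

Definition box : set (R * R) := `]0, L[ `*` `]0, L[.

Lemma box_measurable : measurable box.
Proof. by apply: measurableX; exact: measurable_itv. Qed.

Lemma box_open : open box.
Proof.
have -> : box = fst @^-1` `]0, L[%classic `&` snd @^-1` `]0, L[%classic by [].
apply: openI; apply: open_comp; try exact: interval_open.
  by move=> p _; exact: cvg_fst.
by move=> p _; exact: cvg_snd.
Qed.

Lemma box_area : (area box < +oo)%E.
Proof.
have -> : area box = (leb (`]0%R, L[ : set R) * leb (`]0%R, L[ : set R))%E.
  by apply: product_measure1E; exact: measurable_itv.
by rewrite lebesgue_measure_itv/= lte_fin L0 -EFinB -EFinM ltry.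
Qed.

Lemma cont_pair (T U V : topologicalType) (f : T -> U) (g : T -> V) :
  continuous f -> continuous g -> continuous (fun x => (f x, g x)).
Proof. by move=> cf cg x; apply: cvg_pair; [exact: cf|exact: cg]. Qed.

Lemma cont_box_bounded (F : R * R -> R) : continuous F ->
  exists M, forall p, `[0, L]%classic p.1 -> `[0, L]%classic p.2 -> `|F p| <= M.
Proof.
move=> cF.
have K : compact (`[0, L] `*` `[0, L] : set (R * R)).
  by apply: compact_setX; exact: segment_compact.
have : bounded_set (F @` (`[0, L] `*` `[0, L])).
  by apply: compact_bounded; apply: continuous_compact => //; exact: continuous_subspaceT.
move=> [M [_ H]]; exists (M + 1) => p p1 p2; apply: (H (M + 1)); first by rewrite ltrDl.
by exists p.
Qed.

Lemma box_integrable (F : R * R -> R) : continuous F -> area.-integrable box (EFin \o F).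
Proof.
move=> cF; apply: measurable_bounded_integrable.
- exact: box_measurable.
- exact: box_area.
- by apply: measurable_funS (plane_cont_measurable cF).
- have [M H] := cont_box_bounded cF.
  exists M; split; first exact: num_real.
  move=> x Mx p [p1 p2]; apply: le_trans (ltW Mx).
  by apply: H; [move: p1|move: p2]; exact: subset_itv_oo_cc.
Qed.

Lemma box_sqi (F : R * R -> R) : continuous F -> sqi area box F.
Proof.
move=> cF; apply: sqi_of; first by apply: measurable_funS (plane_cont_measurable cF).
by apply: box_integrable; continuity.
Qed.

Lemma cont_section_fst (F : R * R -> R) y : continuous F -> continuous (fun x => F (x, y)).
Proof. by move=> cF; apply: (@cont_comp _ _ _ F) => //; apply: cont_pair; [exact: cont_id|move=> x; exact: cvg_cst]. Qed.

Lemma cont_section_snd (F : R * R -> R) x : continuous F -> continuous (fun y => F (x, y)).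
Proof. by move=> cF; apply: (@cont_comp _ _ _ F) => //; apply: cont_pair; [move=> ?; exact: cvg_cst|exact: cont_id]. Qed.

Let I_open (f : R -> R) : continuous f ->
  (\int[leb]_(x in `]0%R, L[) (f x)%:E)%E = (itg 0 L f)%:E.
Proof.
move=> cf.
have i : leb.-integrable `]0, L[ (EFin \o f).
  by apply: integrableS (cont_integrable 0 L cf) => //; exact: subset_itv_oo_cc.
have i' : leb.-integrable `]0, L] (EFin \o f).
  by apply: integrableS (cont_integrable 0 L cf) => //; exact: subset_itv_oc_cc.
rewrite -[LHS]fineK; last exact: integrable_fin_num.
congr EFin; rewrite -[LHS]/(\int[leb]_(x in `]0, L[) f x).
by rewrite Rintegral_itv_bndo_bndc// Rintegral_itv_obnd_cbnd.
Qed.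

Lemma box_Fubini_fst (F : R * R -> R) : continuous F -> 
  continuous (fun y => itg 0 L (fun x => F (x, y))) ->
  \int[area]_(p in box) F p = itg 0 L (fun y => itg 0 L (fun x => F (x, y))).
Proof.
move=> cF cI; rewrite /Rintegral.
have iF := box_integrable cF.
rewrite integral_mkcond -integral21_prod_meas1; last first.
  exact: ((@integrable_mkcond _ _ _ area box (EFin \o F) box_measurable).1 iF).
rewrite -[RHS]/(fine (itg 0 L (fun y => itg 0 L (fun x => F (x, y))))%:E) -I_open//.
rewrite [in RHS]integral_mkcond; congr fine; apply: eq_integral => y _.
rewrite /fubini_G patchE; case: ifPn => yL.
  rewrite -I_open; last exact: cont_section_fst.
  rewrite [in RHS]integral_mkcond; apply: eq_integral => x _; rewrite !patchE.
  by congr (if _ then _ else _); rewrite /box in_setX/= yL andbT.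
rewrite -[RHS](@integral0 _ _ _ leb setT); apply: eq_integral => x _; rewrite patchE.
by rewrite /box in_setX/= (negbTE yL) andbF.
Qed.

Lemma box_Fubini_snd (F : R * R -> R) : continuous F -> 
  continuous (fun x => itg 0 L (fun y => F (x, y))) ->
  \int[area]_(p in box) F p = itg 0 L (fun x => itg 0 L (fun y => F (x, y))).
Proof.
move=> cF cI; rewrite /Rintegral.
have iF := box_integrable cF.
rewrite integral_mkcond -integral12_prod_meas1; last first.
  exact: ((@integrable_mkcond _ _ _ area box (EFin \o F) box_measurable).1 iF).
rewrite -[RHS]/(fine (itg 0 L (fun y => itg 0 L (fun x => F (y, x))))%:E) -I_open//.
rewrite [in RHS]integral_mkcond; congr fine; apply: eq_integral => y _.
rewrite /fubini_F patchE; case: ifPn => yL.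
  rewrite -I_open; last exact: cont_section_snd.
  rewrite [in RHS]integral_mkcond; apply: eq_integral => x _; rewrite !patchE.
  by congr (if _ then _ else _); rewrite /box in_setX/= yL.
rewrite -[RHS](@integral0 _ _ _ leb setT); apply: eq_integral => x _; rewrite patchE.
by rewrite /box in_setX/= (negbTE yL).
Qed.

Lemma cont_fst (f : R -> R) : continuous f -> continuous (fun p : R * R => f p.1).
Proof. by move=> cf; apply: (@cont_comp _ _ _ f) => // p; exact: cvg_fst. Qed.
Lemma cont_snd (f : R -> R) : continuous f -> continuous (fun p : R * R => f p.2).
Proof. by move=> cf; apply: (@cont_comp _ _ _ f) => // p; exact: cvg_snd. Qed.

Lemma box_tensor (f g : R -> R) : continuous f -> continuous g ->
  \int[area]_(p in box) (f p.1 * g p.2) = itg 0 L f * itg 0 L g.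
Proof.
move=> cf cg; have cf1 := cont_fst cf; have cg2 := cont_snd cg.
have E y : itg 0 L (fun x => f x * g y) = itg 0 L f * g y.
  by rewrite mulrC -itgZ//; apply: eq_itg => x _; rewrite mulrC.
rewrite box_Fubini_fst/=; last 2 first.
- by continuity.
- have H : continuous (fun y => itg 0 L f * g y) by continuity.
  by apply: (cont_eq H) => y; rewrite E.
by rewrite -itgZ//; apply: eq_itg => y _; rewrite E.
Qed.

Lemma box_FTC_fst (F F' : R * R -> R) : continuous F -> continuous F' ->
  (forall x y, is_derive x (1:R) (fun x => F (x, y)) (F' (x, y))) ->
  \int[area]_(p in box) F' p = itg 0 L (fun y => F (L, y) - F (0, y)).
Proof.
move=> cF cF' dF.
have E y : itg 0 L (fun x => F' (x, y)) = F (L, y) - F (0, y).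
  by apply: (@FTC _ _ _ (fun x => F (x, y))) => //; split => //; exact: cont_section_fst.
have E' : (fun y => itg 0 L (fun x => F' (x, y))) = (fun y => F (L, y) - F (0, y)) by apply/funext.
rewrite box_Fubini_fst ?E'//.
have cL := @cont_section_snd F L cF; have c0 := @cont_section_snd F 0 cF.
by continuity.
Qed.

Lemma box_FTC_snd (F F' : R * R -> R) : continuous F -> continuous F' ->
  (forall x y, is_derive y (1:R) (fun y => F (x, y)) (F' (x, y))) ->
  \int[area]_(p in box) F' p = itg 0 L (fun x => F (x, L) - F (x, 0)).
Proof.
move=> cF cF' dF.
have E x : itg 0 L (fun y => F' (x, y)) = F (x, L) - F (x, 0).
  by apply: (@FTC _ _ _ (fun y => F (x, y))) => //; split => //; exact: cont_section_snd.
have E' : (fun x => itg 0 L (fun y => F' (x, y))) = (fun x => F (x, L) - F (x, 0)) by apply/funext.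
rewrite box_Fubini_snd ?E'//.
have cL := @cont_section_fst F L cF; have c0 := @cont_section_fst F 0 cF.
by continuity.
Qed.

End OpenBox.

(** * The rigid motion onto the square *)

Section Frame.
Context {R : realType}.
Variable S : square R.
Local Notation c := (corner S).
Local Notation d := (direction S).
Local Notation L := (side_length S).

(** The rigid motion that carries the box []0, L[^2] onto the square. [coord] is its inverse, built
    from the transposed rotation. *)
Definition place (p : R * R) : R * R :=
  (c.1 + (d.1 * p.1 - d.2 * p.2), c.2 + (d.2 * p.1 + d.1 * p.2)).
Definition coord (q : R * R) : R * R :=
  (d.1 * (q.1 - c.1) + d.2 * (q.2 - c.2), d.1 * (q.2 - c.2) - d.2 * (q.1 - c.1)).

Lemma placeK : cancel place coord.
Proof.
have d1 := direction_unit S.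
move=> [x y]; rewrite /place /coord/=; congr pair.
  by rewrite -[RHS]mul1r -d1; ring.
by rewrite -[RHS]mul1r -d1; ring.
Qed.

Lemma coordK : cancel coord place.
Proof.
have d1 := direction_unit S.
move=> [x y]; rewrite /place /coord/=; congr pair.
  by rewrite -[RHS](addrNK c.1) addrC -[X in _ = X + _]mul1r -d1; ring.
by rewrite -[RHS](addrNK c.2) addrC -[X in _ = X + _]mul1r -d1; ring.
Qed.

Lemma place_cont : continuous place.
Proof.
have c1' : continuous (fun p : R * R => p.1) by exact: cont_fst (@cont_id _).
have c2' : continuous (fun p : R * R => p.2) by exact: cont_snd (@cont_id _).
by apply: cont_pair; continuity.
Qed.

Lemma coord_cont : continuous coord.
Proof.
have c1' : continuous (fun p : R * R => p.1) by exact: cont_fst (@cont_id _).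
have c2' : continuous (fun p : R * R => p.2) by exact: cont_snd (@cont_id _).
by apply: cont_pair; continuity.
Qed.

Lemma square_placeE : square_set S = place @` box L.
Proof.
apply/seteqP; split => [_ [s /= sL] [t /= tL <-]|_ [[s t] [/= sL tL] <-]].
  exists (s, t) => //; rewrite /place/= [RHS]surjective_pairing; congr pair => /=.
    by rewrite /GRing.scale/=; ring.
  by rewrite /GRing.scale/=; ring.
exists s => //; exists t => //; rewrite /place/= [LHS]surjective_pairing; congr pair => /=.
  by rewrite /GRing.scale/=; ring.
by rewrite /GRing.scale/=; ring.
Qed.

Lemma square_coordE : square_set S = coord @^-1` box L.
Proof.
rewrite square_placeE; apply/seteqP; split => [_ [p pL <-]|q qL] /=; first by rewrite placeK.
by exists (coord q) => //; rewrite coordK.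
Qed.

Lemma place_square p : square_set S (place p) <-> box L p.
Proof. by rewrite square_coordE /= placeK. Qed.

Lemma coord_measurable : measurable_fun setT coord.
Proof.
have c1' : continuous (fun p : R * R => p.1) by exact: cont_fst (@cont_id _).
have c2' : continuous (fun p : R * R => p.2) by exact: cont_snd (@cont_id _).
by apply: measurable_fun_pair; apply: plane_cont_measurable; continuity.
Qed.

Lemma place_measurable : measurable_fun setT place.
Proof.
have c1' : continuous (fun p : R * R => p.1) by exact: cont_fst (@cont_id _).
have c2' : continuous (fun p : R * R => p.2) by exact: cont_snd (@cont_id _).
by apply: measurable_fun_pair; apply: plane_cont_measurable; continuity.
Qed.

Lemma square_measurable : measurable (square_set S).
Proof.
rewrite square_coordE -[X in measurable X]setTI; apply: coord_measurable => //.
exact: box_measurable.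
Qed.

Lemma square_open : open (square_set S).
Proof.
rewrite square_coordE; have /continuousP := coord_cont; apply.
exact: box_open.
Qed.

Lemma place_area_preserving : area_preserving place.
Proof.
have H := area_preserving_comp (area_preserving_hshear (@contC R R c.1))
 (area_preserving_comp (area_preserving_vshear (@contC R R c.2))
    (area_preserving_rot (direction_unit S))).
move: H; congr area_preserving; apply/funext => p.
by rewrite /place /rot/=; congr pair; rewrite addrC.
Qed.

Lemma preimage_square : place @^-1` square_set S = box L.
Proof. by apply/seteqP; split => p /place_square. Qed.

Lemma ge0_square_integral (f : R * R -> \bar R) : measurable_fun (square_set S) f ->
  (forall x, square_set S x -> (0 <= f x)%E) ->
  (\int[area]_(x in square_set S) f x = \int[area]_(p in box L) f (place p))%E.
Proof.
move=> mf f0; have [mp ap] := place_area_preserving.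
(* [area] is a measure on this type; the next three facts are restated over it for the change of
   variables. *)
pose RR := (measurableTypeR R * measurableTypeR R)%type.
have mp' : measurable_fun [set: RR] (place : RR -> RR) by exact: mp.
have mf' : measurable_fun (square_set S : set RR) (f : RR -> \bar R) by exact: mf.
have f0' : {in (square_set S : set RR), forall x, (0 <= f x)%E}.
  by move=> x; rewrite inE; exact: f0.
rewrite -preimage_square.
have H := ge0_integral_pushforward mp' area square_measurable mf' f0'.
rewrite -[RHS]H.
apply: eq_measure_integral => A mA _.
exact: esym (ap A mA).
Qed.

Lemma square_integral (f : R * R -> \bar R) : measurable_fun (square_set S) f ->
  (\int[area]_(x in square_set S) f x = \int[area]_(p in box L) f (place p))%E.
Proof.
move=> mf; rewrite [LHS]integralE [RHS]integralE.
rewrite (ge0_square_integral (measurable_funepos mf)) => [|x _]; last exact: funepos_ge0.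
rewrite (ge0_square_integral (measurable_funeneg mf)) => [|x _]; last exact: funeneg_ge0.
by congr (_ - _)%E; apply: eq_integral => x _; rewrite ?funeposE ?funenegE.
Qed.

Lemma square_Rintegral (f : R * R -> R) : measurable_fun (square_set S) f ->
  \int[area]_(x in S) f x = \int[area]_(p in box L) f (place p).
Proof.
move=> mf; rewrite /Rintegral square_integral//.
exact/measurable_EFinP.
Qed.

Lemma square_sqi f : sqi area S f -> sqi area (box L) (f \o place).
Proof.
move=> [mf lf]; split.
  apply: (measurable_comp square_measurable _ mf).
    by rewrite -preimage_square => _ [p Hp <-].
  apply: measurable_funS place_measurable => //.
move: lf; rewrite square_integral//.
by apply/measurable_EFinP; exact: measurable_funX.
Qed.

Lemma cont_sqi_square F : continuous F -> sqi area S F.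
Proof.
move=> cF; have mF : measurable_fun (square_set S) F.
  by apply: measurable_funS (plane_cont_measurable cF).
split => //.
rewrite square_integral; last by apply/measurable_EFinP; exact: measurable_funX.
have cFp : continuous (F \o place).
  by apply: (@cont_comp _ _ _ F) => //; exact: place_cont.
by have [] := box_sqi (side_length_gt0 S) cFp.
Qed.

End Frame.

(** * The product eigenfunctions *)

Section PlaneWaves.
Context {R : realType}.

Lemma is_derive_direction (f : R * R -> R) (q v : R * R) (l : R) :
  is_derive (0:R) (1:R) (fun h => f (q.1 + h * v.1, q.2 + h * v.2)) l -> is_derive q v f l.
Proof.
move=> [df fl].
have E : (fun h : R => h^-1 *: ((f \o shift q) (h *: v) - f q))
  = (fun h : R => h^-1 *: (((fun h => f (q.1 + h * v.1, q.2 + h * v.2)) \o shift 0) (h *: (1:R))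
      - f (q.1 + 0 * v.1, q.2 + 0 * v.2))).
  apply/funext => h /=; rewrite !mul0r !addr0 -surjective_pairing; congr (_ *: (f _ - _)).
  rewrite [LHS]surjective_pairing /GRing.scale/= mulr1.
  by congr pair; rewrite addrC.
apply: DeriveDef; first by move: df; rewrite /derivable E.
by move: fl; rewrite /derive E.
Qed.

(** Finite sums of plane waves are closed under partial derivatives, hence smooth. By the
    product-to-sum formula, a product of two modes in the coordinates of a tilted square is a sum of
    two such waves. *)
Inductive wave : (R * R -> R) -> Prop :=
| wave_cos A a b e : wave (fun q => A * cos (a * q.1 + b * q.2 - e))
| waveD f g : wave f -> wave g -> wave (fun q => f q + g q).

Lemma wave_cont f : wave f -> continuous f.
Proof.
have c1 : continuous (fun p : R * R => p.1) by exact: cont_fst (@cont_id _).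
have c2 : continuous (fun p : R * R => p.2) by exact: cont_snd (@cont_id _).
by elim=> [A a b e|{}f g _ cf _ cg]; continuity.
Qed.

Lemma wave_partial f i : wave f ->
  exists2 g, wave g & forall q, is_derive q (axis R i) f (g q).
Proof.
elim=> [A a b e|{}f g _ [f' wf df] _ [g' wg dg]]; last first.
  by exists (fun q => f' q + g' q) => [|q]; [exact: waveD|exact: is_deriveD].
pose k := a * (axis R i).1 + b * (axis R i).2.
(* The sine in the derivative is written as a cosine with its phase shifted by [pi / 2], so that it
   is again a wave. *)
exists (fun q => (- A * k) * cos (a * q.1 + b * q.2 - (e + pi / 2))) => [|q]; first exact: wave_cos.
apply: is_derive_direction.
have H := (C1Z A (C1_cos k (e - a * q.1 - b * q.2))).1 0.
have E : (fun h => A * cos (a * (q.1 + h * (axis R i).1) + b * (q.2 + h * (axis R i).2) - e))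
   = (fun x => A * cos (k * x - (e - a * q.1 - b * q.2))).
  by apply/funext => x; rewrite /k; congr (_ * cos _); ring.
rewrite /= E; apply: (is_derive_eq H).
have -> : a * q.1 + b * q.2 - (e + pi / 2) = (a * q.1 + b * q.2 - e) - pi / 2 by ring.
have -> : k * 0 - (e - a * q.1 - b * q.2) = a * q.1 + b * q.2 - e by ring.
by rewrite cosBpihalf; ring.
Qed.

Lemma wave_smooth f : wave f -> smooth f.
Proof.
move=> wf.
suff H s : wave (partials s f).
  move=> s; split=> [|i x]; first exact: wave_cont.
  by have [g _ dg] := wave_partial i (H s); have [] := dg x.
elim: s => //= i s ih.
have [g wg dg] := wave_partial i ih.
by rewrite (_ : partial i _ = g)//; apply/funext => x; have [_] := dg x.
Qed.

End PlaneWaves.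

(** * Smooth functions in the coordinates of the square *)

Section SmoothFunctions.
Context {R : realType}.
Variables (S : square R).
Local Notation d := (direction S).
Local Notation L := (side_length S).

Section Smooth.
Variables (phi : R * R -> R) (sm : smooth phi).

Lemma smooth_cont : continuous phi.
Proof. by have [] := sm [::]. Qed.

Lemma smooth_partial_cont i : continuous (partial i phi).
Proof. by have [] := sm [:: i]. Qed.

(** [Ds] and [Dt] are the derivatives along the two directions of the sides, that is, the partial
    derivatives of [phi] composed with [place]. *)
Definition Ds (p : R * R) := d.1 * partial false phi (place S p) + d.2 * partial true phi (place S p).
Definition Dt (p : R * R) := - d.2 * partial false phi (place S p) + d.1 * partial true phi (place S p).

Lemma smooth_place_cont : continuous (fun p => phi (place S p)).
Proof. by apply: (@cont_comp _ _ _ phi); [exact: place_cont|exact: smooth_cont]. Qed.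

Lemma partial_place_cont i : continuous (fun p => partial i phi (place S p)).
Proof. by apply: (@cont_comp _ _ _ (partial i phi)); [exact: place_cont|exact: smooth_partial_cont]. Qed.

Lemma Ds_cont : continuous Ds.
Proof.
by apply: contD; apply: contM; [exact: contC|exact: (@partial_place_cont false)|exact: contC|exact: (@partial_place_cont true)].
Qed.

Lemma Dt_cont : continuous Dt.
Proof.
by apply: contD; apply: contM; [exact: contC|exact: (@partial_place_cont false)|exact: contC|exact: (@partial_place_cont true)].
Qed.

Lemma Ds_derive (x y : R) : is_derive x (1:R) (fun x => phi (place S (x, y))) (Ds (x, y)).
Proof.
have dphi i q : derivable phi q (axis R i) by have [_] := sm [::]; apply.
have H := is_derive_line (place S (0, y)) d x dphi (@smooth_partial_cont false) (@smooth_partial_cont true).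
have E t : ((place S (0, y)).1 + t * d.1, (place S (0, y)).2 + t * d.2) = place S (t, y).
  by rewrite /place/=; congr pair; ring.
rewrite E in H; move: H; rewrite /Ds; congr is_derive.
by apply/funext => t; rewrite E.
Qed.

Lemma Dt_derive (x y : R) : is_derive y (1:R) (fun y => phi (place S (x, y))) (Dt (x, y)).
Proof.
have dphi i q : derivable phi q (axis R i) by have [_] := sm [::]; apply.
have H := is_derive_line (place S (x, 0)) (- d.2, d.1) y dphi (@smooth_partial_cont false) (@smooth_partial_cont true).
have E t : ((place S (x, 0)).1 + t * (- d.2, d.1).1, (place S (x, 0)).2 + t * (- d.2, d.1).2) = place S (x, t).
  by rewrite /place/=; congr pair; ring.
rewrite E in H; move: H; rewrite /Dt/=; congr is_derive.
by apply/funext => t; rewrite E.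
Qed.

Lemma partial_place i p : partial i phi (place S p) =
  if i then d.2 * Ds p + d.1 * Dt p else d.1 * Ds p - d.2 * Dt p.
Proof.
have d1 := direction_unit S; rewrite /Ds /Dt.
by case: i; rewrite -[LHS]mul1r -d1; move: (partial false phi _) (partial true phi _) => a b; ring.
Qed.

End Smooth.

Lemma grad_dot phi psi p :
  partial false phi (place S p) * partial false psi (place S p)
  + partial true phi (place S p) * partial true psi (place S p)
  = Ds phi p * Ds psi p + Dt phi p * Dt psi p.
Proof.
have d1 := direction_unit S; rewrite /Ds /Dt -[LHS]mul1r -d1.
move: (partial false phi _) (partial true phi _) (partial false psi _) (partial true psi _).
by move=> a b a' b'; ring.
Qed.

End SmoothFunctions.

(** Serves the boundary integral: the boundary is run counterclockwise, so two sides are traversed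
    against the coordinates. *)
Lemma itg_reverse (R : realType) (L : R) (f : R -> R) : 0 < L -> continuous f ->
  itg 0 L (fun t => f (L - t)) = itg 0 L f.
Proof.
move=> L0 cf.
(* The base point [-1] makes [K] differentiable on a neighbourhood of [[0, L]]. *)
pose K y := itg (-1) y f.
have dK (y : R) : -1 < y -> is_derive y (1:R) K (f y) by move=> y1; exact: itg_derive.
have dF (t : R) : 0 <= t <= L -> is_derive t (1:R) (fun t => - K (L - t)) (f (L - t)).
  move=> /andP[t0 tL].
  have dg : is_derive t (1:R) (fun t => L - t) (-1).
    have H : is_derive t 1 (fun t => L - t) (0 - 1) :=
      is_deriveB (is_derive_cst L t 1) (is_derive_id t 1).
    by apply: (is_derive_eq H); rewrite sub0r.
  have dKt : is_derive (L - t) (1:R) K (f (L - t)) by apply: dK; lra.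
  have H : is_derive t 1 (fun t => K (L - t)) _ := @is_derive1_comp _ K (fun t => L - t) _ _ _ dKt dg.
  have H' := is_deriveN H; apply: (is_derive_eq H'); ring.
have cF (t : R) : 0 <= t <= L -> {for t, continuous (fun t => - K (L - t))}.
  move=> tL; apply: differentiable_continuous; apply/derivable1_diffP.
  by have [] := dF t tL.
have cfr : continuous (fun t => f (L - t)).
  by apply: (@cont_comp _ _ _ f (fun t => L - t)) => //; continuity.
have sub t : t \in `]0, L[%R -> 0 <= t <= L.
  by rewrite in_itv/= => /andP[/ltW -> /ltW ->].
rewrite /itg {1}/Rintegral (@continuous_FTC2 _ (fun t => f (L - t)) (fun t => - K (L - t)))//.
- rewrite /= subrr subr0 /K (@itg_cat _ (-1) 0 L)//; last exact: ltW.
  by rewrite /itg; lra.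
- exact: continuous_subspaceT.
- split => [t /sub tL||]; first by have [] := dF t tL.
  + by apply: cvg_at_right_filter; apply: cF; rewrite lexx ltW.
  + by apply: cvg_at_left_filter; apply: cF; rewrite lexx ltW.
- by move=> t /sub tL; rewrite derive1E; have [] := dF t tL.
Qed.

(** * The boundary of the square *)

Section Sides.
Context {R : realType}.
Variable S : square R.
Local Notation L := (side_length S).

Definition side_point (i : nat) (t : R) : R * R :=
  match i with 0%N => (t, 0) | 1%N => (L, t) | 2%N => (L - t, L) | _ => (0, L - t) end.

Lemma sideE (i : 'I_4) t : side S i t = place S (side_point i t).
Proof.
rewrite /side /place /quarter_turn; case: i => -[|[|[|[|//]]]] ? /=;
rewrite ?big_ord_recr ?big_ord0 /=; case: (corner S) => c1 c2; case: (direction S) => d1 d2;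
rewrite [LHS]surjective_pairing /GRing.scale/=; congr pair; rewrite /GRing.scale/=; ring.
Qed.

Lemma side_cont (i : 'I_4) : continuous (side S i).
Proof.
have E : side S i = fun t => place S (side_point i t) by apply/funext => t; rewrite sideE.
have cl : continuous (fun t : R => L - t) by continuity.
have cs : continuous (side_point i).
  by case: i {E} => -[|[|[|[|//]]]] ? /=; apply: cont_pair => //; continuity.
by rewrite E => t; apply: (@continuous_comp _ _ _ (side_point i) (place S)); [exact: cs|exact: place_cont].
Qed.

Lemma boundary_integralE (f : R * R -> R) : continuous f ->
  boundary_integral S f =
    itg 0 L (fun t => f (place S (t, 0))) + itg 0 L (fun t => f (place S (L, t)))
  + itg 0 L (fun t => f (place S (t, L))) + itg 0 L (fun t => f (place S (0, t))).
Proof.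
move=> cf; rewrite /boundary_integral !big_ord_recr big_ord0 /= add0r.
have cp : continuous (fun p => f (place S p)).
  by apply: (@cont_comp _ _ _ f) => //; exact: place_cont.
have L0 := side_length_gt0 S.
rewrite -(itg_reverse L0 (@cont_section_fst _ _ L cp)) -(itg_reverse L0 (@cont_section_snd _ _ 0 cp)).
by congr (_ + _ + _ + _); apply: eq_itg => t _; rewrite sideE.
Qed.

Lemma cont_boundary_L2 (f : R * R -> R) : continuous f -> boundary_L2 S f.
Proof.
move=> cf i.
have cg : continuous (fun t => f (side S i t)) by apply: (@cont_comp _ _ _ f) => //; exact: side_cont.
split; first by apply: measurable_funS (continuous_measurable_fun cg).
have cg2 : continuous (fun t => f (side S i t) ^+ 2) by continuity.
have : (\int[lebesgue_measure]_(t in `[0%R, L]) ((f (side S i t)) ^+ 2)%:E)%E \is a fin_num.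
  by apply: integrable_fin_num => //; exact: cont_integrable cg2.
by rewrite ge0_fin_numE// integral_ge0// => x _; rewrite lee_fin sqr_ge0.
Qed.

End Sides.

Section ProductEigenfunction.
Context {R : realType}.
Variables (S : square R) (S_pi : side_length S = pi).
Variables (h : R) (al : nat -> R) (Hal : forall n, root_eq h n (al n)).
Local Notation mode := (mode al).
Local Notation mode' := (mode' al).

Definition product_mode (p : nat * nat) (q : R * R) : R :=
  mode p.1 (coord S q).1 * mode p.2 (coord S q).2.

Lemma product_mode_place p x y : product_mode p (place S (x, y)) = mode p.1 x * mode p.2 y.
Proof. by rewrite /product_mode placeK. Qed.

Lemma wave_product_mode p : wave (product_mode p).
Proof.
pose d := direction S; pose c := corner S.
pose a1 := al p.1; pose a2 := al p.2; pose t1 := tau al p.1; pose t2 := tau al p.2.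
have -> : product_mode p = fun q =>
  2^-1 * cos ((a1 * d.1 - a2 * d.2) * q.1 + (a1 * d.2 + a2 * d.1) * q.2
     - ((a1 * d.1 - a2 * d.2) * c.1 + (a1 * d.2 + a2 * d.1) * c.2 + t1 + t2))
  + 2^-1 * cos ((a1 * d.1 + a2 * d.2) * q.1 + (a1 * d.2 - a2 * d.1) * q.2
     - ((a1 * d.1 + a2 * d.2) * c.1 + (a1 * d.2 - a2 * d.1) * c.2 + t1 - t2)).
  apply/funext => q; rewrite /product_mode /mode /coord/= -/d -/c -/a1 -/a2 -/t1 -/t2.
  set X := a1 * _ - t1; set Y := a2 * _ - t2.
  have -> : (a1 * d.1 - a2 * d.2) * q.1 + (a1 * d.2 + a2 * d.1) * q.2
     - ((a1 * d.1 - a2 * d.2) * c.1 + (a1 * d.2 + a2 * d.1) * c.2 + t1 + t2) = X + Y.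
    by rewrite /X /Y; ring.
  have -> : (a1 * d.1 + a2 * d.2) * q.1 + (a1 * d.2 - a2 * d.1) * q.2
     - ((a1 * d.1 + a2 * d.2) * c.1 + (a1 * d.2 - a2 * d.1) * c.2 + t1 - t2) = X - Y.
    by rewrite /X /Y; ring.
  by rewrite (cosD X Y) (cosB X Y); field.
by apply: waveD; exact: wave_cos.
Qed.

Lemma product_mode_smooth p : smooth (product_mode p).
Proof. exact/wave_smooth/wave_product_mode. Qed.

Lemma product_mode_cont p : continuous (product_mode p).
Proof. exact: smooth_cont (product_mode_smooth p). Qed.

Lemma Ds_product_mode p x y : Ds S (product_mode p) (x, y) = mode' p.1 x * mode p.2 y.
Proof.
have [_ <-] := Ds_derive S (product_mode_smooth p) x y.
have := (C1Z (mode p.2 y) (C1_mode al p.1)).1 x => -[_].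
by rewrite mulrC => <-; congr ('D_1 _ x); apply/funext => t; rewrite product_mode_place mulrC.
Qed.

Lemma Dt_product_mode p x y : Dt S (product_mode p) (x, y) = mode p.1 x * mode' p.2 y.
Proof.
have [_ <-] := Dt_derive S (product_mode_smooth p) x y.
have := (C1Z (mode p.1 x) (C1_mode al p.2)).1 y => -[_ <-].
by congr ('D_1 _ y); apply/funext => t; rewrite product_mode_place.
Qed.

Definition product_eigenvalue (p : nat * nat) : R := al p.1 ^+ 2 + al p.2 ^+ 2.

(** Integration by parts in each coordinate: [K1] and [K2] are the derivatives of [F1] and [F2], and
    the boundary conditions of the modes turn the end values of [F1] and [F2] into [- h] times
    integrals over opposite sides. *)
Lemma green_smooth p phi : smooth phi ->
  \int[area]_(x in S) (partial false (product_mode p) x * partial false phi x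
     + partial true (product_mode p) x * partial true phi x)
  + h * boundary_integral S (fun x => product_mode p x * phi x)
  = product_eigenvalue p * \int[area]_(x in S) (product_mode p x * phi x).
Proof.
move=> sp.
have c0 := smooth_partial_cont sp; have cphi := smooth_cont sp.
have cw := @product_mode_cont p; have cdw := smooth_partial_cont (product_mode_smooth p).
have cgrad : continuous (fun x => partial false (product_mode p) x * partial false phi x
     + partial true (product_mode p) x * partial true phi x).
  by apply: contD; apply: contM; [exact: cdw|exact: c0|exact: cdw|exact: c0].
have cwphi : continuous (fun x => product_mode p x * phi x) by continuity.
rewrite !square_Rintegral; last 2 first.
- by apply: measurable_funS (plane_cont_measurable cwphi).
- by apply: measurable_funS (plane_cont_measurable cgrad).
rewrite boundary_integralE//.
have L0 := side_length_gt0 S.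
rewrite S_pi in L0 *.
pose psi q := phi (place S q).
have cpsi : continuous psi by exact: smooth_place_cont.
have cDs := @Ds_cont _ S _ sp; have cDt := @Dt_cont _ S _ sp.
have cu n : continuous (mode n) by exact: (@mode_cont R al n).
have cu' n : continuous (mode' n) by exact: (@mode'_cont R al n).
have cu1 n := @cont_fst _ _ (cu n); have cu2 n := @cont_snd _ _ (cu n).
have cu1' n := @cont_fst _ _ (cu' n); have cu2' n := @cont_snd _ _ (cu' n).
pose F1 q := mode' p.1 q.1 * mode p.2 q.2 * psi q.
pose K1 q := mode' p.1 q.1 * mode p.2 q.2 * Ds S phi q - al p.1 ^+ 2 * (mode p.1 q.1 * mode p.2 q.2 * psi q).
pose F2 q := mode p.1 q.1 * mode' p.2 q.2 * psi q.
pose K2 q := mode p.1 q.1 * mode' p.2 q.2 * Dt S phi q - al p.2 ^+ 2 * (mode p.1 q.1 * mode p.2 q.2 * psi q).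
have cF1 : continuous F1 by apply: contM => //; apply: contM; [exact: cu1'|exact: cu2].
have cF2 : continuous F2 by apply: contM => //; apply: contM; [exact: cu1|exact: cu2'].
have cuu : continuous (fun q => mode p.1 q.1 * mode p.2 q.2 * psi q).
  by apply: contM => //; apply: contM; [exact: cu1|exact: cu2].
have cG1 : continuous (fun q => mode' p.1 q.1 * mode p.2 q.2 * Ds S phi q).
  by apply: contM => //; apply: contM; [exact: cu1'|exact: cu2].
have cG2 : continuous (fun q => mode p.1 q.1 * mode' p.2 q.2 * Dt S phi q).
  by apply: contM => //; apply: contM; [exact: cu1|exact: cu2'].
have cK1 : continuous K1 by apply: contD => //; apply: contN; apply: contM => //; exact: contC.
have cK2 : continuous K2 by apply: contD => //; apply: contN; apply: contM => //; exact: contC.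
have dF1 (x y : R) : is_derive x (1:R) (fun x => F1 (x, y)) (K1 (x, y)).
  have d1 : is_derive x (1:R) (fun x => mode p.2 y * mode' p.1 x) (mode p.2 y * (- al p.1 ^+ 2 * mode p.1 x)).
    exact: (C1Z (mode p.2 y) (C1_mode' al p.1)).1.
  have d2 := Ds_derive S sp x y.
  have := is_deriveM d1 d2; rewrite /F1/=.
  have -> : (fun x => mode' p.1 x * mode p.2 y * psi (x, y)) =
     (fun x => mode p.2 y * mode' p.1 x) * (fun x => phi (place S (x, y))).
    by apply/funext => t; rewrite -[RHS]/(mode p.2 y * mode' p.1 t * phi (place S (t, y))) [mode p.2 y * _]mulrC.
  by move=> H; apply: (is_derive_eq H); rewrite /K1 /GRing.scale/= -/(psi (x, y)); ring.
have dF2 (x y : R) : is_derive y (1:R) (fun y => F2 (x, y)) (K2 (x, y)).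
  have d1 : is_derive y (1:R) (fun y => mode p.1 x * mode' p.2 y) (mode p.1 x * (- al p.2 ^+ 2 * mode p.2 y)).
    exact: (C1Z (mode p.1 x) (C1_mode' al p.2)).1.
  have d2 := Dt_derive S sp x y.
  have H := is_deriveM d1 d2; rewrite /F2/=.
  by apply: (is_derive_eq H); rewrite /K2 /GRing.scale/= -/(psi (x, y)); ring.
have E1 := box_FTC_fst L0 cF1 cK1 dF1.
have E2 := box_FTC_snd L0 cF2 cK2 dF2.
have IB (f g : R * R -> R) : continuous f -> continuous g -> \int[area]_(q in box pi) (f q - g q) =
   \int[area]_(q in box pi) f q - \int[area]_(q in box pi) g q.
  by move=> cf cg; rewrite RintegralB//; [exact: box_measurable|exact: (box_integrable L0)..].
have ID (f g : R * R -> R) : continuous f -> continuous g -> \int[area]_(q in box pi) (f q + g q) =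
   \int[area]_(q in box pi) f q + \int[area]_(q in box pi) g q.
  by move=> cf cg; rewrite RintegralD//; [exact: box_measurable|exact: (box_integrable L0)..].
have IZ (k : R) (f : R * R -> R) : continuous f -> \int[area]_(q in box pi) (k * f q) = k * \int[area]_(q in box pi) f q.
  by move=> cf; rewrite RintegralZl//; [exact: box_measurable|exact: (box_integrable L0)].
rewrite IB ?IZ// in E1; last by apply: contM => //; exact: contC.
rewrite IB ?IZ// in E2; last by apply: contM => //; exact: contC.
have -> : \int[area]_(q in box pi) (partial false (product_mode p) (place S q) * partial false phi (place S q)
     + partial true (product_mode p) (place S q) * partial true phi (place S q)) =
   \int[area]_(q in box pi) (mode' p.1 q.1 * mode p.2 q.2 * Ds S phi q) + \int[area]_(q in box pi) (mode p.1 q.1 * mode' p.2 q.2 * Dt S phi q).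
  rewrite -ID//; apply: eq_Rintegral => -[x y] _; rewrite grad_dot Ds_product_mode Dt_product_mode//.
have -> : \int[area]_(q in box pi) (product_mode p (place S q) * phi (place S q)) = \int[area]_(q in box pi) (mode p.1 q.1 * mode p.2 q.2 * psi q).
  by apply: eq_Rintegral => -[x y] _; rewrite product_mode_place.
have cs0 := @cont_section_fst _ _ 0 cpsi; have csp := @cont_section_fst _ _ pi cpsi.
have ct0 := @cont_section_snd _ _ 0 cpsi; have ctp := @cont_section_snd _ _ pi cpsi.
have B1 : itg 0 pi (fun y => F1 (pi, y) - F1 (0, y)) =
   - h * (itg 0 pi (fun y => product_mode p (place S (pi, y)) * phi (place S (pi, y)))
          + itg 0 pi (fun y => product_mode p (place S (0, y)) * phi (place S (0, y)))).
  rewrite -itgD; last 2 first.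
  - by apply: (cont_eq (f := fun y => mode p.1 pi * mode p.2 y * psi (pi, y))) => [|y]; [apply: contM => //; apply: contM => //; exact: contC|rewrite product_mode_place].
  - by apply: (cont_eq (f := fun y => mode p.1 0 * mode p.2 y * psi (0, y))) => [|y]; [apply: contM => //; apply: contM => //; exact: contC|rewrite product_mode_place].
  rewrite -itgZ; last first.
    apply: (cont_eq (f := fun y => mode p.1 pi * mode p.2 y * psi (pi, y) + mode p.1 0 * mode p.2 y * psi (0, y))) => [|y].
      by apply: contD; apply: contM => //; apply: contM => //; exact: contC.
    by rewrite !product_mode_place.
  by apply: eq_itg => y _; rewrite /F1/= !product_mode_place (mode'_pi Hal) (mode'_0 Hal) -!/(psi _); ring.
have B2 : itg 0 pi (fun x => F2 (x, pi) - F2 (x, 0)) =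
   - h * (itg 0 pi (fun x => product_mode p (place S (x, pi)) * phi (place S (x, pi)))
          + itg 0 pi (fun x => product_mode p (place S (x, 0)) * phi (place S (x, 0)))).
  rewrite -itgD; last 2 first.
  - by apply: (cont_eq (f := fun x => mode p.1 x * mode p.2 pi * psi (x, pi))) => [|y]; [apply: contM => //; apply: contM => //; exact: contC|rewrite product_mode_place].
  - by apply: (cont_eq (f := fun x => mode p.1 x * mode p.2 0 * psi (x, 0))) => [|y]; [apply: contM => //; apply: contM => //; exact: contC|rewrite product_mode_place].
  rewrite -itgZ; last first.
    apply: (cont_eq (f := fun x => mode p.1 x * mode p.2 pi * psi (x, pi) + mode p.1 x * mode p.2 0 * psi (x, 0))) => [|y].
      by apply: contD; apply: contM => //; apply: contM => //; exact: contC.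
    by rewrite !product_mode_place.
  by apply: eq_itg => y _; rewrite /F2/= !product_mode_place (mode'_pi Hal) (mode'_0 Hal) -!/(psi _); ring.
rewrite B1 in E1; rewrite B2 in E2.
by rewrite /product_eigenvalue; move: E1 E2; rewrite !mulrDr !mulrDl !mulNr; lra.
Qed.

End ProductEigenfunction.

(** * Green's identity and weak solutions *)

(* The same sets, with the sigma-algebra that [lebesgue_measure] is defined on. *)
Lemma square_plane_measurable (R : realType) (S : square R) :
  measurable (square_set S : set (measurableTypeR R * measurableTypeR R)).
Proof. exact: square_measurable. Qed.

Lemma box_plane_measurable (R : realType) (L : R) :
  measurable (box L : set (measurableTypeR R * measurableTypeR R)).
Proof. exact: box_measurable. Qed.

Section SmoothH1.
Context {R : realType}.
Variable S : square R.
Local Notation d := (direction S).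
Local Notation L := (side_length S).

Lemma cont_L2 f : continuous f -> L2 S f.
Proof. by move=> cf; exact: (cont_sqi_square S cf). Qed.

Lemma box_edge (p : R * R) : p.1 = 0 \/ p.1 = L \/ p.2 = 0 \/ p.2 = L -> ~ square_set S (place S p).
Proof.
rewrite place_square /box/= => + [].
by rewrite /= !in_itv/= => -[->|[->|[->|->]]]; rewrite ?ltxx ?andbF.
Qed.

(** The edges lie outside the open square, which contains the support of [phi]; so [f * phi]
    vanishes on them and both of its coordinate derivatives integrate to [0]. [partial i] is a
    combination of these with constant coefficients. *)
Lemma weak_partial_smooth f i : smooth f -> weak_partial S i f (partial i f).
Proof.
move=> sf phi [sphi _ supp].
have L0 := side_length_gt0 S.
have phi0 p : ~ square_set S (place S p) -> phi (place S p) = 0.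
  move=> H; apply: contrapT => /eqP n0; apply: H; apply: supp.
  exact: subset_closure.
have cf := smooth_cont sf; have cphi := smooth_cont sphi.
have cdf := smooth_partial_cont sf; have cdphi := smooth_partial_cont sphi.
have c1 : continuous (fun x => f x * partial i phi x) by apply: contM => //; exact: cdphi.
have c2 : continuous (fun x => partial i f x * phi x) by apply: contM => //; exact: cdf.
rewrite !square_Rintegral; last 2 first.
- by apply: measurable_funS (plane_cont_measurable c2).
- by apply: measurable_funS (plane_cont_measurable c1).
pose F q := f (place S q) * phi (place S q).
have cfp : continuous (fun q => f (place S q)) by exact: smooth_place_cont.
have cphip : continuous (fun q => phi (place S q)) by exact: smooth_place_cont.
have cDsf := @Ds_cont _ S _ sf; have cDtf := @Dt_cont _ S _ sf.
have cDsp := @Ds_cont _ S _ sphi; have cDtp := @Dt_cont _ S _ sphi.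
pose Ks q := Ds S f q * phi (place S q) + f (place S q) * Ds S phi q.
pose Kt q := Dt S f q * phi (place S q) + f (place S q) * Dt S phi q.
have cF : continuous F by exact: contM.
have cKs : continuous Ks.
  by apply: contD; apply: contM; [exact: cDsf|exact: cphip|exact: cfp|exact: cDsp].
have cKt : continuous Kt.
  by apply: contD; apply: contM; [exact: cDtf|exact: cphip|exact: cfp|exact: cDtp].
have dKs (x y : R) : is_derive x (1:R) (fun x => F (x, y)) (Ks (x, y)).
  have H := is_deriveM (Ds_derive S sf x y) (Ds_derive S sphi x y).
  by apply: (is_derive_eq H); rewrite /Ks /GRing.scale/= addrC; congr (_ + _); rewrite mulrC.
have dKt (x y : R) : is_derive y (1:R) (fun y => F (x, y)) (Kt (x, y)).
  have H := is_deriveM (Dt_derive S sf x y) (Dt_derive S sphi x y).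
  by apply: (is_derive_eq H); rewrite /Kt /GRing.scale/= addrC; congr (_ + _); rewrite mulrC.
have I00 : itg 0 L (fun=> 0 : R) = 0 by rewrite (FTC L0 (C1C 0)) subrr.
have Es : \int[area]_(q in box L) Ks q = 0.
  rewrite (box_FTC_fst L0 cF cKs dKs) -[RHS]I00; apply: eq_itg => y _.
  by rewrite /F !phi0 ?mulr0 ?subr0//; apply: box_edge => /=; tauto.
have Et : \int[area]_(q in box L) Kt q = 0.
  rewrite (box_FTC_snd L0 cF cKt dKt) -[RHS]I00; apply: eq_itg => y _.
  by rewrite /F !phi0 ?mulr0 ?subr0//; apply: box_edge => /=; tauto.
have int (g : R * R -> R) : continuous g -> area.-integrable (box L) (EFin \o g).
  exact: box_integrable.
have mb := @box_measurable R L.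
have ci1 : continuous (fun q => f (place S q) * partial i phi (place S q)).
  by apply: contM => //; exact: partial_place_cont.
have ci2 : continuous (fun q => partial i f (place S q) * phi (place S q)).
  by apply: contM => //; exact: partial_place_cont.
apply/eqP; rewrite -subr_eq0 opprK -RintegralD//; [|exact: int..].
apply/eqP; pose a := if i then d.2 else d.1; pose b := if i then d.1 else - d.2.
transitivity (\int[area]_(q in box L) (a * Ks q + b * Kt q)).
  apply: eq_Rintegral => q _; rewrite (partial_place S phi) (partial_place S f) /Ks /Kt /a /b.
  by case: (i); move: (Ds S f q) (Dt S f q) (Ds S phi q) (Dt S phi q) => x y z t; ring.
have caKs : continuous (fun q => a * Ks q) by apply: contM => //; exact: contC.
have cbKt : continuous (fun q => b * Kt q) by apply: contM => //; exact: contC.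
rewrite RintegralD//; [|exact: int..].
by rewrite !RintegralZl ?Es ?Et ?mulr0 ?addr0//; exact: int.
Qed.

Lemma smooth_H1 f : smooth f -> H1 S f (fun i => partial i f).
Proof.
move=> sf; split; first exact/cont_L2/smooth_cont.
move=> i; split; last exact: weak_partial_smooth.
exact/cont_L2/(smooth_partial_cont sf).
Qed.

Lemma smooth_trace f : smooth f -> is_trace S f (fun i => partial i f) f.
Proof.
move=> sf; split; first exact/cont_boundary_L2/smooth_cont.
have z d (T : measurableType d) (mu : {measure set T -> \bar R}) (D : set T) (g : T -> R) :
  (\int[mu]_(x in D) ((g x - g x) ^+ 2)%:E)%E = 0%E.
  by rewrite (eq_integral (cst 0%E)) ?integral0// => x _; rewrite subrr expr0n.
exists (fun=> f); split => // [|i|i].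
- by apply: cvg_near_cst; apply: nearW => n; exact: z.
- by apply: cvg_near_cst; apply: nearW => n; exact: z.
- by apply: cvg_near_cst; apply: nearW => n; rewrite (eq_integral (cst 0%E)) ?integral0// => x _; rewrite subrr expr0n.
Qed.

End SmoothH1.

Section ProductRobin.
Context {R : realType}.
Variables (S : square R) (S_pi : side_length S = pi).
Variables (h : R) (al : nat -> R) (Hal : forall n, root_eq h n (al n)).
Local Notation product_mode := (product_mode S al).
Local Notation product_eigenvalue := (product_eigenvalue al).
Local Notation L := (side_length S).

(** Passage to the limit in [green_smooth] along the smooth sequence of [is_trace], which
    approximates [v], its weak gradient and its trace at once. *)
Lemma green_product_mode p v H k : H1 S v H -> is_trace S v H k ->
  \int[area]_(x in S) (partial false (product_mode p) x * H false x + partial true (product_mode p) x * H true x)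
    + h * boundary_integral S (fun x => product_mode p x * k x)
  = product_eigenvalue p * \int[area]_(x in S) (product_mode p x * v x).
Proof.
move=> [Lv HH] [bk [phi [sphi lim0 lim1 limb]]].
have sw := product_mode_smooth S al p.
have mS := square_plane_measurable S.
have sq0 f : continuous f -> sqi area S f by exact: cont_sqi_square.
have sqw : sqi area S (product_mode p) by exact/sq0/smooth_cont.
have sqdw i : sqi area S (partial i (product_mode p)) by exact/sq0/(smooth_partial_cont sw).
have sqH i : sqi area S (H i) by have [] := HH i.
have sqphi n : sqi area S (phi n) by apply: sq0; exact: smooth_cont (sphi n).
have sqdphi i n : sqi area S (partial i (phi n)) by exact/sq0/(smooth_partial_cont (sphi n)).
have A0 := l2_lim mS sqw Lv sqphi lim0.
have A1 i := l2_lim mS (sqdw i) (sqH i) (sqdphi i) (lim1 i).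
have mb : measurable (`[0, L] : set (measurableTypeR R)) by exact: measurable_itv.
have bsq f : continuous f -> forall i, sqi lebesgue_measure `[0, L] (fun t => f (side S i t)).
  by move=> cf i; exact: (cont_boundary_L2 S cf i).
have AB i := l2_lim mb (bsq _ (smooth_cont sw) i) (bk i) (fun n => bsq _ (smooth_cont (sphi n)) i) (limb i).
have ABs : boundary_integral S (fun x => product_mode p x * phi n x) @[n --> \oo] -->
   boundary_integral S (fun x => product_mode p x * k x).
  apply: cvg_big => [|i _]; last exact: AB.
  exact: add_continuous.
have AG : \int[area]_(x in S) (partial false (product_mode p) x * partial false (phi n) x
     + partial true (product_mode p) x * partial true (phi n) x) @[n --> \oo] -->
   \int[area]_(x in S) (partial false (product_mode p) x * H false x + partial true (product_mode p) x * H true x).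
  have E (K : bool -> R * R -> R) : (forall i, sqi area S (K i)) ->
    \int[area]_(x in S) (partial false (product_mode p) x * K false x + partial true (product_mode p) x * K true x) =
    \int[area]_(x in S) (partial false (product_mode p) x * K false x) + \int[area]_(x in S) (partial true (product_mode p) x * K true x).
    by move=> HK; rewrite RintegralD//; exact: sqi_mul.
  rewrite (E H sqH) (_ : (fun n => _) = (fun n => \int[area]_(x in S) (partial false (product_mode p) x * partial false (phi n) x)
     + \int[area]_(x in S) (partial true (product_mode p) x * partial true (phi n) x))).
    exact: cvgD (A1 false) (A1 true).
  by apply/funext => n; exact: (E (fun i => partial i (phi n)) (fun i => sqdphi i n)).
have cst_cvg (c : R) : (fun=> c) @ \oo --> c by exact: cvg_cst.
apply: (cvg_unique _ (cvgD AG (cvgM (cst_cvg h) ABs))); first exact: norm_hausdorff.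
rewrite (_ : _ + _ = (fun n => product_eigenvalue p * \int[area]_(x in S) (product_mode p x * phi n x))).
  exact: cvgM (cst_cvg (product_eigenvalue p)) A0.
by apply/funext => n /=; rewrite -(green_smooth S_pi Hal p (sphi n)).
Qed.

Lemma product_mode_solution p : robin_solution S h (product_eigenvalue p) (product_mode p).
Proof.
exists (fun i => partial i (product_mode p)), (product_mode p); split.
- exact/smooth_H1/product_mode_smooth.
- exact/smooth_trace/product_mode_smooth.
- by move=> v H k Hv Hk; exact: green_product_mode.
Qed.

(** Self-adjointness: the equation for [v] is tested with the product mode, and the equation for the
    product mode with [v]. *)
Lemma solution_orth lam v p : robin_solution S h lam v -> lam <> product_eigenvalue p ->
  \int[area]_(x in S) (v x * product_mode p x) = 0.
Proof.
move=> [G [g [Hv Hg E]]] ne.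
have sw := product_mode_smooth S al p.
have E1 := E _ _ _ (smooth_H1 S sw) (smooth_trace S sw).
have E2 := green_product_mode p Hv Hg.
have e1 : \int[area]_(x in S) (partial false (product_mode p) x * G false x + partial true (product_mode p) x * G true x)
  = \int[area]_(x in S) (G false x * partial false (product_mode p) x + G true x * partial true (product_mode p) x).
  by apply: eq_Rintegral => x _; rewrite mulrC [X in _ + X]mulrC.
have e2 : boundary_integral S (fun x => product_mode p x * g x) = boundary_integral S (fun x => g x * product_mode p x).
  by apply: eq_bigr => i _; apply: eq_Rintegral => x _; rewrite mulrC.
have e3 : \int[area]_(x in S) (product_mode p x * v x) = \int[area]_(x in S) (v x * product_mode p x).
  by apply: eq_Rintegral => x _; rewrite mulrC.
rewrite e1 e2 e3 E1 in E2.
have : (lam - product_eigenvalue p) * \int[area]_(x in S) (v x * product_mode p x) = 0 by rewrite mulrBl E2 subrr.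
by move/eqP; rewrite mulf_eq0 subr_eq0 => /orP[/eqP//|/eqP].
Qed.

End ProductRobin.

(** * Completeness of the product eigenfunctions *)

Section Bernstein.
Context {R : realType}.

(* Expectation of [f] under the binomial distribution with parameters [n] and
   [t]; as a function of [t] this is the [n]-th Bernstein polynomial. *)
Fixpoint bern (n : nat) (t : R) (f : nat -> R) : R :=
  if n is m.+1 then (1 - t) * bern m t f + t * bern m t (f \o succn) else f 0%N.

Lemma bern_le n t f g : 0 <= t <= 1 -> (forall k, (k <= n)%N -> f k <= g k) ->
  bern n t f <= bern n t g.
Proof.
move=> /andP[t0 t1]; elim: n f g => [|n ih] f g fg /=; first exact: fg.
apply: lerD; rewrite ler_wpM2l ?subr_ge0// ih// => k kn; last exact: fg.
by apply: fg; exact: leqW.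
Qed.

Lemma bernD n t f g : bern n t (fun k => f k + g k) = bern n t f + bern n t g.
Proof.
elim: n f g => [|n ih] f g //=; rewrite ih (ih (f \o succn) (g \o succn)); ring.
Qed.

Lemma bernZ n t c f : bern n t (fun k => c * f k) = c * bern n t f.
Proof. by elim: n f => [|n ih] f //=; rewrite ih (ih (f \o succn)); ring. Qed.

Lemma bernC n t c : bern n t (fun=> c) = c.
Proof. by elim: n => [|n ih] //=; rewrite !ih; ring. Qed.

Lemma bern_var n t c : bern n t (fun k => (k%:R - c) ^+ 2) = n%:R * (t * (1 - t)) + (n%:R * t - c) ^+ 2.
Proof.
elim: n c => [|n ih] c /=; first by ring.
rewrite ih (_ : _ \o succn = fun k => (k%:R - (c - 1)) ^+ 2).
  by rewrite ih -natr1; ring.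
by apply/funext => k /=; rewrite -natr1; congr (_ ^+ 2); ring.
Qed.

(** The deviation is bounded by a constant plus a quadratic term in the distance to [t]; the mean of
    the latter is [K] times the variance [t (1 - t) / n]. *)
Lemma bern_dist n t f x e K : 0 <= t <= 1 -> (0 < n)%N -> 0 <= K ->
  (forall k, (k <= n)%N -> `|f k - x| <= e + K * (k%:R / n%:R - t) ^+ 2) ->
  `|bern n t f - x| <= e + K / n%:R.
Proof.
move=> t01 n0 K0 H; have n0' : 0 < n%:R :> R by rewrite ltr0n.
have E : bern n t f - x = bern n t (fun k => f k + - x) by rewrite bernD bernC.
have V : bern n t (fun k => e + K * (k%:R / n%:R - t) ^+ 2) <= e + K / n%:R.
  rewrite bernD bernC lerD2l.
  rewrite (_ : (fun k => _) = fun k => (K / n%:R ^+ 2) * (k%:R - n%:R * t) ^+ 2); last first.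
    by apply/funext => k; field; rewrite gt_eqF.
  rewrite bernZ bern_var subrr expr0n addr0.
  have -> : K / n%:R ^+ 2 * (n%:R * (t * (1 - t))) = K / n%:R * (t * (1 - t)).
    by field; rewrite gt_eqF.
  rewrite ler_piMr ?divr_ge0 ?ler0n//.
  by case/andP: t01 => t0 t1; nra.
rewrite E ler_norml; apply/andP; split.
  rewrite lerNl; apply: le_trans V.
  have -> : - bern n t (fun k => f k + - x) = bern n t (fun k => (-1) * (f k + - x)) by rewrite bernZ mulN1r.
  by apply: bern_le => // k kn; apply: le_trans (H k kn); rewrite mulN1r -normrN ler_norm.
by apply: le_trans V; apply: bern_le => // k kn; apply: le_trans (H k kn); rewrite ler_norm.
Qed.

(** Finite sums of products of [C^1] functions of one variable, to which [interval_complete] applies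
    one factor at a time. *)
Inductive tensor : (R * R -> R) -> Prop :=
| tensorM a a' b b' : C1 a a' -> C1 b b' -> tensor (fun q => a q.1 * b q.2)
| tensorD f g : tensor f -> tensor g -> tensor (fun q => f q + g q).

Lemma tensor_mull f a a' : C1 a a' -> tensor f -> tensor (fun q => a q.1 * f q).
Proof.
move=> Ca; elim=> [b b' c c' Cb Cc|{}f g _ tf _ tg].
  have := tensorM (C1M Ca Cb) Cc; congr tensor.
  by apply/funext => q; rewrite mulrA.
by have := tensorD tf tg; congr tensor; apply/funext => q; rewrite mulrDr.
Qed.

Lemma tensor_bern n m (g : nat -> nat -> R) L : 
  tensor (fun q => bern n (q.1 / L) (fun k => bern m (q.2 / L) (g k))).
Proof.
have CL : C1 (fun x : R => x / L) (fun=> L^-1).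
  by apply: C1_eq (C1Z L^-1 C1id) _ _ => x; rewrite ?mulr1// mulrC.
have CL' : C1 (fun x : R => 1 - x / L) (fun=> - L^-1).
  by apply: C1_eq (C1D (C1C 1) (C1Z (-1) CL)) _ _ => x; rewrite ?mulN1r// add0r.
elim: n g => [|n ih] g /=; last first.
  exact: tensorD (tensor_mull CL' (ih g)) (tensor_mull CL (ih (g \o succn))).
have [b' Cb] : exists b', C1 (fun y => bern m (y / L) (g 0%N)) b'.
  elim: m (g 0%N) => [|m ihm] f /=; first by exists (fun=> 0); exact: C1C.
  have [b1 C1b] := ihm f; have [b2 C2b] := ihm (f \o succn).
  by eexists; exact: (C1D (C1M CL' C1b) (C1M CL C2b)).
by have := tensorM (C1C 1) Cb; congr tensor; apply/funext => q; rewrite mul1r.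
Qed.

Lemma tensor_cont f : tensor f -> continuous f.
Proof.
elim=> [a a' b b' Ca Cb|{}f g _ cf _ cg]; last exact: contD.
by apply: contM; [exact: (cont_fst (C1_cont Ca))|exact: (cont_snd (C1_cont Cb))].
Qed.

Lemma tensor_dense (L : R) (psi psi1 psi2 : R * R -> R) e : 0 < L ->
  continuous psi1 -> continuous psi2 ->
  (forall x y, is_derive x (1:R) (fun x => psi (x, y)) (psi1 (x, y))) ->
  (forall x y, is_derive y (1:R) (fun y => psi (x, y)) (psi2 (x, y))) ->
  0 < e ->
  exists2 B, tensor B & forall q, box L q -> `|psi q - B q| <= e.
Proof.
move=> L0 c1 c2 d1 d2 e0.
have [M1 H1] := cont_box_bounded L c1; have [M2 H2] := cont_box_bounded L c2.
pose M := `|M1| + `|M2| + 1.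
have M0 : 0 < M by rewrite /M; have := normr_ge0 M1; have := normr_ge0 M2; lra.
have HM1 p : `[0, L]%classic p.1 -> `[0, L]%classic p.2 -> `|psi1 p| <= M.
  move=> p1 p2; apply: le_trans (H1 p p1 p2) _; rewrite /M.
  by have := ler_norm M1; have := normr_ge0 M2; lra.
have HM2 p : `[0, L]%classic p.1 -> `[0, L]%classic p.2 -> `|psi2 p| <= M.
  move=> p1 p2; apply: le_trans (H2 p p1 p2) _; rewrite /M.
  by have := ler_norm M2; have := normr_ge0 M1; lra.
(* A Lipschitz bound in the form that [bern_dist] takes, from [M s <= eta + M^2 s^2 / eta]. *)
have lip (f f' : R -> R) : (forall t, is_derive t (1:R) f (f' t)) ->
    (forall t, 0 <= t <= L -> `|f' t| <= M) -> forall eta, 0 < eta ->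
    forall x y, 0 <= x <= L -> 0 <= y <= L ->
    `|f x - f y| <= eta + M ^+ 2 / eta * (x - y) ^+ 2.
  move=> df fM eta eta0 x y xL yL.
  have : `|f x - f y| <= M * `|x - y|.
    have wf (a b : R) : {within `[a, b], continuous f}.
      by apply: derivable_within_continuous => t _; have [] := df t.
    wlog xy : x y xL yL / x <= y => [W|].
      by have [/W|/ltW /W] := leP x y; [apply|rewrite distrC [`|x - y|]distrC; apply].
    have [t] := MVT_segment xy (fun t _ => df t) (wf x y).
    rewrite in_itv/= => /andP[xt ty]; rewrite distrC [`|x - y|]distrC => ->.
    rewrite normrM ler_wpM2r// fM//.
    by case/andP: xL => x0 _; case/andP: yL => _ yl; rewrite (le_trans x0 xt) (le_trans ty yl).
  move=> /le_trans; apply; rewrite -(real_normK (num_real (x - y))).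
  set s := `|x - y|; have s0 : 0 <= s by exact: normr_ge0.
  have -> : eta + M ^+ 2 / eta * s ^+ 2 = eta^-1 * (eta ^+ 2 + (M * s) ^+ 2).
    by field; rewrite gt_eqF.
  rewrite -ler_pdivrMl ?invr_gt0// invrK.
  have := sqr_ge0 (eta - M * s); have := mulr_ge0 (ltW M0) s0; have := ltW eta0; nra.
(* Four errors add up, each at most [eta]: in each variable a constant part and a variance part
   [K / n]. *)
pose eta := e / 4.
have eta0 : 0 < eta by rewrite divr_gt0.
pose K := M ^+ 2 / eta * L ^+ 2.
have K0 : 0 <= K by rewrite mulr_ge0 ?divr_ge0 ?sqr_ge0// ltW.
pose n := (Num.truncn (K / eta)).+1.
have n0 : 0 < n%:R :> R by rewrite ltr0n.
have Kn : K / n%:R <= eta.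
  rewrite ler_pdivrMr// mulrC -ler_pdivrMr//.
  have KK : 0 <= K / eta by rewrite divr_ge0// ltW.
  by have /andP[_ /ltW] := Num.Theory.truncn_itv KK.
pose node (k : nat) : R := L * (k%:R / n%:R).
have nodeL k : (k <= n)%N -> 0 <= node k <= L.
  move=> kn; rewrite /node mulr_ge0 ?divr_ge0 ?ler0n ?(ltW L0)//=.
  by rewrite ler_piMr ?(ltW L0)// ler_pdivrMr// mul1r ler_nat.
exists (fun q => bern n (q.1 / L) (fun k => bern n (q.2 / L) (fun l => psi (node k, node l)))).
  exact: tensor_bern.
move=> [x y] [] /=; rewrite !in_itv/= => /andP[x0 xL] /andP[y0 yL].
have xL' : 0 <= x <= L by rewrite !ltW.
have yL' : 0 <= y <= L by rewrite !ltW.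
have t01 z : 0 <= z <= L -> 0 <= z / L <= 1.
  by move=> /andP[z0 zL]; rewrite divr_ge0 ?(ltW L0)//= ler_pdivrMr// mul1r.
have nodeE k z : (node k - z) ^+ 2 = L ^+ 2 * (k%:R / n%:R - z / L) ^+ 2.
  by rewrite /node -exprMn; congr (_ ^+ 2); field; rewrite gt_eqF// gt_eqF.
have KE z : K * z = M ^+ 2 / eta * (L ^+ 2 * z) by rewrite /K; ring.
have inner k : (k <= n)%N ->
    `|bern n (y / L) (fun l => psi (node k, node l)) - psi (node k, y)| <= eta + K / n%:R.
  move=> kn; apply: bern_dist => //; first exact: t01.
  move=> l ln; rewrite KE -nodeE.
  apply: (@lip (fun y => psi (node k, y)) (fun y => psi2 (node k, y))) => //; last exact: nodeL.
  by move=> t tL; apply: HM2; rewrite /= in_itv//=; exact: nodeL.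
have outer : `|bern n (x / L) (fun k => bern n (y / L) (fun l => psi (node k, node l))) - psi (x, y)|
    <= (eta + (eta + K / n%:R)) + K / n%:R.
  apply: bern_dist => //; first exact: t01.
  move=> k kn; have A := inner k kn.
  have B : `|psi (node k, y) - psi (x, y)| <= eta + K * (k%:R / n%:R - x / L) ^+ 2.
    rewrite KE -nodeE.
    apply: (@lip (fun x => psi (x, y)) (fun x => psi1 (x, y))) => //; last exact: nodeL.
    by move=> t tL; apply: HM1; rewrite /= in_itv.
  by apply: (le_trans (ler_distD (psi (node k, y)) _ _)); move: A B; lra.
rewrite distrC; apply: le_trans outer _.
by rewrite /eta in Kn *; lra.
Qed.

End Bernstein.

(** * Functions orthogonal to all products of modes *)

Section BoxComplete.
Context {R : realType}.
Variables (h : R) (h0 : 0 <= h) (al : nat -> R) (Hal : forall n, root_eq h n (al n)).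
Local Notation mode := (mode al).
Local Notation Q := (box (pi : R)).
Variables (z : R * R -> R) (Hz : sqi area Q z).
Hypothesis z_orth : forall i j, \int[area]_(q in Q) (z q * (mode i q.1 * mode j q.2)) = 0.

Let mQ := box_plane_measurable (pi : R).
Let p0 : 0 < pi :> R := pi_gt0 R.

Let sqc (f : R * R -> R) : continuous f -> sqi area Q f.
Proof. exact: box_sqi. Qed.

Let tensor_nrm2 (f g : R -> R) : continuous f -> continuous g ->
  nrm2 area Q (fun q => f q.1 * g q.2) = itg 0 pi (fun x => f x ^+ 2) * itg 0 pi (fun y => g y ^+ 2).
Proof.
move=> cf cg; rewrite -box_tensor//; [|by continuity..].
by apply: eq_Rintegral => q _; rewrite exprMn.
Qed.

(** One factor at a time: here the first factor becomes arbitrary, and [kill_tensor] then frees the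
    second one, using combinations of the functions treated here. *)
Lemma kill_left a a' j : C1 a a' -> \int[area]_(q in Q) (z q * (a q.1 * mode j q.2)) = 0.
Proof.
move=> Ca; have ca := C1_cont Ca; have cu n : continuous (mode n) by exact: (@mode_cont R al n).
have cc (F G : R -> R) : continuous F -> continuous G -> continuous (fun q : R * R => F q.1 * G q.2).
  by move=> cF cG; apply: contM; [exact: cont_fst|exact: cont_snd].
apply: (orth_closed mQ Hz (sqc (cc _ _ ca (cu j)))) => e e0.
have nj := mode_norm_gt0 h0 Hal j.
have [N [c Hc]] := interval_complete h0 Hal Ca (divr_gt0 e0 nj).
exists (fun q => \sum_(n < N) c n * (mode n q.1 * mode j q.2)).
have cs : continuous (fun x => \sum_(n < N) c n * mode n x) by apply: cont_sum => n _; continuity.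
split.
- by apply: sqi_sum => // n _; apply: sqiZ => //; apply: sqc; exact: cc.
- rewrite Rint_mul_sum//; first by rewrite big1// => n _; rewrite z_orth mulr0.
  by move=> n _; apply: sqc; exact: cc.
- have -> : (fun q : R * R => a q.1 * mode j q.2 - \sum_(n < N) c n * (mode n q.1 * mode j q.2)) =
     (fun q => (a q.1 - \sum_(n < N) c n * mode n q.1) * mode j q.2).
    by apply/funext => q; rewrite mulrBl mulr_suml; congr (_ - _); apply: eq_bigr => n _; rewrite mulrA.
  rewrite (@tensor_nrm2 (fun x => a x - \sum_(n < N) c n * mode n x))//; last by continuity.
  by rewrite -ler_pdivlMr.
Qed.

Lemma kill_tensor f : tensor f -> \int[area]_(q in Q) (z q * f q) = 0.
Proof.
have cu n : continuous (mode n) by exact: (@mode_cont R al n).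
have cc (F G : R -> R) : continuous F -> continuous G -> continuous (fun q : R * R => F q.1 * G q.2).
  by move=> cF cG; apply: contM; [exact: cont_fst|exact: cont_snd].
elim=> [a a' b b' Ca Cb|f1 f2 tf zf tg zg]; last first.
  by rewrite Rint_mulD// ?zf ?zg ?addr0//; apply: sqc; exact: tensor_cont.
have ca := C1_cont Ca; have cb := C1_cont Cb.
apply: (orth_closed mQ Hz (sqc (cc _ _ ca cb))) => e e0.
(* Adding [1] allows the division when [a] vanishes. *)
have na : 0 < itg 0 pi (fun x => a x ^+ 2) + 1.
  by apply: ltr_wpDl => //; apply: itg_ge0 => x _; exact: sqr_ge0.
have [N [c Hc]] := interval_complete h0 Hal Cb (divr_gt0 e0 na).
exists (fun q => \sum_(n < N) c n * (a q.1 * mode n q.2)).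
have cs : continuous (fun x => \sum_(n < N) c n * mode n x) by apply: cont_sum => n _; continuity.
split.
- by apply: sqi_sum => // n _; apply: sqiZ => //; apply: sqc; exact: cc.
- rewrite Rint_mul_sum//; first by rewrite big1// => n _; rewrite (kill_left _ Ca) mulr0.
  by move=> n _; apply: sqc; exact: cc.
- have -> : (fun q : R * R => a q.1 * b q.2 - \sum_(n < N) c n * (a q.1 * mode n q.2)) =
     (fun q => a q.1 * (b q.2 - \sum_(n < N) c n * mode n q.2)).
    by apply/funext => q; rewrite mulrBr mulr_sumr; congr (_ - _); apply: eq_bigr => n _; rewrite mulrCA.
  rewrite (@tensor_nrm2 a (fun x => b x - \sum_(n < N) c n * mode n x))//; last by continuity.
  move: Hc; rewrite ler_pdivlMr//; apply: le_trans.
  rewrite mulrC ler_wpM2l ?lerDl//.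
  by apply: itg_ge0 => x _; exact: sqr_ge0.
Qed.

Lemma kill_C1 (psi psi1 psi2 : R * R -> R) : continuous psi ->
  continuous psi1 -> continuous psi2 ->
  (forall x y, is_derive x (1:R) (fun x => psi (x, y)) (psi1 (x, y))) ->
  (forall x y, is_derive y (1:R) (fun y => psi (x, y)) (psi2 (x, y))) ->
  \int[area]_(q in Q) (z q * psi q) = 0.
Proof.
move=> cpsi c1 c2 d1 d2.
apply: (orth_closed mQ Hz (sqc cpsi)) => e e0.
pose V := fine (area Q).
have V0 : 0 <= V by apply: fine_ge0.
(* From [|psi - B| <= eta <= 1] the square is at most [eta], so its integral is at most
   [eta * V <= e]. *)
pose eta := Num.min 1 (e / (V + 1)).
have V1 : 0 < V + 1 by lra.
have eta0 : 0 < eta by rewrite lt_min ltr01 divr_gt0.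
have [B tB HB] := tensor_dense p0 c1 c2 d1 d2 eta0.
have cB := tensor_cont tB.
exists B; split; [exact: sqc|exact: kill_tensor|].
have cd : continuous (fun q => psi q - B q) by continuity.
have cd2 : continuous (fun q => (psi q - B q) ^+ 2) by continuity.
have : nrm2 area Q (fun q => psi q - B q) <= \int[area]_(q in Q) (cst eta q).
  apply: le_Rintegral => //.
  - exact: box_integrable.
  - exact: (box_integrable p0 (@contC _ _ eta)).
  - move=> q Qq; rewrite -(real_normK (num_real _)) /cst.
    have H1 := HB q Qq; have H2 : eta <= 1 by rewrite ge_min lexx.
    apply: (@le_trans _ _ (eta * 1)); last by rewrite mulr1.
    rewrite expr2; apply: ler_pM => //; exact: le_trans H1 H2.
move=> /le_trans; apply; rewrite Rintegral_cst//.
have : eta <= e / (V + 1) by rewrite ge_min lexx orbT.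
rewrite ler_pdivlMr//; apply: le_trans.
by rewrite ler_wpM2l ?(ltW eta0)// -/V lerDl.
Qed.

End BoxComplete.

Lemma ae_imply (d : measure_display) (T : measurableType d) (R : realType)
  (mu : {measure set T -> \bar R}) (P Q : T -> Prop) : (forall x, P x -> Q x) ->
  {ae mu, forall x, P x} -> {ae mu, forall x, Q x}.
Proof. by move=> PQ; apply: filterS. Qed.

(** * The eigenspaces of the square *)

Section SquareComplete.
Context {R : realType}.
Variables (S : square R) (S_pi : side_length S = pi).
Variables (h : R) (h0 : 0 <= h) (al : nat -> R) (Hal : forall n, root_eq h n (al n)).
Local Notation product_mode := (product_mode S al).
Local Notation product_eigenvalue := (product_eigenvalue al).
Let mS := square_plane_measurable S.
Let sqc (f : R * R -> R) : continuous f -> sqi area S f.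
Proof. exact: cont_sqi_square. Qed.

(** Smooth [phi] suffice for the application: each solution comes, through its trace, with smooth
    functions converging to it in [L2]. *)
Lemma square_complete z phi : sqi area S z ->
  (forall p, \int[area]_(x in S) (z x * product_mode p x) = 0) -> smooth phi ->
  \int[area]_(x in S) (z x * phi x) = 0.
Proof.
move=> Hz zw sphi.
have tr (f : R * R -> R) : continuous f ->
    \int[area]_(x in S) (z x * f x) = \int[area]_(q in box pi) (z (place S q) * f (place S q)).
  move=> cf; rewrite square_Rintegral ?S_pi//.
  apply: measurable_funM; first by case: Hz.
  by apply: measurable_funS (plane_cont_measurable cf).
rewrite tr; last exact: smooth_cont.
have Hz' : sqi area (box pi) (z \o place S) by rewrite -S_pi; exact: square_sqi.
apply: (kill_C1 h0 Hal Hz' _ (smooth_place_cont sphi) (Ds_cont sphi) (Dt_cont sphi) (Ds_derive S sphi) (Dt_derive S sphi)).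
move=> i j; rewrite -[RHS](zw (i, j)) tr; last exact: product_mode_cont.
by apply: eq_Rintegral => -[x y] _; rewrite product_mode_place.
Qed.

Lemma product_mode_dot p q : \int[area]_(x in S) (product_mode p x * product_mode q x) =
  itg 0 pi (fun x => mode al p.1 x * mode al q.1 x) * itg 0 pi (fun x => mode al p.2 x * mode al q.2 x).
Proof.
have cu n : continuous (mode al n) by exact: (@mode_cont R al n).
rewrite -box_tensor; [|exact: pi_gt0|by continuity|by continuity].
rewrite square_Rintegral ?S_pi; last first.
  have cww : continuous (fun x => product_mode p x * product_mode q x) by apply: contM; exact: product_mode_cont.
  by apply: measurable_funS (plane_cont_measurable cww).
by apply: eq_Rintegral => -[x y] _; rewrite !product_mode_place /=; ring.
Qed.

Lemma product_mode_dot_neq p q : p != q -> \int[area]_(x in S) (product_mode p x * product_mode q x) = 0.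
Proof.
move=> pq; rewrite product_mode_dot; have [e1|e1] := eqVneq p.1 q.1; last first.
  by rewrite (mode_orth Hal) ?mul0r//; exact/eqP.
rewrite [X in _ * X](mode_orth Hal) ?mulr0// => e2; case/eqP: pq.
by rewrite [LHS]surjective_pairing e1 e2 -surjective_pairing.
Qed.

Lemma product_mode_dot_gt0 p : 0 < \int[area]_(x in S) (product_mode p x * product_mode p x).
Proof. by rewrite product_mode_dot mulr_gt0//; exact: (mode_norm_gt0 h0 Hal). Qed.

Definition mode_coef v p := (\int[area]_(x in S) (v x * product_mode p x)) / (\int[area]_(x in S) (product_mode p x * product_mode p x)).

(** The remainder [z] is orthogonal to every product mode: to those in [P] by the choice of the
    coefficients, to the others by [solution_orth]. Hence it is orthogonal to all smooth functions,
    to their limit [v], and to the sum itself; so it is orthogonal to itself. *)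
Lemma eigen_expansion lam v (P : seq (nat * nat)) : uniq P ->
  (forall p, p \in P <-> product_eigenvalue p = lam) -> robin_solution S h lam v ->
  v = (fun x => \sum_(p <- P) mode_coef v p * product_mode p x) %[ae area in square_set S].
Proof.
move=> uP HP sv; have [G [g [[Lv HG] [_ [phi [sphi lim0 _ _]]] _]]] := sv.
have sqv : sqi area S v by exact: Lv.
have sqw p : sqi area S (product_mode p) by apply: sqc; exact: product_mode_cont.
pose s x := \sum_(p <- P) mode_coef v p * product_mode p x.
have sqs : sqi area S s by apply: sqi_sum => // p _; exact: sqiZ.
pose z x := v x - s x.
have sqz : sqi area S z by exact: sqiB.
have zw p : \int[area]_(x in S) (z x * product_mode p x) = 0.
  transitivity (\int[area]_(x in S) (product_mode p x * v x) - \int[area]_(x in S) (product_mode p x * s x)).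
    by rewrite -Rint_mulB//; apply: eq_Rintegral => x _; rewrite mulrC.
  rewrite (@Rint_mul_sum _ _ _ _ _ mS _ _ P xpredT product_mode (mode_coef v) (sqw p) (fun q _ => sqw q)).
  have vw : \int[area]_(x in S) (product_mode p x * v x) = \int[area]_(x in S) (v x * product_mode p x).
    by apply: eq_Rintegral => x _; rewrite mulrC.
  have [pP|pP] := boolP (p \in P).
    rewrite (bigD1_seq p)//= big1 ?addr0 => [|q qp]; last by rewrite product_mode_dot_neq ?mulr0// eq_sym.
    by rewrite vw /mode_coef divfK ?subrr// gt_eqF// product_mode_dot_gt0.
  rewrite vw (solution_orth S_pi Hal sv) => [|e]; last by move/negP: pP; apply; exact/HP.
  rewrite sub0r big_seq big1 ?oppr0// => q qP; rewrite product_mode_dot_neq ?mulr0//.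
  by apply: contraNneq pP => ->.
have sqphi n : sqi area S (phi n) by apply: sqc; exact: smooth_cont (sphi n).
have zv : \int[area]_(x in S) (z x * v x) = 0.
  have := l2_lim mS sqz sqv sqphi lim0.
  under eq_fun do rewrite (square_complete sqz zw (sphi _)).
  by move=> H; apply/esym; apply: (cvg_unique _ (cvg_cst 0) H); exact: norm_hausdorff.
have z2 : nrm2 area S z = 0.
  transitivity (\int[area]_(x in S) (z x * (v x - s x))); first by apply: eq_Rintegral => x _; rewrite expr2.
  rewrite Rint_mulB// zv sub0r (@Rint_mul_sum _ _ _ _ _ mS _ _ P xpredT product_mode (mode_coef v) sqz (fun q _ => sqw q)).
  by rewrite big1 ?oppr0// => q _; rewrite zw mulr0.
have := nrm2_eq0_ae mS sqz z2; apply: filterS => x /= H Sx.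
by apply/eqP; rewrite -subr_eq0; apply/eqP; exact: H Sx.
Qed.

Lemma eigen_coef v (P : seq (nat * nat)) (a : nat * nat -> R) p : uniq P -> p \in P ->
  sqi area S v ->
  v = (fun x => \sum_(p <- P) a p * product_mode p x) %[ae area in square_set S] -> a p = mode_coef v p.
Proof.
move=> uP pP sqv ae.
have sqw q : sqi area S (product_mode q) by apply: sqc; exact: product_mode_cont.
have sqs : sqi area S (fun x => \sum_(p <- P) a p * product_mode p x) by apply: sqi_sum => // q _; exact: sqiZ.
have E : \int[area]_(x in S) (v x * product_mode p x) = \int[area]_(x in S) (product_mode p x * \sum_(p <- P) a p * product_mode p x).
  rewrite /Rintegral; congr fine; apply: ae_eq_integral => //.
  - by have /measurable_int := sqi_mul mS sqv (sqw p).
  - by have /measurable_int := sqi_mul mS (sqw p) sqs.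
  - by move: ae; apply: ae_imply => x /= H Sx; rewrite (H Sx) mulrC.
rewrite /mode_coef E (@Rint_mul_sum _ _ _ _ _ mS _ _ P xpredT product_mode a (sqw p) (fun q _ => sqw q)) (bigD1_seq p)//=.
rewrite big1 ?addr0 => [|q qp]; last by rewrite product_mode_dot_neq ?mulr0// eq_sym.
by rewrite mulfK// gt_eqF// product_mode_dot_gt0.
Qed.

Lemma eigenspace_dim_pairs lam (P : seq (nat * nat)) : uniq P ->
  (forall p, p \in P <-> product_eigenvalue p = lam) -> eigenspace_dim S h lam (size P).
Proof.
move=> uP HP; exists (fun i : 'I_(size P) => product_mode (nth (0, 0)%N P i)); split.
  move=> i; have /HP <- : nth (0, 0)%N P i \in P by exact: mem_nth.
  exact: product_mode_solution.
move=> v sv; have H := eigen_expansion uP HP sv.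
have sqv : sqi area S v by case: sv => G [g [[]]].
have bigE (a : nat * nat -> R) x : \sum_(p <- P) a p * product_mode p x = \sum_(i < size P) a (nth (0, 0)%N P i) * product_mode (nth (0, 0)%N P i) x.
  by rewrite (big_nth (0, 0)%N) big_mkord.
exists (\row_i mode_coef v (nth (0, 0)%N P i)); split.
  move: H; apply: ae_imply => x /= H Sx; rewrite H// bigE.
  by apply: eq_bigr => i _; rewrite mxE.
move=> b Hb; apply/rowP => i; rewrite mxE.
(* [b], indexed by positions in [P], becomes a function of pairs, with the default [0] off [P]. *)
pose a p := if insub (index p P) is Some k then b 0 k else 0.
have ab (k : 'I_(size P)) : a (nth (0, 0)%N P k) = b 0 k.
  by rewrite /a index_uniq// valK.
rewrite -ab; apply/esym; apply: (@eigen_coef v P a) => //; first exact: mem_nth.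
move: Hb; apply: ae_imply => x /= Hb Sx; rewrite Hb// bigE.
by apply: eq_bigr => k _; rewrite ab.
Qed.

End SquareComplete.

(** * Enumeration of the spectrum *)

Section DimensionUnique.
Context {R : realType}.
Variables (S : square R) (h lam : R).

Lemma ae_forall_ord (d : measure_display) (T : measurableType d)
  (mu : {measure set T -> \bar R}) n (P : 'I_n -> T -> Prop) :
  (forall i, {ae mu, forall x, P i x}) -> {ae mu, forall x, forall i, P i x}.
Proof. by move=> H; apply: filter_forall. Qed.

Lemma ae_imply2 (d : measure_display) (T : measurableType d)
  (mu : {measure set T -> \bar R}) (P Q U : T -> Prop) : (forall x, P x -> Q x -> U x) ->
  {ae mu, forall x, P x} -> {ae mu, forall x, Q x} -> {ae mu, forall x, U x}.
Proof. by move=> PQU; apply: filterS2. Qed.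

(** Each family is expressed in the other. Row [i] of the product of the coefficient matrices and
    the [i]-th unit row both represent [w1 i]; by uniqueness they agree, and a product equal to the
    identity of size [d1] forces [d1 <= d2]. *)
Lemma eigenspace_dim_le d1 d2 : eigenspace_dim S h lam d1 -> eigenspace_dim S h lam d2 -> (d1 <= d2)%N.
Proof.
move=> [w1 [s1 H1]] [w2 [s2 H2]].
have /choice[A HA] : forall i, exists a : 'rV[R]_d2,
    w1 i = (fun x => \sum_(j < d2) a 0 j * w2 j x) %[ae area in square_set S].
  by move=> i; have [a [Ha _]] := H2 _ (s1 i); exists a.
have /choice[B HB] : forall j, exists b : 'rV[R]_d1,
    w2 j = (fun x => \sum_(i < d1) b 0 i * w1 i x) %[ae area in square_set S].
  by move=> j; have [b [Hb _]] := H1 _ (s2 j); exists b.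
have AB : (\matrix_(i, j) A i 0 j) *m (\matrix_(j, i) B j 0 i) = 1%:M :> 'M[R]_d1.
  apply/row_matrixP => i.
  have [a [_ Ha]] := H1 _ (s1 i).
  transitivity a; first apply/esym; apply: Ha.
    have HB' := ae_forall_ord HB.
    move: (HA i) HB'; apply: ae_imply2 => x /= Hx Bx Sx.
    rewrite Hx// (eq_bigr (fun j => \sum_(k < d1) A i 0 j * (B j 0 k * w1 k x))); last first.
      by move=> j _; rewrite (Bx j Sx) mulr_sumr.
    rewrite exchange_big/=; apply: eq_bigr => k _; rewrite !mxE mulr_suml.
    by apply: eq_bigr => j _; rewrite !mxE mulrA.
  apply: (@ae_imply _ _ _ area (fun=> True)); last exact: filterT.
  move=> x _ _; rewrite (bigD1 i)//= big1 ?addr0 => [|k ki].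
    by rewrite !mxE eqxx mul1r.
  by rewrite !mxE eq_sym (negbTE ki) mul0r.
exact: mulmx1_min AB.
Qed.

Lemma eigenspace_dim_unique d1 d2 : eigenspace_dim S h lam d1 -> eigenspace_dim S h lam d2 -> d1 = d2.
Proof. by move=> H1 H2; apply/eqP; rewrite eqn_leq !eigenspace_dim_le. Qed.

End DimensionUnique.

(** * Listing pairs by increasing value, and counting *)

Section Enumeration.
Context {R : realType}.
Variables (f : nat * nat -> R).
Hypothesis f_finite : forall c, exists s : seq (nat * nat), forall p, f p <= c -> p \in s.

Lemma seq_argmin (T : eqType) (g : T -> R) (s : seq T) x : x \in s ->
  exists2 y, y \in s & forall z, z \in s -> g y <= g z.
Proof.
elim: s x => // a s ih x _.
case: s ih => [_|b s ih]; first by exists a; [exact: mem_head|move=> z; rewrite inE => /eqP ->].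
have [y ys Hy] := ih b (mem_head _ _).
have [ay|ya] := leP (g a) (g y).
  exists a; first exact: mem_head.
  by move=> z; rewrite inE => /orP[/eqP ->//|/Hy]; exact: le_trans.
exists y; first by rewrite inE ys orbT.
by move=> z; rewrite inE => /orP[/eqP ->|/Hy//]; exact: ltW.
Qed.

Lemma next_exists (s : seq (nat * nat)) :
  exists p, p \notin s /\ forall q, q \notin s -> f p <= f q.
Proof.
(* A pair outside [s], as its first index exceeds all those in [s]; its value confines the search
   for a minimum to a finite list. *)
pose p0 := ((\max_(p <- s) p.1).+1, 0)%N.
have p0s : p0 \notin s.
  apply/negP => ps; have := @leq_bigmax_seq _ s xpredT (fun p => p.1) _ ps isT.
  by rewrite /= ltnn.
have [t Ht] := f_finite (f p0).
have : p0 \in [seq p <- t | p \notin s] by rewrite mem_filter p0s Ht.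
move=> /(seq_argmin f)[p]; rewrite mem_filter => /andP[ps pt] Hp.
exists p; split => // q qs; have [qp|pq] := leP (f q) (f p0).
  by apply: Hp; rewrite mem_filter qs Ht.
apply: ltW; apply: le_lt_trans pq; apply: Hp.
by rewrite mem_filter p0s Ht.
Qed.

(** Greedy choice: a pair of least value among those not yet taken. A pair that is never taken would
    bound the values of infinitely many distinct pairs, against [f_finite]. *)
Lemma enumeration_exists : exists e : nat -> nat * nat,
  [/\ injective e, forall p, exists n, e n = p & nondecreasing_seq (f \o e)].
Proof.
have [pick Hpick] := choice next_exists.
pose E := fix E n := if n is m.+1 then rcons (E m) (pick (E m)) else [::].
pose e n := pick (E n).
have eE m n : (m < n)%N -> e m \in E n.
  elim: n => // n ih; rewrite ltnS leq_eqVlt /= mem_rcons inE => /orP[/eqP ->|/ih ->].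
    by rewrite eqxx.
  by rewrite orbT.
have EE m n : (m <= n)%N -> {subset E m <= E n}.
  elim: n => [|n ih]; first by rewrite leqn0 => /eqP ->.
  rewrite leq_eqVlt => /orP[/eqP -> //|/ih H] p /H pn.
  by rewrite /= mem_rcons inE pn orbT.
have e_inj : injective e.
  move=> m n emn; case: (ltngtP m n) => // /eE H; exfalso.
    by have [/negP N _] := Hpick (E n); apply: N; rewrite -/(e n) -emn.
  by have [/negP N _] := Hpick (E m); apply: N; rewrite -/(e m) emn.
exists e; split => //.
- move=> q; apply: contrapT => Hq.
  have [s Hs] := f_finite (f q).
  have qE n : q \notin E n.
    elim: n => // n ih; rewrite /= mem_rcons inE negb_or ih andbT.
    by apply/eqP => qe; apply: Hq; exists n.
  have : (size (map e (iota 0 (size s).+1)) <= size s)%N.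
    apply: uniq_leq_size; first by rewrite map_inj_uniq ?iota_uniq.
    move=> _ /mapP[n _ ->]; apply: Hs.
    by have [_] := Hpick (E n); apply.
  by rewrite size_map size_iota ltnn.
- apply/nondecreasing_seqP => n; have [_] := Hpick (E n); apply.
  have [H _] := Hpick (E n.+1); apply: contra H.
  exact: EE.
Qed.

Section Counting.
Variables (e : nat -> nat * nat) (e_inj : injective e) (e_surj : forall p, exists n, e n = p).
Variable l : nat -> R.
Hypothesis lE : forall n, l n = f (e n).
Hypothesis l_mono : nondecreasing_seq l.

(** The four counting lemmas are pigeonhole arguments: otherwise the first [N + 1] listed pairs
    would all lie in [T], or [T] would lie among the first [N] listed pairs. *)
Lemma count_lower N c (T : seq (nat * nat)) : (size T <= N)%N ->
  (forall p, f p < c -> p \in T) -> c <= l N.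
Proof.
move=> TN HT; rewrite leNgt; apply/negP => lN.
have : (size (map e (iota 0 N.+1)) <= size T)%N.
  apply: uniq_leq_size; first by rewrite map_inj_uniq ?iota_uniq.
  move=> p /mapP[n]; rewrite mem_iota add0n ltnS => /andP[_ nN] ->.
  by apply: HT; rewrite -lE; apply: le_lt_trans lN; exact: l_mono.
by rewrite size_map size_iota => /leq_trans/(_ TN); rewrite ltnn.
Qed.

Lemma count_lower_strict N c (T : seq (nat * nat)) : (size T <= N)%N ->
  (forall p, f p <= c -> p \in T) -> c < l N.
Proof.
move=> TN HT; rewrite ltNge; apply/negP => lN.
have : (size (map e (iota 0 N.+1)) <= size T)%N.
  apply: uniq_leq_size; first by rewrite map_inj_uniq ?iota_uniq.
  move=> p /mapP[n]; rewrite mem_iota add0n ltnS => /andP[_ nN] ->.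
  by apply: HT; rewrite -lE; apply: le_trans lN; exact: l_mono.
by rewrite size_map size_iota => /leq_trans/(_ TN); rewrite ltnn.
Qed.

Lemma count_upper N c (T : seq (nat * nat)) : uniq T -> (N < size T)%N ->
  (forall p, p \in T -> f p <= c) -> l N <= c.
Proof.
move=> uT NT HT; rewrite leNgt; apply/negP => lN.
have : (size T <= size (map e (iota 0 N)))%N.
  apply: uniq_leq_size => // p pT; have [n en] := e_surj p.
  apply/mapP; exists n => //; rewrite mem_iota add0n /= ltnNge; apply/negP => Nn.
  have := le_lt_trans (HT p pT) lN; rewrite -en -lE ltNge => /negP; apply.
  exact: l_mono.
by rewrite size_map size_iota leqNgt NT.
Qed.

Lemma count_upper_strict N c (T : seq (nat * nat)) : uniq T -> (N < size T)%N ->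
  (forall p, p \in T -> f p < c) -> l N < c.
Proof.
move=> uT NT HT; rewrite ltNge; apply/negP => lN.
have : (size T <= size (map e (iota 0 N)))%N.
  apply: uniq_leq_size => // p pT; have [n en] := e_surj p.
  apply/mapP; exists n => //; rewrite mem_iota add0n /= ltnNge; apply/negP => Nn.
  have := lt_le_trans (HT p pT) lN; rewrite -en -lE ltNge => /negP; apply.
  exact: l_mono.
by rewrite size_map size_iota leqNgt NT.
Qed.

End Counting.

Lemma level_set c : exists P : seq (nat * nat), uniq P /\ forall p, p \in P <-> f p = c.
Proof.
have [s Hs] := f_finite c.
exists (undup [seq p <- s | f p == c]); split; first exact: undup_uniq.
move=> p; rewrite mem_undup mem_filter; split => [/andP[/eqP]//|fp].
by rewrite fp eqxx/= Hs// fp.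
Qed.

End Enumeration.

Section RobinSpectrum.
Context {R : realType}.
Variables (S : square R) (S_pi : side_length S = pi).
Variables (h : R) (h0 : 0 <= h) (al : nat -> R) (Hal : forall n, root_eq h n (al n)).
Local Notation product_eigenvalue := (product_eigenvalue al).

Lemma product_eigenvalue_finite c : exists s : seq (nat * nat), forall p, product_eigenvalue p <= c -> p \in s.
Proof.
(* Both indices of a pair of value at most [c] are below [K], because
   [n <= n^2 <= al n ^ 2 <= c < K]. *)
pose K := (Num.truncn c).+1.
exists [seq (i, j) | i <- iota 0 K, j <- iota 0 K] => -[i j] Hc.
have small n : al n ^+ 2 <= c -> (n < K)%N.
  move=> nc; rewrite -(ltr_nat R).
  have n2 : n%:R <= al n ^+ 2.
    have [->|n0] := posnP n; first exact: sqr_ge0.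
    apply: (@le_trans _ _ (n%:R ^+ 2)).
      by rewrite expr2 -[leLHS]mul1r ler_wpM2r ?ler0n// ler1n.
    by rewrite lerXn2r ?nnegrE ?ler0n ?(al_ge0 Hal)//; exact: (al_ge Hal).
  apply: (le_lt_trans (le_trans n2 nc)).
  have c0 : 0 <= c by apply: le_trans nc; exact: sqr_ge0.
  by have /andP[] := Num.Theory.truncn_itv c0.
apply/allpairsP; exists (i, j); rewrite !mem_iota !add0n; split => //; apply: small;
  by apply: le_trans Hc; rewrite /product_eigenvalue/= ?lerDl ?lerDr sqr_ge0.
Qed.

Lemma spectrum_exists : exists e : nat -> nat * nat,
  [/\ injective e, forall p, exists n, e n = p & robin_spectrum S h (product_eigenvalue \o e)].
Proof.
have [e [ei es em]] := enumeration_exists product_eigenvalue_finite.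
exists e; split => //; split => // lam.
have [P [uP HP]] := level_set product_eigenvalue_finite lam.
have [g Hg] := choice es.
exists (map g P); split.
- rewrite map_inj_uniq// => p q gpq; by rewrite -(Hg p) gpq Hg.
- move=> n; split => [/mapP[p /HP pP ->]|en]; first by rewrite /= Hg.
  by apply/mapP; exists (e n); [exact/HP|apply: ei; rewrite Hg].
- by rewrite size_map; exact: eigenspace_dim_pairs.
Qed.

(** Applies to any admissible list, as is needed to refute sharpness. The places where [l] takes the
    value [c] are as many as the pairs of value [c], by uniqueness of the dimension; [e] matches the
    two finite lists position by position. *)
Lemma spectrum_pairs l : robin_spectrum S h l -> exists e : nat -> nat * nat,
  [/\ injective e, forall p, exists n, e n = p & forall n, l n = product_eigenvalue (e n)].
Proof.
move=> [_ Hl].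
have [s Hs] := choice Hl; have [P HP] := choice (level_set product_eigenvalue_finite).
have sz c : size (s c) = size (P c).
  have [_ _ H] := Hs c; have [u m] := HP c.
  exact: eigenspace_dim_unique H (eigenspace_dim_pairs S_pi h0 Hal u m).
pose e n := nth (0, 0)%N (P (l n)) (index n (s (l n))).
have ns n : n \in s (l n) by have [_ H _] := Hs (l n); apply/H.
have eP n : e n \in P (l n) by rewrite mem_nth// -sz index_mem ns.
have le n : l n = product_eigenvalue (e n) by have [_ m] := HP (l n); apply/esym/m.
exists e; split => //.
- move=> m n emn; have lmn : l m = l n by rewrite !le emn.
  have [u _] := HP (l n).
  move: emn; rewrite /e lmn => /eqP; rewrite nth_uniq// -?sz ?index_mem -?lmn ?ns ?lmn ?ns//.
  move=> /eqP E; have mn : m \in s (l n) by rewrite -lmn.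
  by rewrite -(nth_index 0%N mn) E nth_index.
- move=> p; have [u m] := HP (product_eigenvalue p).
  have pP : p \in P (product_eigenvalue p) by apply/m.
  have [us Hs' _] := Hs (product_eigenvalue p).
  have ks : (index p (P (product_eigenvalue p)) < size (s (product_eigenvalue p)))%N by rewrite sz index_mem.
  exists (nth 0%N (s (product_eigenvalue p)) (index p (P (product_eigenvalue p)))).
  have ln : l (nth 0%N (s (product_eigenvalue p)) (index p (P (product_eigenvalue p)))) = product_eigenvalue p by apply/Hs'; exact: mem_nth.
  by rewrite /e ln index_uniq// nth_index.
Qed.

End RobinSpectrum.

(** * The crossing of the eigenvalues (2, 2) and (0, 3) *)

Section Crossing.
Context {R : realType}.

(** The root equation solved for [h]; the branches of frequencies are the inverse functions of
    [robin_param n] on [[n, n + 1[]. *)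
Definition robin_param (n : nat) (a : R) : R := a * tan (phase a n).

Lemma phase_cos_gt0 (a : R) n : n%:R <= a < n.+1%:R -> 0 < cos (phase a n).
Proof.
move=> /phase_bound/andP[p0 p1]; apply: cos_gt0_pihalf; rewrite p1 andbT.
by apply: lt_le_trans p0; rewrite oppr_lt0 divr_gt0// pi_gt0.
Qed.

Lemma root_eq_param h n (a : R) : root_eq h n a -> robin_param n a = h.
Proof.
move=> [an E]; have c0 := phase_cos_gt0 an.
by rewrite /robin_param /tan mulrA E mulfK// gt_eqF.
Qed.

Lemma param_root_eq n (a : R) : n%:R <= a < n.+1%:R -> root_eq (robin_param n a) n a.
Proof.
move=> an; split => //; have c0 := phase_cos_gt0 an.
by rewrite /robin_param /tan mulrA divfK// gt_eqF.
Qed.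

Lemma tan_phase_lt (a b : R) n : n%:R <= a -> a < b -> b < n.+1%:R ->
  tan (phase a n) < tan (phase b n).
Proof.
move=> na ab bn.
have [a0 a1] := andP (@phase_bound _ a n ltac:(by rewrite na (lt_trans ab bn))).
have [b0 b1] := andP (@phase_bound _ b n ltac:(by rewrite bn (ltW (le_lt_trans na ab)))).
have p : 0 < pi / 2 :> R by rewrite divr_gt0 ?pi_gt0.
by rewrite ltr_tan ?in_itv/=; [rewrite /phase ltr_pM2r// ltrD2r|lra|lra].
Qed.

Lemma tan_phase_ge0 (a : R) n : n%:R <= a < n.+1%:R -> 0 <= tan (phase a n).
Proof.
move=> an; have /andP[p0 p1] := phase_bound an.
rewrite /tan divr_ge0 ?(ltW (phase_cos_gt0 an))// sin_ge0_pi// p0/=.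
by have := pi_gt0 R; lra.
Qed.

Lemma robin_param_lt (a b : R) n : n%:R <= a -> a < b -> b < n.+1%:R ->
  robin_param n a < robin_param n b.
Proof.
move=> na ab bn; have t := tan_phase_lt na ab bn.
have a0 : 0 <= a by apply: le_trans na; exact: ler0n.
have ta := tan_phase_ge0 (_ : n%:R <= a < n.+1%:R).
have {}ta := ta ltac:(by rewrite na (lt_trans ab bn)).
rewrite /robin_param; apply: (@le_lt_trans _ _ (a * tan (phase b n))).
  by rewrite ler_wpM2l// ltW.
by rewrite ltr_pM2r//; exact: le_lt_trans t.
Qed.

Lemma robin_param_ge0 (a : R) n : n%:R <= a < n.+1%:R -> 0 <= robin_param n a.
Proof.
move=> an; rewrite mulr_ge0 ?tan_phase_ge0//.
by case/andP: an => na _; apply: le_trans na; exact: ler0n.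
Qed.

Lemma root_eq_unique h n (a b : R) : root_eq h n a -> root_eq h n b -> a = b.
Proof.
move=> Ha Hb; have [/andP[na an] _] := Ha; have [/andP[nb bn] _] := Hb.
have ta := root_eq_param Ha; have tb := root_eq_param Hb.
case: (ltgtP a b) => // ab.
  by have := robin_param_lt na ab bn; rewrite ta tb ltxx.
by have := robin_param_lt nb ab an; rewrite ta tb ltxx.
Qed.

Lemma right_increase (f : R -> R) (c b l : R) : is_derive c (1:R) f l -> 0 < l -> c < b ->
  exists2 t, c < t < b & f c < f t.
Proof.
move=> [df fl] l0 cb.
have : (fun h : R => h^-1 *: ((f \o shift c) (h *: (1:R)) - f c)) @ (0:R)^' --> l.
  by rewrite -fl; exact: df.
move=> /cvgrPdist_lt/(_ _ l0); rewrite near_withinE => /nbhs_ballP[e /= e0 He].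
pose t := Num.min (e / 2) ((b - c) / 2).
have t0 : 0 < t by rewrite lt_min !divr_gt0// subr_gt0.
have te : t < e by apply: (@le_lt_trans _ _ (e / 2)); [rewrite ge_min lexx|lra].
have tb : t < b - c by apply: (@le_lt_trans _ _ ((b - c) / 2)); [rewrite ge_min lexx orbT|lra].
have := He t; rewrite -ball_normE /ball_/= sub0r normrN (gtr0_norm t0) => /(_ te).
move=> /(_ (lt0r_neq0 t0)) /=; rewrite /GRing.scale/= mulr1 => H.
exists (t + c); first by rewrite ltrDr t0/=; lra.
have : 0 < t^-1 * (f (t + c) - f c).
  by move: H; rewrite ltr_norml => /andP[_]; lra.
by rewrite pmulr_rgt0 ?invr_gt0// subr_gt0.
Qed.

(** A maximum over [[a, b]] cannot lie at a point [m < b] with [f m >= 0], since the derivative is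
    positive there. If [f b <= 0], such a maximum exists nevertheless: when the maximum is attained
    at [b], it is attained at [a] as well. *)
Lemma single_crossing (f f' : R -> R) (a b : R) :
  (forall x : R, 0 < x -> is_derive x (1:R) f (f' x)) ->
  (forall x, 0 < x -> 0 <= f x -> 0 < f' x) ->
  0 < a -> a < b -> 0 <= f a -> 0 < f b.
Proof.
move=> df pos a0 ab fa.
have wf : {within `[a, b], continuous f}.
  apply: derivable_within_continuous => t; rewrite in_itv/= => /andP[at_ _].
  by have [] := df t (lt_le_trans a0 at_).
have [c] := EVT_max (ltW ab) wf; rewrite in_itv/= => /andP[ac cb] Hc.
have nomax m : a <= m -> m < b -> (forall t, t \in `[a, b]%R -> f t <= f m) -> 0 <= f m -> False.
  move=> am mb Hm fm; have m0 := lt_le_trans a0 am.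
  have [t /andP[mt tb] ft] := right_increase (df m m0) (pos m m0 fm) mb.
  have := Hm t; rewrite in_itv/= (ltW tb) (ltW (le_lt_trans am mt)) => /(_ isT).
  by rewrite leNgt ft.
have fac : f a <= f c by apply: Hc; rewrite in_itv/= lexx ltW.
rewrite ltNge; apply/negP => fb.
move: cb; rewrite le_eqVlt => /orP[/eqP cb|cb]; last first.
  exact: (nomax c ac cb Hc (le_trans fa fac)).
apply: (nomax a (lexx a) ab _ fa) => t tab; apply: (le_trans (Hc t tab)).
by rewrite cb; exact: le_trans fb fa.
Qed.

Lemma robin_param_derive n (a : R) : n%:R < a < n.+1%:R ->
  is_derive a (1:R) (robin_param n)
    (tan (phase a n) + a * ((1 + tan (phase a n) ^+ 2) * (pi / 2))).
Proof.
move=> /andP[na an].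
have c0 : cos (phase a n) != 0 by rewrite gt_eqF// phase_cos_gt0// (ltW na).
have dp : is_derive a (1:R) (fun x => phase x n) (pi / 2).
  have H : is_derive a (1:R) (fun x => pi / 2 * x - pi / 2 * n%:R) (pi / 2 * 1 - 0) :=
    is_deriveB (is_deriveZ (pi / 2) (is_derive_id a 1)) (is_derive_cst (pi / 2 * n%:R) a 1).
  rewrite (_ : (fun x => phase x n) = (fun x => pi / 2 * x - pi / 2 * n%:R)).
    by apply: (is_derive_eq H); rewrite subr0 mulr1.
  by apply/funext => x; rewrite /phase; ring.
have dt : is_derive a (1:R) (fun x => tan (phase x n)) _ :=
  @is_derive1_comp _ (@tan R) (fun x => phase x n) _ _ _ (is_derive_tan c0) dp.
apply: (is_derive_eq (is_deriveM (is_derive_id a 1) dt)).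
rewrite /GRing.scale/= mulr1 addrC; congr (_ + _ * (_ * _)).
have s2 := cos2Dsin2 (phase a n).
rewrite /tan expr_div_n (_ : sin _ ^+ 2 = 1 - cos (phase a n) ^+ 2); first by field.
by rewrite -s2; ring.
Qed.

(** * The branches as functions of the Robin parameter *)

Section Branch.
Variables (n : nat) (g : R -> R).
Hypothesis Hg : forall h, 0 <= h -> root_eq h n (g h).

Lemma branch_gt (h : R) : 0 < h -> n%:R < g h.
Proof.
move=> h0; have [/andP[ng gn] E] := Hg (ltW h0).
rewrite lt_neqAle ng andbT; apply/eqP => e.
have := root_eq_param (Hg (ltW h0)); rewrite /robin_param /phase -e subrr mul0r tan0 mulr0 => e0.
by rewrite -e0 ltxx in h0.
Qed.

(** The inverse function rule for [robin_param n], in which [tan (phase (g h) n)] equals [h / g h].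
    The formula contains [n] only through [g h]: one differential equation governs all branches, so
    that their rates can be compared by concavity. *)
Lemma branch_derive (h : R) : 0 < h ->
  is_derive h (1:R) (fun x => g x ^+ 2)
    (2 * g h ^+ 2 / (h + pi / 2 * h ^+ 2 + pi / 2 * g h ^+ 2)).
Proof.
move=> h0; have H := Hg (ltW h0); have [/andP[ng gn] E] := H.
have gh := branch_gt h0; have Ep := root_eq_param H.
have g0 : 0 < g h by apply: le_lt_trans gh; exact: ler0n.
have p : 0 < pi / 2 :> R by rewrite divr_gt0 ?pi_gt0.
have nr : \forall x \near g h, n%:R < x < n.+1%:R.
  have : nbhs (g h) (`]n%:R, n.+1%:R[%classic : set R).
    by apply: open_nbhs_nbhs; split; [exact: interval_open|rewrite /= in_itv/= gh gn].
  by apply: filterS => x; rewrite /= in_itv.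
have dT := robin_param_derive (_ : n%:R < g h < n.+1%:R).
have {}dT := dT ltac:(by rewrite gh gn).
have tE : tan (phase (g h) n) = h / g h.
  apply: (mulfI (lt0r_neq0 g0)).
  by rewrite [RHS]mulrCA mulfV ?mulr1 ?lt0r_neq0.
rewrite tE in dT.
set D := h / g h + _ in dT.
have D0 : 0 < D.
  by rewrite /D addr_gt0 ?divr_gt0// mulr_gt0// mulr_gt0// ltr_wpDr// sqr_ge0.
have := @is_derive_inverse R (robin_param n) g D (g h) _ _ dT (lt0r_neq0 D0).
rewrite Ep => /(_ _ _)dg.
have {}dg : is_derive h (1:R) g D^-1.
  apply: dg.
    apply: filterS nr => x /andP[nx xn].
    have xr : n%:R <= x < n.+1%:R by rewrite ltW.
    exact: root_eq_unique (Hg (robin_param_ge0 xr)) (param_root_eq xr).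
  apply: filterS nr => x xr; apply: differentiable_continuous; apply/derivable1_diffP.
  by have [] := robin_param_derive xr.
have dg2 : is_derive h (1:R) (fun x => g x * g x) _ := is_deriveM dg dg.
rewrite (_ : (fun x => g x ^+ 2) = (fun x => g x * g x)); last by apply/funext.
apply: (is_derive_eq dg2); rewrite /GRing.scale/= /D.
have X0 : 0 < h + pi / 2 * h ^+ 2 + pi / 2 * g h ^+ 2.
  by rewrite !addr_gt0// mulr_gt0// exprn_gt0.
have -> : h / g h + g h * ((1 + (h / g h) ^+ 2) * (pi / 2)) =
   (h + pi / 2 * h ^+ 2 + pi / 2 * g h ^+ 2) / g h by field; rewrite gt_eqF.
set X := h + pi / 2 * h ^+ 2 + pi / 2 * g h ^+ 2 in X0 *.
by rewrite invf_div; field; rewrite lt0r_neq0.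
Qed.

End Branch.

(** With [k = pi / 2], [c = h + k h^2] and [x = c + k mu], the left side is the rate of a branch;
    the right side shows it as a strictly concave function of [x > 0]. *)
Lemma phi_identity (k c x : R) : k != 0 -> x != 0 ->
  2 * ((x - c) / k) / x = 2 / k * (1 - c / x).
Proof. by move=> k0 x0; field; rewrite x0 k0. Qed.

(** The rate of the gap, with [x], [y], [z] belonging to the branches [0], [2], [3]. Its sign is
    that of [(x + z) y - 2 x z], which is positive when [x + z <= 2 y] and [x < z], because
    [(x + z)^2 > 4 x z]. *)
Lemma gap_identity (k c x y z : R) : k != 0 -> x != 0 -> y != 0 -> z != 0 ->
  2 * (2 / k * (1 - c / y)) - 2 / k * (1 - c / x) - 2 / k * (1 - c / z)
  = 2 / k * (c * (((x + z) * y - 2 * (x * z)) / (x * y * z))).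
Proof. by move=> k0 x0 y0 z0; field; rewrite x0 y0 z0 k0. Qed.

Definition gap (al : nat -> R) : R := 2 * al 2%N ^+ 2 - al 0%N ^+ 2 - al 3%N ^+ 2.

Lemma crossing : exists2 h9 : R, 0 < h9 &
  (forall h al, 0 <= h <= h9 -> (forall n, root_eq h n (al n)) -> gap al <= 0) /\
  (forall h al, h9 < h -> (forall n, root_eq h n (al n)) -> 0 < gap al).
Proof.
(* The frequencies as functions of [h]; for negative [h] they get the default [0]. *)
have /choice[a Ha] : forall h : R, exists al : nat -> R, 0 <= h -> forall n, root_eq h n (al n).
  move=> h; have [h0|h0] := leP 0 h; last first.
    by exists (fun=> 0).
  by have [al Hal] := choice (fun n => root_eq_exists n h0); exists al.
pose f h := gap (a h).
have gapE h al : 0 <= h -> (forall n, root_eq h n (al n)) -> gap al = f h.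
  move=> h0 Hal; congr gap; apply/funext => n.
  exact: root_eq_unique (Hal n) (Ha h h0 n).
pose br n h := a h n.
have Hbr n h : 0 <= h -> root_eq h n (br n h) by move=> h0; exact: Ha.
pose phi h mu : R := 2 * mu / (h + pi / 2 * h ^+ 2 + pi / 2 * mu).
pose f' h := 2 * phi h (br 2%N h ^+ 2) - phi h (br 0%N h ^+ 2) - phi h (br 3%N h ^+ 2).
have df (h : R) : 0 < h -> is_derive h (1:R) f (f' h).
  move=> h0; have d n := branch_derive (Hbr n) h0.
  exact: is_deriveB (is_deriveB (is_deriveZ 2 (d 2%N)) (d 0%N)) (d 3%N).
have pos h : 0 < h -> 0 <= f h -> 0 < f' h.
  move=> h0 fh; have p : 0 < pi / 2 :> R by rewrite divr_gt0 ?pi_gt0.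
  have Hal := Ha h (ltW h0).
  pose c := h + pi / 2 * h ^+ 2.
  have c0 : 0 < c by rewrite addr_gt0// mulr_gt0// exprn_gt0.
  pose X n := c + pi / 2 * br n h ^+ 2.
  have X0 n : 0 < X n by rewrite ltr_wpDr// mulr_ge0 ?sqr_ge0// ltW.
  have phiE n : phi h (br n h ^+ 2) = 2 / (pi / 2) * (1 - c / X n).
    have := X0 n; rewrite /phi -/c -/(X n) => x0.
    have -> : br n h ^+ 2 = (X n - c) / (pi / 2).
      by rewrite /X addrAC subrr add0r mulrC mulKf// lt0r_neq0.
    exact: phi_identity (lt0r_neq0 p) (lt0r_neq0 x0).
  have sq m n : (m < n)%N -> br m h ^+ 2 < br n h ^+ 2.
    move=> mn; rewrite ltr_pXn2r ?nnegrE ?(al_ge0 Hal)//.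
    exact: (al_incr Hal mn).
  have XX m n : (m < n)%N -> X m < X n by move=> /sq H; rewrite /X ltrD2l ltr_pM2l.
  have mid : X 0%N + X 3%N <= 2 * X 2%N.
    have : 0 <= pi / 2 * f h by rewrite mulr_ge0// ltW.
    by rewrite /f /gap /X /br; lra.
  rewrite /f' !phiE (gap_identity c (lt0r_neq0 p) (lt0r_neq0 (X0 0%N)) (lt0r_neq0 (X0 2%N)) (lt0r_neq0 (X0 3%N))).
  apply: mulr_gt0; first exact: divr_gt0.
  apply: mulr_gt0 => //; apply: divr_gt0; last by rewrite !mulr_gt0.
  have H03 := XX 0%N 3%N isT; have x0 := X0 0%N; have x3 := X0 3%N.
  have : 0 < (X 3%N - X 0%N) ^+ 2 by rewrite exprn_gt0// subr_gt0.
  have : (X 0%N + X 3%N) * (X 0%N + X 3%N) <= (X 0%N + X 3%N) * (2 * X 2%N).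
    by rewrite ler_pM2l// addr_gt0.
  by move=> A B; nra.
(* The parameters at which [al 2] is [2.1] and [2.95]. Twice its square is [8.82 < 9 <= al 3 ^ 2] at
   the first, and [17.405], above the bound [1 + 16] for [al 0 ^ 2 + al 3 ^ 2], at the second. *)
pose hl := robin_param 2 (21 / 10 : R); pose hr := robin_param 2 (59 / 20 : R).
have rl : 2%:R <= (21 / 10 : R) < 3%:R by lra.
have rr : 2%:R <= (59 / 20 : R) < 3%:R by lra.
have hl0 : 0 < hl.
  apply: (@le_lt_trans _ _ (robin_param 2 (2%:R : R))); last by apply: robin_param_lt; lra.
  by apply: robin_param_ge0; lra.
have hlr : hl < hr by apply: robin_param_lt; lra.
have hr0 : 0 < hr := lt_trans hl0 hlr.
have val x h : 2%:R <= x < 3%:R -> h = robin_param 2 x -> 0 <= h -> a h 2%N = x.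
  by move=> xr -> h0; exact: root_eq_unique (Ha _ h0 2%N) (param_root_eq xr).
have sqb h n : 0 <= h -> n%:R ^+ 2 <= a h n ^+ 2 /\ a h n ^+ 2 < n.+1%:R ^+ 2.
  move=> h0; have Hal := Ha h h0; split.
    by rewrite lerXn2r ?nnegrE ?ler0n ?(al_ge0 Hal)//; exact: (al_ge Hal).
  by rewrite ltr_pXn2r ?nnegrE ?ler0n ?(al_ge0 Hal)//; exact: (al_lt Hal).
have fl : f hl < 0.
  have [b3 _] := sqb hl 3%N (ltW hl0); have [b0 _] := sqb hl 0%N (ltW hl0).
  by rewrite /f /gap (val _ hl rl)//; [lra|exact: ltW].
have fr : 0 < f hr.
  have [_ b3] := sqb hr 3%N (ltW hr0); have [_ b0] := sqb hr 0%N (ltW hr0).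
  by rewrite /f /gap (val _ hr rr)//; [lra|exact: ltW].
have wf : {within `[hl, hr], continuous f}.
  apply: derivable_within_continuous => t; rewrite in_itv/= => /andP[lt_ _].
  by have [] := df t (lt_le_trans hl0 lt_).
have [|h9] := @IVT _ f hl hr 0 (ltW hlr) wf.
  by rewrite ge_min le_max (ltW fl) (ltW fr) orbT.
rewrite in_itv/= => /andP[lh9 _] f9.
have h90 := lt_le_trans hl0 lh9.
exists h9 => //; split => h al.
  move=> /andP[h0 hh9] Hal; rewrite (gapE h al h0 Hal) leNgt; apply/negP => fh.
  move: hh9; rewrite le_eqVlt => /orP[/eqP e|hh9]; first by move: fh; rewrite e f9 ltxx.
  move: h0; rewrite le_eqVlt => /orP[/eqP e|h0]; last first.
    by have := single_crossing df pos h0 hh9 (ltW fh); rewrite f9 ltxx.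
  (* The derivative is available for [h > 0] only. At [h = 0] the frequencies are the integers, and
     the gap is [8 - 9]. *)
  have root0 n : root_eq 0 n (n%:R : R).
    split; first by rewrite lexx ltr_nat ltnSn.
    by rewrite /phase subrr mul0r sin0 mulr0 mul0r.
  by move: fh; rewrite -e -(gapE 0 (fun n => n%:R) (lexx 0) root0) /gap; lra.
move=> h9h Hal; rewrite (gapE h al (ltW (lt_trans h90 h9h)) Hal).
by apply: (single_crossing df pos h90 h9h); rewrite f9.
Qed.

End Crossing.

(** * Nodal domains *)

(** The indices smaller than their partners are exactly one half: [t] maps them onto their
    complement. *)
Lemma involution_even (n : nat) (t : 'I_n -> 'I_n) :
  (forall i, t (t i) = i) -> (forall i, t i != i) -> ~~ odd n.
Proof.
move=> tt tn; have t_inj : injective t by exact: (can_inj tt).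
pose A : {set 'I_n} := [set i : 'I_n | (i < t i)%N]%SET.
have tA : t @: A = ~: A.
  apply/setP => i; rewrite !inE -leqNgt; apply/imsetP/idP => [[j]|ti].
    by rewrite inE => jt ->; rewrite tt ltnW.
  exists (t i); last by rewrite tt.
  by rewrite inE tt ltn_neqAle ti andbT; apply: contraNneq (tn i) => /val_inj ->.
have := cardsC A; rewrite -tA (card_imset _ t_inj) card_ord => <-.
by rewrite addnn odd_double.
Qed.

Section AntisymmetricNodalDomains.
Context {R : realType}.
Variables (Om : set (R * R)) (s : R * R -> R * R) (v : R * R -> R).
Hypotheses (ss : forall x, s (s x) = x) (s_cont : continuous s).
Hypotheses (s_Om : forall x, Om x -> Om (s x)).
Hypothesis v_cont : forall x, Om x -> {for x, continuous v}.
Hypothesis v_anti : forall x, Om x -> v (s x) = - v x.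

Let Z := Om `&` [set x | v x = 0].
Let N := Om `\` closure Z.

Let sZ x : Z x -> Z (s x).
Proof. by move=> [Ox /= vx]; split; [exact: s_Om|rewrite /= v_anti// vx oppr0]. Qed.

Let s_closure x : closure Z x -> closure Z (s x).
Proof.
move=> cx B Bsx; have /cx[y [Zy By]] : nbhs x (s @^-1` B) by exact: s_cont.
by exists (s y); split => //; exact: sZ.
Qed.

Let sN x : N x -> N (s x).
Proof. by move=> [Ox nx]; split; [exact: s_Om|move=> /s_closure; rewrite ss]. Qed.

Let s_component_sub x : N x -> s @` connected_component N x `<=` connected_component N (s x).
Proof.
move=> Nx; apply: connected_component_max.
- by exists x => //; exact: connected_component_refl.
- by move=> _ [y /connected_component_sub Ny <-]; exact: sN.
- apply: connected_continuous_connected; first exact: component_connected.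
  exact: continuous_subspaceT.
Qed.

Let s_component x : N x -> s @` connected_component N x = connected_component N (s x).
Proof.
move=> Nx; apply/seteqP; split; first exact: s_component_sub.
move=> y Hy; exists (s y) => //.
have := s_component_sub (sN Nx); rewrite ss; apply.
by exists y.
Qed.

(** A component fixed by [s] would contain both [x] and [s x], where [v] takes opposite values;
    being connected, it would contain a zero of [v], but the zeros have been removed from [N]. *)
Let s_component_neq x : N x -> connected_component N (s x) <> connected_component N x.
Proof.
move=> Nx E; set C := connected_component N x.
have CN : C `<=` N by exact: connected_component_sub.
have wv : {within C, continuous v}.
  by apply: continuous_in_subspaceT => y; rewrite inE => /CN[Oy _]; exact: v_cont.
have cx : C x by exact: connected_component_refl.
have csx : C (s x).
  by rewrite /C -E; apply: connected_component_refl; exact: sN.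
have /connected_intervalP vC := connected_continuous_connected (@component_connected _ N x) wv.
have [y Cy vy] : (v @` C) 0.
  have vx : (v @` C) (v x) by exists x.
  have vsx : (v @` C) (- v x) by exists (s x) => //; rewrite v_anti//; case: Nx.
  have [v0|v0] := leP 0 (v x).
    by apply: (vC _ _ vsx vx); rewrite oppr_le0 v0.
  by apply: (vC _ _ vx vsx); rewrite oppr_ge0 ltW.
have [Oy ny] := CN _ Cy.
by apply: ny; apply: subset_closure.
Qed.

(** A bijection with [I_n] would turn the action of [s] on the nodal domains into an involution of
    the indices without fixed points. *)
Lemma nodal_domains_not_odd n : odd n -> ~ (nodal_domains Om v #= `I_n)%card.
Proof.
move=> on /card_set_bijP[f [f_fun f_inj f_surj]].
have sND D : nodal_domains Om v D -> nodal_domains Om v (s @` D).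
  by move=> [x Nx <-]; exists (s x); [exact: sN|rewrite -/N -/Z s_component].
have ssD (D : set (R * R)) : s @` (s @` D) = D.
  apply/seteqP; split => [_ [_ [x Dx <-] <-]|x Dx]; first by rewrite ss.
  by exists (s x); [exists x|rewrite ss].
have nND D : nodal_domains Om v D -> s @` D <> D.
  by move=> [x Nx <-]; rewrite -/N -/Z s_component//; exact: s_component_neq.
have /choice[g Hg] : forall i : 'I_n, exists D : set (R * R), nodal_domains Om v D /\ f D = i.
  by move=> i; have [D HD fD] := f_surj i (ltn_ord i); exists D.
have lt_f i : (f (s @` g i) < n)%N by apply: f_fun; apply: sND; have [] := Hg i.
pose t i := Ordinal (lt_f i).
have gt i : g (t i) = s @` g i.
  have [H1 H2] := Hg (t i); have [H3 _] := Hg i.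
  by apply: f_inj; rewrite ?inE//; exact: sND.
suff : ~~ odd n by rewrite on.
apply: (@involution_even n t).
  move=> i; apply: val_inj => /=.
  by rewrite gt ssD; have [] := Hg i.
move=> i; apply/eqP => ti; have [H _] := Hg i.
by apply: (nND _ H); rewrite -gt ti.
Qed.

End AntisymmetricNodalDomains.

(** * The nine cells of a product with two zeros in each factor *)

Section Grid.
Context {R : realType}.
Variables (S : square R) (v1 : R -> R) (c1 c2 : R).
Local Notation L := (side_length S).
Hypotheses (c12 : 0 < c1 /\ c1 < c2 /\ c2 < L).
Hypothesis v1_cont : continuous v1.
Hypothesis v1_zero : forall x, 0 < x < L -> v1 x = 0 <-> x = c1 \/ x = c2.

Definition prod_fun (q : R * R) : R := v1 (coord S q).1 * v1 (coord S q).2.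

Definition strip (x : R) : nat := if x < c1 then 0%N else if x < c2 then 1%N else 2%N.
Definition cell (q : R * R) : nat := (strip (coord S q).1 * 3 + strip (coord S q).2)%N.
Let N := square_set S `\` closure (square_set S `&` [set x | prod_fun x = 0]).

Let off_grid x := 0 < x < L /\ x <> c1 /\ x <> c2.

Let prod_fun_cont : continuous prod_fun.
Proof.
have c1' : continuous (fun q => (coord S q).1).
  by apply: (@cont_comp _ _ _ (fun p : R * R => p.1)); [exact: coord_cont|exact: cont_fst (@cont_id _)].
have c2' : continuous (fun q => (coord S q).2).
  by apply: (@cont_comp _ _ _ (fun p : R * R => p.2)); [exact: coord_cont|exact: cont_snd (@cont_id _)].
by apply: contM; apply: (@cont_comp _ _ _ v1).
Qed.

(** The zero set of the continuous [prod_fun] is closed, so inside the square the closure adds no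
    points to it. *)
Let NE q : N q <-> off_grid (coord S q).1 /\ off_grid (coord S q).2.
Proof.
have nz x : 0 < x < L -> v1 x <> 0 <-> x <> c1 /\ x <> c2.
  move=> xL; have := v1_zero xL => -[H1 H2]; split.
    by move=> v0; split => e; apply: v0; apply: H2; [left|right].
  by move=> [e1 e2] /H1[].
have boxE : square_set S q <-> 0 < (coord S q).1 < L /\ 0 < (coord S q).2 < L.
  by rewrite square_coordE /box/= !in_itv/=.
have ND : N q <-> square_set S q /\ prod_fun q <> 0.
  split=> [[Sq nq]|[Sq nq]]; split => //.
    by move=> q0; apply: nq; apply: subset_closure.
  have cl : closed (prod_fun @^-1` [set 0]).
    by have /continuous_closedP := prod_fun_cont; apply; exact: closed_eq.
  move=> H; apply: nq; have : closure (prod_fun @^-1` [set 0]) q.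
    by move: H; apply: closureS => x [].
  by rewrite -((closure_id _).1 cl).
rewrite ND boxE /prod_fun /off_grid.
set a := (coord S q).1; set b := (coord S q).2.
split=> [[[aL bL] nab]|[[aL na] [bL nb]]].
  have [a0 b0] : v1 a <> 0 /\ v1 b <> 0.
    by split => e; apply: nab; rewrite e ?mul0r ?mulr0.
  by split; split => //; apply/nz.
split => // /eqP; rewrite mulf_eq0 => /orP[]/eqP; last exact: (nz b bL).2.
exact: (nz a aL).2.
Qed.

Let strip_interval (J : set R) x y : is_interval J -> ~ J c1 -> ~ J c2 -> J x -> J y -> strip x = strip y.
Proof.
move=> Ji n1 n2.
wlog xy : x y / x <= y => [W|Jx Jy].
  by have [/W//|/ltW /W H Jx Jy] := leP x y; exact/esym/H.
have N1 : ~ (x <= c1 <= y) by move=> H; apply: n1; exact: (Ji x y).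
have N2 : ~ (x <= c2 <= y) by move=> H; apply: n2; exact: (Ji x y).
have [c1_0 [c1_2 c2_L]] := c12.
rewrite /strip; case: (ltP x c1) => x1; case: (ltP y c1) => y1 //.
- by case: N1; rewrite y1 ltW.
- by have := lt_le_trans y1 x1; rewrite ltNge xy.
- case: (ltP x c2) => x2; case: (ltP y c2) => y2 //.
    by case: N2; rewrite y2 ltW.
  by have := lt_le_trans y2 x2; rewrite ltNge xy.
Qed.

Let off_strip x : off_grid x ->
  [\/ strip x = 0%N /\ 0 < x < c1, strip x = 1%N /\ c1 < x < c2 | strip x = 2%N /\ c2 < x < L].
Proof.
have [c1_0 [c1_2 c2_L]] := c12.
move=> [/andP[x0 xL] [n1 n2]]; rewrite /strip; case: (ltgtP x c1) => // x1.
  by apply: Or31; rewrite x0.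
case: (ltgtP x c2) => // x2; first by apply: Or32.
by apply: Or33.
Qed.

Let strip_between x y t : off_grid x -> off_grid y -> strip x = strip y -> 0 <= t <= 1 ->
  off_grid (x + t * (y - x)).
Proof.
have [c1_0 [c1_2 c2_L]] := c12.
have conv lo hi a b : lo < a < hi -> lo < b < hi -> 0 <= t <= 1 -> lo < a + t * (b - a) < hi.
  move=> /andP[a1 a2] /andP[b1 b2] /andP[t0 t1].
  have -> : a + t * (b - a) = (1 - t) * a + t * b by ring.
  have [->|tn0] := eqVneq t 0; first by rewrite subr0 mul1r mul0r addr0 a1.
  have tp : 0 < t by rewrite lt_neqAle eq_sym tn0.
  have H1 : t * lo < t * b by rewrite ltr_pM2l.
  have H2 : t * b < t * hi by rewrite ltr_pM2l.
  have H3 : (1 - t) * lo <= (1 - t) * a by rewrite ler_wpM2l ?subr_ge0// ltW.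
  have H4 : (1 - t) * a <= (1 - t) * hi by rewrite ler_wpM2l ?subr_ge0// ltW.
  by apply/andP; split; lra.
move=> ox oy exy t01.
have : [\/ 0 < x + t * (y - x) < c1, c1 < x + t * (y - x) < c2 | c2 < x + t * (y - x) < L].
  have [[sx bx]|[sx bx]|[sx bx]] := off_strip ox; have [[sy by_]|[sy by_]|[sy by_]] := off_strip oy;
    move: exy; rewrite sx sy => // _.
  - by apply: Or31; exact: conv.
  - by apply: Or32; exact: conv.
  - by apply: Or33; exact: conv.
by case=> /andP[h1 h2]; split; [lra|split; lra|lra|split; lra|lra|split; lra].
Qed.

Let strip_lt x : (strip x < 3)%N.
Proof. by rewrite /strip; case: ifP => // _; case: ifP. Qed.

(** A component lies in one cell because its two projections are intervals that avoid [c1] and [c2].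
    Conversely, the segment between two points of the same cell stays off the grid. *)
Let cell_component q : N q -> connected_component N q = [set r | N r /\ cell r = cell q].
Proof.
move=> Nq; apply/seteqP; split => r.
  move=> Cr; have Nr : N r by exact: connected_component_sub Cr.
  split => //.
  have cq : connected_component N q q by exact: connected_component_refl.
  have proj (pr : R * R -> R) : continuous pr ->
      (forall q, N q -> pr (coord S q) <> c1 /\ pr (coord S q) <> c2) ->
      strip (pr (coord S r)) = strip (pr (coord S q)).
    move=> cpr Hpr.
    have cf : continuous (fun q => pr (coord S q)).
      by apply: (@cont_comp _ _ _ pr) => //; exact: coord_cont.
    have /connected_intervalP J := connected_continuous_connected (@component_connected _ N q)
      (continuous_subspaceT cf).
    apply: (strip_interval J).
    - by move=> [y /connected_component_sub /Hpr[]].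
    - by move=> [y /connected_component_sub /Hpr[]].
    - by exists r.
    - by exists q.
  rewrite /cell (proj (fun p => p.1)); last 2 first.
  - exact: cont_fst (@cont_id _).
  - by move=> y /NE[[_ ?] _].
  rewrite (proj (fun p => p.2))//; first exact: cont_snd (@cont_id _).
  by move=> y /NE[_ [_ ?]].
move=> [Nr crq].
have [e1 e2] : strip (coord S q).1 = strip (coord S r).1 /\ strip (coord S q).2 = strip (coord S r).2.
  have := strip_lt (coord S q).1; have := strip_lt (coord S q).2.
  have := strip_lt (coord S r).1; have := strip_lt (coord S r).2.
  by move: crq; rewrite /cell; lia.
pose path (t : R) := place S ((coord S q).1 + t * ((coord S r).1 - (coord S q).1),
                      (coord S q).2 + t * ((coord S r).2 - (coord S q).2)).
have path_cont : continuous path.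
  have H : continuous (fun t : R => ((coord S q).1 + t * ((coord S r).1 - (coord S q).1),
      (coord S q).2 + t * ((coord S r).2 - (coord S q).2))) by apply: cont_pair; continuity.
  by move=> t; apply: (continuous_comp (H t)); exact: place_cont.
have pathN : path @` `[0, 1] `<=` N.
  move=> _ [t /= + <-]; rewrite in_itv/= => t01; apply/NE; rewrite placeK/=.
  have [q1 q2] := (NE q).1 Nq; have [r1 r2] := (NE r).1 Nr.
  by split; exact: strip_between.
have path0 : path 0 = q by rewrite /path !mul0r !addr0 -surjective_pairing coordK.
have path1 : path 1 = r by rewrite /path !mul1r !subrKC -surjective_pairing coordK.
apply: (connected_component_max _ pathN).
- by exists 0 => //=; rewrite in_itv/= lexx ler01.
- apply: connected_continuous_connected; last exact: continuous_subspaceT.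
  by apply/connected_intervalP; exact: interval_is_interval.
- by exists 1 => //=; rewrite in_itv/= lexx ler01.
Qed.

Let strip_point k : (k < 3)%N -> exists x, off_grid x /\ strip x = k.
Proof.
have [c1_0 [c1_2 c2_L]] := c12.
case: k => [|[|[|//]]] _.
- exists (c1 / 2); split; first by split; [apply/andP; split; lra|split; lra].
  by rewrite /strip ifT//; lra.
- exists ((c1 + c2) / 2); split; first by split; [apply/andP; split; lra|split; lra].
  by rewrite /strip ifF; [rewrite ifT//; lra|apply/negbTE; rewrite -leNgt; lra].
- exists ((c2 + L) / 2); split; first by split; [apply/andP; split; lra|split; lra].
  by rewrite /strip !ifF//; apply/negbTE; rewrite -leNgt; lra.
Qed.

Lemma grid_nodal_domains : (nodal_domains S prod_fun #= `I_9)%card.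
Proof.
pose g k := [set r | N r /\ cell r = k].
have point k : (k < 9)%N -> exists2 q, N q & cell q = k.
  move=> k9; have [x [ox sx]] : exists x, off_grid x /\ strip x = (k %/ 3)%N.
    by apply: strip_point; lia.
  have [y [oy sy]] : exists y, off_grid y /\ strip y = (k %% 3)%N by apply: strip_point; lia.
  exists (place S (x, y)); first by apply/NE; rewrite placeK.
  by rewrite /cell placeK /= sx sy -divn_eq.
have -> : nodal_domains S prod_fun = g @` `I_9.
  apply/seteqP; split => [_ [q Nq <-]|_ [k /= k9 <-]].
    exists (cell q); last by rewrite -/N cell_component.
    by rewrite /= /cell; have := strip_lt (coord S q).1; have := strip_lt (coord S q).2; lia.
  have [q Nq cq] := point k k9; exists q => //.
  by rewrite -/N cell_component// cq.
apply: inj_card_eq => k m; rewrite !inE /= => k9 m9 gkm.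
have [q Nq cq] := point k k9.
have : g k q by [].
by rewrite gkm => -[_]; rewrite cq.
Qed.

End Grid.

(** * The ninth eigenvalue *)

Section SecondModeZeros.
Context {R : realType}.
Variables (h : R) (al : nat -> R) (Hal : forall n, root_eq h n (al n)).
Let c1 := (pi / 2 + tau al 2) / al 2%N.
Let c2 := (pi / 2 + pi + tau al 2) / al 2%N.

Let a0 : 0 < al 2%N.
Proof. by apply: lt_le_trans (al_ge Hal 2); rewrite ltr0n. Qed.

Lemma second_mode_order : 0 < c1 /\ c1 < c2 /\ c2 < pi.
Proof.
have /andP[t0 t1] := tau_bound Hal 2; have p := pi_gt0 R.
have E := al_pi al 2.
split; last split.
- by rewrite divr_gt0//; lra.
- by rewrite ltr_pM2r ?invr_gt0//; lra.
- by rewrite ltr_pdivrMr// mulrC; lra.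
Qed.

(** The argument of the cosine runs from [- tau] to [tau + 2 pi], where [0 <= tau < pi / 2]; between
    these it meets only the zeros [pi / 2] and [3 pi / 2]. *)
Lemma second_mode_zeros x : 0 < x < pi -> mode al 2 x = 0 <-> x = c1 \/ x = c2.
Proof.
move=> /andP[x0 xp]; have /andP[t0 t1] := tau_bound Hal 2; have p := pi_gt0 R.
have E := al_pi al 2.
have ax0 : 0 < al 2%N * x by rewrite mulr_gt0.
have axp : al 2%N * x < al 2%N * pi by rewrite ltr_pM2l.
rewrite /mode; set th := al 2%N * x - tau al 2.
have xE k : th = k <-> x = (k + tau al 2) / al 2%N.
  split=> [<-|E0]; first by rewrite /th subrK mulrC mulKf// lt0r_neq0.
  by rewrite /th E0 mulrC divfK ?addrK// lt0r_neq0.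
rewrite /c1 /c2 -!xE.
have th1 : - (pi / 2) < th by rewrite /th; lra.
have p2 : pi *+ 2 = 2 * pi :> R by rewrite mulr_natl.
have th2 : th < pi / 2 + 2 * pi by rewrite /th; lra.
split; last first.
  case=> ->; first exact: cos_pihalf.
  by rewrite cosDpi cos_pihalf oppr0.
move=> c0; have [l1|g1|e1] := ltgtP th (pi / 2); [|right|by left].
  by have := @cos_gt0_pihalf _ th; rewrite th1 l1 c0 ltxx => /(_ isT).
have [l2|g2|//] := ltgtP th (pi / 2 + pi).
  have := @cos_gt0_pihalf _ (th - pi).
  have -> : cos (th - pi) = - cos th by rewrite -[in RHS](subrK pi th) cosDpi opprK.
  by rewrite c0 oppr0 ltxx => H; have : false by apply: H; apply/andP; split; lra.
have := @cos_gt0_pihalf _ (th - pi *+ 2).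
have -> : cos (th - pi *+ 2) = cos th by rewrite -[in RHS](subrK (pi *+ 2) th) cosD2pi.
rewrite c0 ltxx => H; have : false by apply: H; rewrite p2; apply/andP; split; lra.
by [].
Qed.

End SecondModeZeros.

(** * The reflection through the center *)

Section Reflection.
Context {R : realType}.
Variable S : square R.
Local Notation L := (side_length S).

Definition reflect_center (q : R * R) : R * R :=
  place S (L - (coord S q).1, L - (coord S q).2).

Lemma reflect_centerK q : reflect_center (reflect_center q) = q.
Proof.
rewrite /reflect_center placeK /= -[RHS](coordK S); congr place.
by rewrite /coord; congr pair; ring.
Qed.

Lemma reflect_center_cont : continuous reflect_center.
Proof.
have k1 : continuous (fun q => (coord S q).1).
  by apply: (@cont_comp _ _ _ (fun p : R * R => p.1)); [exact: coord_cont|exact: cont_fst (@cont_id _)].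
have k2 : continuous (fun q => (coord S q).2).
  by apply: (@cont_comp _ _ _ (fun p : R * R => p.2)); [exact: coord_cont|exact: cont_snd (@cont_id _)].
have H : continuous (fun q => (L - (coord S q).1, L - (coord S q).2)) by apply: cont_pair; continuity.
by move=> q; apply: (continuous_comp (H q)); exact: place_cont.
Qed.

Lemma reflect_center_square q : square_set S q -> square_set S (reflect_center q).
Proof.
move=> Sq; apply/place_square; move: Sq; rewrite square_coordE => -[].
rewrite /= !in_itv/= => /andP[? ?] /andP[? ?].
by split; rewrite /= in_itv/=; apply/andP; split; lra.
Qed.

Lemma product_mode_reflect al p q : L = pi ->
  product_mode S al p (reflect_center q) = (-1) ^+ (p.1 + p.2) * product_mode S al p q.
Proof.
move=> Lpi; have H n x : mode al n (pi - x) = (-1) ^+ n * mode al n x.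
  rewrite /mode (_ : al n * (pi - x) - tau al n = - (al n * x - tau al n) + n%:R * pi).
    by rewrite cosDnpi cosN.
  by rewrite mulrBr -(subrK (tau al n) (al n * pi)) al_pi; ring.
by rewrite /product_mode placeK /= Lpi !H exprD; ring.
Qed.

(** Expansions in product modes hold almost everywhere, while nodal domains depend on values at
    points. If the functions differed at one point, by continuity they would differ on a small box,
    and its positive area would have to fit into a null set. *)
Lemma ae_eq_continuous (f g : R * R -> R) :
  (forall x, square_set S x -> {for x, continuous f}) -> continuous g ->
  f = g %[ae area in square_set S] -> forall x, square_set S x -> f x = g x.
Proof.
move=> cf cg [A [mA A0 HA]] p Sp; apply/eqP; rewrite -subr_eq0; apply/negP => /negP fg.
have cfg : {for p, continuous (fun x => f x - g x)}.
  by apply: cvgB; [exact: cf|exact: cg].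
have near_ne : \forall x \near p, f x - g x != 0.
  by apply: (cvgr_neq0 _ cfg fg).
have near_S : \forall x \near p, square_set S x.
  by apply: open_nbhs_nbhs; split => //; exact: square_open.
have /nbhs_ballP[e /= e0 He] : nbhs p (square_set S `&` [set x | f x - g x != 0]).
  exact: filterI near_S near_ne.
pose B : set (R * R) := `]p.1 - e, p.1 + e[ `*` `]p.2 - e, p.2 + e[.
have BA : B `<=` A.
  move=> x [] /=; rewrite !in_itv/= => /andP[x1 x2] /andP[y1 y2].
  have [Sx nx] : square_set S x /\ f x - g x != 0.
    by apply: He; split; apply: ball_itv.
  by apply: HA => H; move: nx; rewrite (H Sx) subrr eqxx.
have mB : measurable B by apply: measurableX; exact: measurable_itv.
have : (area B <= area A)%E by apply: le_measure => //; rewrite inE.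
have len (z : R) : lebesgue_measure (`]z - e, z + e[ : set R) = (e + e)%:E.
  rewrite lebesgue_measure_itv/= lte_fin ifT; last by lra.
  by rewrite -EFinB; congr EFin; ring.
have -> : area B = (lebesgue_measure (`](p.1 - e)%R, (p.1 + e)%R[ : set R) * lebesgue_measure (`](p.2 - e)%R, (p.2 + e)%R[ : set R))%E.
  by apply: product_measure1E; exact: measurable_itv.
rewrite A0 !len -EFinM lee_fin leNgt mulr_gt0//; exact: addr_gt0.
Qed.

End Reflection.

Section Final.
Context {R : realType}.
Variables (S : square R) (S_pi : side_length S = pi).
Variables (h : R) (h0 : 0 <= h) (al : nat -> R) (Hal : forall n, root_eq h n (al n)).
Local Notation product_eigenvalue := (product_eigenvalue al).

Let mu n := al n ^+ 2.
Let mu_lt m n : (m < n)%N -> mu m < mu n.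
Proof.
by move=> mn; rewrite /mu ltr_pXn2r ?nnegrE ?(al_ge0 Hal)//; exact: (al_incr Hal).
Qed.
Let mu_le m n : (m <= n)%N -> mu m <= mu n.
Proof. by rewrite leq_eqVlt => /orP[/eqP ->//|/mu_lt/ltW]. Qed.
Let mu_ge n : n%:R ^+ 2 <= mu n.
Proof. by rewrite /mu lerXn2r ?nnegrE ?ler0n ?(al_ge0 Hal)//; exact: (al_ge Hal). Qed.
Let mu_up n : mu n < n.+1%:R ^+ 2.
Proof. by rewrite /mu ltr_pXn2r ?nnegrE ?ler0n ?(al_ge0 Hal)//; exact: (al_lt Hal). Qed.
Let evE i j : product_eigenvalue (i, j) = mu i + mu j. Proof. by []. Qed.

(** The pairs of indices below [3] except [(2, 2)]. All of them have smaller values than [(2, 2)],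
    and a pair with a larger index has at least the value [mu 0 + mu 3]. *)
Let low8 : seq (nat * nat) :=
  [:: (0, 0); (0, 1); (1, 0); (1, 1); (0, 2); (2, 0); (1, 2); (2, 1)]%N.

Lemma ninth_sharp : gap al <= 0 -> courant_sharp S h 9.
Proof.
move=> g0; have [e [ei es sp]] := spectrum_exists S_pi h0 Hal.
have [mono _] := sp.
have gm : mu 2%N + mu 2%N <= mu 0%N + mu 3%N by move: g0; rewrite /gap /mu; lra.
(* Index [8] is the ninth value. The comparison with [mu 0 + mu 3] is not strict: at the crossing
   itself, where [(0, 3)] and [(3, 0)] share the value of [(2, 2)], this is still the ninth
   eigenvalue. *)
have lam : (product_eigenvalue \o e) 8%N = product_eigenvalue (2, 2)%N.
  apply/eqP; rewrite eq_le; apply/andP; split.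
    apply: (@count_upper _ product_eigenvalue e es (product_eigenvalue \o e) (fun=> erefl) mono 8 _ ((2, 2)%N :: low8)) => //.
    have m02 := mu_lt (isT : (0 < 2)%N); have m12 := mu_lt (isT : (1 < 2)%N).
    by move=> p; rewrite !inE => /or4P[|||/or4P[|||/or3P[]]] /eqP ->; rewrite !evE; lra.
  apply: (@count_lower _ product_eigenvalue e ei (product_eigenvalue \o e) (fun=> erefl) mono 8 _ low8) => // -[i j].
  rewrite !evE => H.
  have i3 : (i < 3)%N.
    rewrite ltnNge; apply/negP => /mu_le mi; have := mu_le (leq0n j); lra.
  have j3 : (j < 3)%N.
    rewrite ltnNge; apply/negP => /mu_le mj; have := mu_le (leq0n i); lra.
  by case: i j i3 j3 H => [|[|[|//]]] [|[|[|//]]] // _ _; rewrite ltxx.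
exists (product_eigenvalue (2, 2)%N); first by split => //; exists (product_eigenvalue \o e).
exists (product_mode S al (2, 2)%N); split.
- split; first exact: product_mode_solution.
  move=> ae; have := product_mode_dot_gt0 S_pi h0 Hal (2, 2)%N.
  have cw := @product_mode_cont _ S al (2, 2)%N.
  have z := ae_eq_continuous (fun x _ => cw x) (@contC _ _ 0) ae.
  suff -> : \int[area]_(x in S) (product_mode S al (2, 2)%N x * product_mode S al (2, 2)%N x) = 0 by rewrite ltxx.
  transitivity (\int[area]_(x in S) (cst 0 x : R)).
    by apply: eq_Rintegral => x; rewrite inE => Sx; rewrite z// mulr0.
  by rewrite Rintegral_cst ?mul0r//; exact: square_plane_measurable.
- by move=> x _; exact: product_mode_cont.
- have ord := second_mode_order Hal; have zer := @second_mode_zeros _ _ _ Hal.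
  rewrite -S_pi in ord zer.
  exact: (grid_nodal_domains ord (@mode_cont R al 2) zer).
Qed.

(** The ninth eigenvalue is confined strictly above [mu 0 + mu 2] and [2 mu 1], and strictly below
    [2 mu 2], [mu 1 + mu 3] and [mu 0 + mu 4]. Every pair with even sum has a value at or beyond one
    of these bounds: [(0, 0)], [(0, 2)], [(1, 1)] lie too low, and the others too high. *)
Lemma ninth_not_sharp : 0 < gap al -> ~ courant_sharp S h 9.
Proof.
move=> g0 [lam [_ [l sp l8]] [v [[sv _] cv card9]]].
have [mono _] := sp; have [e [ei es le]] := spectrum_pairs S_pi h0 Hal sp.
have gm : mu 0%N + mu 3%N < mu 2%N + mu 2%N by move: g0; rewrite /gap /mu; lra.
have m01 := mu_lt (isT : (0 < 1)%N); have m12 := mu_lt (isT : (1 < 2)%N).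
have m23 := mu_lt (isT : (2 < 3)%N); have m34 := mu_lt (isT : (3 < 4)%N).
have b0 := mu_up 0%N; have b1 := mu_up 1%N; have b2 := mu_up 2%N.
have B0 := mu_ge 0%N; have B3 := mu_ge 3%N; have B4 := mu_ge 4%N.
have up := @count_upper_strict _ product_eigenvalue e es l le mono 8.
have lo := @count_lower_strict _ product_eigenvalue e ei l le mono 8.
have top : lam < mu 2%N + mu 2%N.
  rewrite -l8 /=; apply: (up _ ((0, 3)%N :: low8)) => //.
  by move=> p; rewrite !inE => /or4P[|||/or4P[|||/or3P[]]] /eqP ->; rewrite !evE; lra.
have l02 : mu 0%N + mu 2%N < lam.
  rewrite -l8 /=; apply: (lo _ [:: (0, 0); (0, 1); (1, 0); (1, 1); (0, 2); (2, 0)]%N) => // -[i j].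
  rewrite evE => H; case: i j H => [|[|[|i]]] [|[|[|j]]] //= H; exfalso;
    try have := mu_le (isT : (3 <= i.+3)%N); try have := mu_le (isT : (3 <= j.+3)%N); move: H; lra.
(* A pair with an index at least [3] has value at least [9], whereas [2 mu 1 < 8]. *)
have l11 : mu 1%N + mu 1%N < lam.
  rewrite -l8 /=; apply: (lo _ [:: (0, 0); (0, 1); (1, 0); (1, 1); (0, 2); (2, 0)]%N) => // -[i j].
  rewrite evE => H; case: i j H => [|[|[|i]]] [|[|[|j]]] //= H; exfalso;
    try have := mu_le (isT : (3 <= i.+3)%N); try have := mu_le (isT : (3 <= j.+3)%N); move: H; lra.
(* The right side is at least [16], whereas [mu 1 + mu 2 < 4 + 9]. *)
have l04 : lam < mu 0%N + mu 4%N.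
  rewrite -l8 /=; apply: (up _ [:: (0, 0); (0, 1); (1, 0); (1, 1); (0, 2); (2, 0); (1, 2); (0, 3); (3, 0)]%N) => //.
  by move=> p; rewrite !inE => /or4P[|||/or4P[|||/or3P[]]] /eqP ->; rewrite !evE; lra.
have l13 : lam < mu 1%N + mu 3%N.
  rewrite -l8 /=; apply: (up _ [:: (0, 0); (0, 1); (1, 0); (1, 1); (0, 2); (2, 0); (1, 2); (0, 3); (3, 0)]%N) => //.
  by move=> p; rewrite !inE => /or4P[|||/or4P[|||/or3P[]]] /eqP ->; rewrite !evE; lra.
have odd_le i j : (i <= j)%N -> mu i + mu j = lam -> odd (i + j).
  move=> ij E; apply/negPn/negP => ev_ij.
  have i2 : (i < 2)%N.
    rewrite ltnNge; apply/negP => i2; have := mu_le i2; have := mu_le (leq_trans i2 ij); lra.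
  case: i i2 ij E ev_ij => [|[|//]] _ ij E ev_ij.
    have [j3|j3] := leqP 4 j; first by have := mu_le j3; lra.
    have j2 : (j <= 2)%N by case: j j3 ev_ij {ij E} => [|[|[|[|//]]]].
    by have := mu_le j2; lra.
  have [j3|j3] := leqP 3 j; first by have := mu_le j3; lra.
  have j1 : (j <= 1)%N by case: j j3 ev_ij {ij E} => [|[|[|//]]].
  by have := mu_le j1; lra.
have odd_lam p : product_eigenvalue p = lam -> odd (p.1 + p.2).
  case: p => i j; rewrite evE /= => E; have [ij|/ltnW ji] := leqP i j; first exact: odd_le.
  by rewrite addnC; apply: odd_le => //; rewrite addrC.
have [P [uP HP]] := level_set (product_eigenvalue_finite Hal) lam.
have expn := eigen_expansion S_pi h0 Hal uP HP sv.
have cW : continuous (fun x => \sum_(p <- P) mode_coef S al v p * product_mode S al p x).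
  by apply: cont_sum => p _; apply: contM; [exact: contC|exact: product_mode_cont].
have vW := ae_eq_continuous cv cW expn.
apply: (@nodal_domains_not_odd _ (square_set S) (reflect_center S) v (@reflect_centerK _ S)
  (@reflect_center_cont _ S) (@reflect_center_square _ S) cv _ 9) => // x Sx.
rewrite vW ?vW//; last exact: reflect_center_square.
rewrite -sumrN big_seq [RHS]big_seq; apply: eq_bigr => p /HP/odd_lam op.
by rewrite product_mode_reflect// -signr_odd op expr1; ring.
Qed.

End Final.

Theorem proposition7p3 (R : realType) (S : square R)
    (S_pi : side_length S = pi) :
  exists h9 : R, 0 < h9 /\
    (forall h : R, 0 <= h <= h9 -> courant_sharp S h 9) /\
    (forall h : R, h9 < h -> ~ courant_sharp S h 9).
Proof.
have [h9 h90 [low high]] := @crossing R.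
exists h9; split => //; split => h.
  move=> hh; have h0 : 0 <= h by case/andP: hh.
  have [al Hal] := choice (fun n => root_eq_exists n h0).
  exact: (ninth_sharp S_pi h0 Hal (low h al hh Hal)).
move=> h9h; have h0 : 0 <= h by exact: ltW (lt_trans h90 h9h).
have [al Hal] := choice (fun n => root_eq_exists n h0).
exact: (ninth_not_sharp S_pi h0 Hal (high h al h9h Hal)).
Qed.
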